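(* For $i=1,2$ let $P_i:\mathbb{C}^2\to\mathbb{C}^2$ be a holomorphic skew-product, $P_i(z,w)=(p_i(z),q_i(z,w))$, such that near the origin $$p_i(z)=z-z^2+a_iz^3+O(z^4),\qquad q_i(z,w)=w+w^2+b_iz^2+b_{0,3,i}w^3+b_{3,0,i}z^3+O(\|(z,w)\|^4),$$ with coefficients in $\mathbb{C}$, and with $b_i$ real, $b_i>\frac14$. Set $$c_i:=\frac{\sqrt{4b_i-1}}2,\qquad\alpha_i:=e^{\pi/c_i},\qquad\beta_i:=(b_{0,3,i}-a_i)(\alpha_i-1),$$ and assume $\beta_i\in\mathbb{R}$. If $P_1$ and $P_2$ are topologically conjugated on a neighborhood of the origin, then $\alpha_1=\alpha_2$ and $\beta_1=\beta_2$ (and therefore $b_1=b_2$).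
   Context: Topological conjugacy near the origin: there are open neighborhoods $U,V$ of $(0,0)$ and a homeomorphism $\mathfrak{h}:U\to V$ fixing the origin with $\mathfrak h\circ P_1=P_2\circ\mathfrak h$ wherever both sides are defined. *)

(* Defs.v *)
From Stdlib Require Import Reals.
From Coquelicot Require Import Coquelicot.

Set Implicit Arguments.
Unset Strict Implicit.

Notation C2 := (prod_NormedModule C_AbsRing C_NormedModule C_NormedModule).

(* Fréchet differentiability over the field C at every point of C^2. *)
Definition holomorphic (P : C2 -> C2) : Prop :=
  forall x : C2, ex_filterdiff (K := C_AbsRing) (U := C2) (V := C2) P (locally x).

Definition bigO_norm_pow (E : NormedModule C_AbsRing) (n : nat) (r : E -> C)
  : Prop :=
  exists M : R, locally (zero : E) (fun x => (Cmod (r x) <= M * norm x ^ n)%R).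

Definition skew_product (p : C -> C) (q : C -> C -> C) (x : C2) : C2 :=
  (p (fst x), q (fst x) (snd x)).

Definition base_expansion (p : C -> C) (a : C) : Prop :=
  bigO_norm_pow (E := C_NormedModule) 4
    (fun z : C => p z - (z - z ^ 2 + a * z ^ 3))%C.

Definition fiber_expansion (q : C -> C -> C) (b : R) (b03 b30 : C) : Prop :=
  bigO_norm_pow (E := C2) 4
    (fun x : C * C => let (z, w) := x in
      q z w - (w + w ^ 2 + RtoC b * z ^ 2 + b03 * w ^ 3 + b30 * z ^ 3))%C.

(* Outside [U] (resp. [V]) the values of [h] (resp. of its inverse [g]) are
   irrelevant. *)
Definition homeomorphism_between (X Y : UniformSpace)
    (U : X -> Prop) (V : Y -> Prop) (h : X -> Y) : Prop :=
  exists g : Y -> X,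
    (forall x, U x -> V (h x) /\ g (h x) = x) /\
    (forall y, V y -> U (g y) /\ h (g y) = y) /\
    continuous_on U h /\ continuous_on V g.

(* For [x] in [U], [P2 (h x)] is always defined, whereas [h (P1 x)] is defined
   exactly when [P1 x] is in [U]. *)
Definition topologically_conjugated_near_0 (P1 P2 : C2 -> C2) : Prop :=
  exists (U V : C2 -> Prop) (h : C2 -> C2),
    open U /\ open V /\ U zero /\ V zero /\
    homeomorphism_between U V h /\ h zero = zero /\
    (forall x : C2, U x -> U (P1 x) -> h (P1 x) = P2 (h x)).

Definition c_of (b : R) : R := (sqrt (4 * b - 1) / 2)%R.

Definition alpha_of (b : R) : R := exp (PI / c_of b).

Definition beta_of (a b03 : C) (b : R) : C :=
  ((b03 - a) * (RtoC (alpha_of b) - 1))%C.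

(* Main.v *)
Require Import Defs.
From Stdlib Require Import Reals.
From Coquelicot Require Import Coquelicot.
From Stdlib Require Import Lra Lia Psatz Classical Wf_nat.
Open Scope R_scope.

(** Write [alpha = exp (PI / c)] and [beta = th (1 - alpha)] with [a = b03 + th]. A small orbit
    with [z <> 0] satisfies [1/z_n = n + (1-a) ln n + d + o(1)], and in the coordinate [Z = -1/w]
    the fiber map is close to [Z + 1] as long as [|z|] is much smaller than [|w|]. When [w] comes
    back to the size of [z], the orbit crosses a parabolic gate: with
    [lam = -1/2 + i c], the quantity [X] given by
    [(w - lam z) / (w - conj lam z) = exp (2 i c X)] moves from 0 to [PI / c] with velocity [z],
    up to corrections of order [z^2] that can be summed explicitly. If an orbit enters the gate at
    time [m] and leaves it at time [e], this gives
    [Z_e - d = alpha (Z_m - d) + (e - alpha m - beta ln m) + O(1)].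

    Hence a small orbit which is at distance at least [eps] from the origin at time [n] is visible
    again at a time [n' = alpha n + beta ln n + O(1)], and, up to bounded shifts, at no time in
    between. Visibility at infinitely many times is transferred by a conjugacy and its inverse, so
    [alpha] and [beta] are invariants provided that such an orbit exists arbitrarily close to the origin. The height
    [Im Z - Im d] is multiplied by [alpha > 1] at each passage, up to a bounded error; a shooting
    argument on the initial height yields an orbit which returns to a fixed window of the [Z]-plane
    infinitely often. *)

(** * Complex exponential and logarithm *)

(** Two logarithms of different origin compete: the base clock contributes [(1 - a) ln n / n], the
    ends of the gate contribute [(1 - b03) ln n / n]. Both coefficients may be complex, but only
    [th = a - b03] survives, and reality of beta says exactly that [th] is real. So the logarithm
    shifts return times and never heights. The bounded error of a passage is in fact
    [K (1 + ln rho)], where [rho] is the size of [Re Z] at both ends of the gate and [K] does not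
    depend on [rho]. The construction of an orbit relies on this uniformity: between two gates the
    orbit must travel from [Re Z] near [- rho] to [Re Z] near [rho] while [w] stays small, that is,
    pass far above [Z = 0]. It is sent over it at height about [H], with [rho = 4 H], and errors of
    order [ln H] are negligible against [H]. Starting with [d = i H] makes [H] the fixed point of
    the height expansion. A conjugacy need not respect the fibers. Along the two orbits compared,
    [z] tends to 0, so being away from the origin can be read on [w] alone. *)

Lemma Cmod_minus_le (x y : C) : Cmod (x - y) <= Cmod x + Cmod y.
Proof.
  unfold Cminus. rewrite <- (Cmod_opp y). apply Cmod_triangle.
Qed.

Lemma Cmod_minus_ge (x y : C) : Cmod x - Cmod y <= Cmod (x - y).
Proof.
  assert (H := Cmod_triangle (x - y) y).
  replace (x - y + y)%C with x in H by ring. lra.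
Qed.

Lemma Cmod_plus_ge (x y : C) : Cmod x - Cmod y <= Cmod (x + y).
Proof.
  assert (H := Cmod_minus_ge x (- y)). rewrite Cmod_opp in H.
  replace (x - - y)%C with (x + y)%C in H by ring. exact H.
Qed.

Lemma Cmod_minus_sym (x y : C) : Cmod (x - y) = Cmod (y - x).
Proof.
  replace (x - y)%C with (- (y - x))%C by ring. apply Cmod_opp.
Qed.

Lemma Cmod_dist_trans (x y z : C) : Cmod (x - z) <= Cmod (x - y) + Cmod (y - z).
Proof.
  replace (x - z)%C with ((x - y) + (y - z))%C by ring. apply Cmod_triangle.
Qed.

Lemma Im_le_Cmod (x : C) : Rabs (Im x) <= Cmod x.
Proof.
  apply Rle_trans with (2 := Rmax_Cmod x). apply Rmax_r.
Qed.

Lemma Cmod_le_Re_Im (x : C) : Cmod x <= Rabs (Re x) + Rabs (Im x).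
Proof.
  destruct x as [u v]. simpl.
  replace (u, v) with (RtoC u + Ci * RtoC v)%C.
  - eapply Rle_trans; [apply Cmod_triangle|].
    rewrite Cmod_mult, Cmod_Ci, !Cmod_R. lra.
  - apply injective_projections; simpl; ring.
Qed.

Lemma Cmod_RtoC_pos (x : R) : 0 <= x -> Cmod (RtoC x) = x.
Proof. intros; rewrite Cmod_R; apply Rabs_pos_eq; trivial. Qed.

Lemma Re_ge_of_dist (x y : C) e : Cmod (x - y) <= e -> Rabs (Re x - Re y) <= e.
Proof.
  intros H. apply Rle_trans with (2 := H).
  replace (Re x - Re y) with (Re (x - y)) by (destruct x, y; reflexivity).
  apply re_le_Cmod.
Qed.

Definition cexp (u : C) : C := (exp (Re u) * cos (Im u), exp (Re u) * sin (Im u)).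

(** The principal logarithm on the right half-plane, where [atan (Im z / Re z)] is the argument. The
    logarithms below are arranged to be evaluated at numbers with positive real part, so branches
    never have to be chosen. *)
Definition clog (z : C) : C := (ln (Cmod z), atan (Im z / Re z)).

Lemma cexp_add (u v : C) : cexp (u + v) = (cexp u * cexp v)%C.
Proof.
  destruct u as [a b], v as [c d]; unfold cexp, Cmult; simpl.
  rewrite exp_plus, cos_plus, sin_plus.
  apply injective_projections; simpl; ring.
Qed.

Lemma cexp_0 : cexp 0 = 1.
Proof.
  unfold cexp; simpl. rewrite exp_0, cos_0, sin_0.
  apply injective_projections; simpl; ring.
Qed.

Lemma Cmod_cexp (u : C) : Cmod (cexp u) = exp (Re u).
Proof.
  unfold cexp, Cmod; simpl.
  replace (_ + _) with (Rsqr (exp (Re u))).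
  - apply sqrt_Rsqr. left; apply exp_pos.
  - assert (H := sin2_cos2 (Im u)). unfold Rsqr in *. nra.
Qed.

Lemma cexp_neq_0 (u : C) : cexp u <> 0.
Proof.
  apply Cmod_gt_0. rewrite Cmod_cexp. apply exp_pos.
Qed.

Lemma cexp_opp (u : C) : cexp (- u) = (/ cexp u)%C.
Proof.
  assert (H := cexp_neq_0 u).
  assert (E : (cexp (- u) * cexp u = 1)%C).
  { rewrite <- cexp_add. replace (- u + u)%C with (RtoC 0) by ring. apply cexp_0. }
  rewrite <- (Cmult_1_r (cexp (- u))), <- (Cinv_r (cexp u)) by trivial.
  rewrite Cmult_assoc, E. ring.
Qed.

Lemma cexp_2PI (u : C) : cexp (u + (0, 2 * PI)) = cexp u.
Proof.
  rewrite cexp_add. unfold cexp at 2; simpl.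
  rewrite exp_0, cos_2PI, sin_2PI.
  apply injective_projections; simpl; ring.
Qed.

Lemma cexp_clog (z : C) : 0 < Re z -> cexp (clog z) = z.
Proof.
  destruct z as [x y]; simpl; intros Hx.
  assert (Hm : 0 < Cmod (x, y)).
  { apply Rlt_le_trans with (Rabs x).
    - rewrite Rabs_pos_eq; lra.
    - apply (re_le_Cmod (x, y)). }
  unfold cexp, clog; simpl. rewrite exp_ln by trivial.
  rewrite cos_atan, sin_atan.
  assert (E : sqrt (1 + (y / x)²) = Cmod (x, y) / x).
  { replace (1 + (y / x)²) with ((x ^ 2 + y ^ 2) / (x * x)).
    - rewrite sqrt_div_alt by nra. rewrite sqrt_square by lra. reflexivity.
    - unfold Rsqr; field; lra. }
  rewrite E.
  apply injective_projections; simpl; field; lra.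
Qed.

Lemma Im_clog_bound (z : C) : Rabs (Im (clog z)) <= PI / 2.
Proof.
  unfold clog; simpl. assert (H := atan_bound (Im z / Re z)).
  apply Rabs_le; lra.
Qed.

Lemma cos_eq_1_unique t : cos t = 1 -> - (2 * PI) < t < 2 * PI -> t = 0.
Proof.
  intros Hc Ht.
  assert (Hs : sin (t / 2) = 0).
  { assert (H := cos_2a_sin (t / 2)). replace (2 * (t / 2)) with t in H by field. nra. }
  destruct (Rtotal_order t 0) as [H|[H|H]]; trivial; exfalso.
  - assert (H1 := sin_gt_0 (- (t / 2))). rewrite sin_neg in H1. lra.
  - assert (H1 := sin_gt_0 (t / 2)). lra.
Qed.

(** The two sides have the same exponential, so their imaginary parts differ by a multiple of
    [2 PI]; three arctangents add up to less than [3 PI / 2] in absolute value, which leaves only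
    0. *)
Lemma clog_mult (x y : C) :
  0 < Re x -> 0 < Re y -> 0 < Re (x * y)%C ->
  clog (x * y) = (clog x + clog y)%C.
Proof.
  intros Hx Hy Hxy.
  assert (Nx : 0 < Cmod x).
  { apply Rlt_le_trans with (1 := Hx), Rle_trans with (2 := re_le_Cmod x), Rle_abs. }
  assert (Ny : 0 < Cmod y).
  { apply Rlt_le_trans with (1 := Hy), Rle_trans with (2 := re_le_Cmod y), Rle_abs. }
  assert (ER : Re (clog (x * y)) = Re (clog x) + Re (clog y)).
  { unfold clog; simpl. rewrite Cmod_mult. apply ln_mult; trivial. }
  set (t := Im (clog (x * y)) - Im (clog x) - Im (clog y)).
  assert (Ht : t = 0).
  { apply cos_eq_1_unique.
    - assert (E : cexp (clog (x * y) - (clog x + clog y)) = 1).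
      { unfold Cminus. rewrite cexp_add, cexp_opp, cexp_add, !cexp_clog by trivial.
        apply Cinv_r. apply Cmod_gt_0. rewrite Cmod_mult. nra. }
      apply (f_equal Re) in E. unfold cexp in E; cbn [Re fst] in E.
      replace (Re (clog (x * y) - (clog x + clog y))) with 0 in E
        by (change (0 = Re (clog (x * y)) - (Re (clog x) + Re (clog y))); lra).
      rewrite exp_0, Rmult_1_l in E.
      replace (Im (clog (x * y) - (clog x + clog y))) with t in E; trivial.
      unfold t. change (Im (clog (x * y)) - Im (clog x) - Im (clog y) =
         Im (clog (x * y)) - (Im (clog x) + Im (clog y))). lra.
    - assert (A1 := atan_bound (Im (x * y)%C / Re (x * y)%C)).
      assert (A2 := atan_bound (Im x / Re x)). assert (A3 := atan_bound (Im y / Re y)).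
      unfold t, clog; simpl Im in *. simpl snd in *. assert (HP := PI_RGT_0). simpl in *; lra. }
  apply injective_projections; [exact ER|].
  change (Im (clog (x * y)) = Im (clog x) + Im (clog y)). unfold t in Ht; lra.
Qed.

Lemma ln_1p_bound t : Rabs t <= 3 / 4 -> Rabs (ln (1 + t) - t) <= 4 * t ^ 2.
Proof.
  intros H. apply Rabs_def2b in H || apply Rabs_le_between in H.
  assert (U : ln (1 + t) <= t).
  { assert (E := exp_ineq1_le t). apply Rle_trans with (ln (exp t)).
    - apply ln_le; lra.
    - rewrite ln_exp; lra. }
  assert (L : t - 4 * t ^ 2 <= ln (1 + t)).
  { assert (E := exp_ineq1_le (- (t / (1 + t)))).
    assert (E2 : exp (- (t / (1 + t))) >= / (1 + t)).
    { replace (/ (1 + t)) with (1 + - (t / (1 + t))) by (field; lra). lra. }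
    assert (E3 : ln (/ (1 + t)) <= - (t / (1 + t))).
    { rewrite <- (ln_exp (- (t / (1 + t)))). apply ln_le; [apply Rinv_0_lt_compat; lra|lra]. }
    rewrite ln_Rinv in E3 by lra.
    assert (E4 : t / (1 + t) - (t - 4 * t ^ 2) = t ^ 2 * (4 - / (1 + t))) by (field; lra).
    assert (E5 : / (1 + t) <= 4).
    { rewrite <- (Rinv_inv 4). apply Rinv_le_contravar; lra. }
    nra. }
  apply Rabs_le; lra.
Qed.

Lemma atan_sub_id_bound y : Rabs (atan y - y) <= y ^ 2.
Proof.
  destruct (MVT_cor4 (fun x => atan x - x) (fun x => / (1 + x ^ 2) - 1) 0 (Rabs y)) with (b := y)
    as [c [Hc Hcy]].
  - intros c _. auto_derive; trivial. unfold Rsqr; field. nra.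
  - rewrite Rminus_0_r; lra.
  - rewrite atan_0 in Hc. rewrite !Rminus_0_r in *.
    assert (E : atan y - y = (/ (1 + c ^ 2) - 1) * y) by lra. rewrite E.
    rewrite Rabs_mult.
    assert (B : Rabs (/ (1 + c ^ 2) - 1) <= Rabs c).
    { replace (/ (1 + c ^ 2) - 1) with (- (c * (c / (1 + c ^ 2)))) by (field; nra).
      rewrite Rabs_Ropp, Rabs_mult.
      assert (Rabs (c / (1 + c ^ 2)) <= 1).
      { unfold Rdiv. rewrite Rabs_mult, (Rabs_pos_eq (/ _)) by (left; apply Rinv_0_lt_compat; nra).
        apply Rmult_le_reg_r with (1 + c ^ 2); [nra|].
        rewrite Rmult_assoc, Rinv_l by nra.
        assert (Q := pow2_abs c). assert (Rabs c >= 0) by (apply Rle_ge, Rabs_pos). nra. }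
      assert (Q := Rabs_pos c). nra. }
    assert (Q := pow2_abs y). assert (Q2 := Rabs_pos y). assert (Q3 := Rabs_pos c). nra.
Qed.

Lemma clog_near_1 (e : C) :
  Cmod e <= 1 / 4 -> Cmod (clog (1 + e) - e) <= 16 * Cmod e ^ 2.
Proof.
  intros H. destruct e as [x y].
  assert (Hx := re_le_Cmod (x, y)). assert (Hy := Im_le_Cmod (x, y)).
  assert (H2 := Cmod2_alt (x, y)). simpl Re in *; simpl Im in *.
  set (r := Cmod (x, y)) in *. assert (Hr : 0 <= r) by apply Cmod_ge_0.
  assert (X : Rabs x <= 1 / 4) by lra. assert (Y : Rabs y <= 1 / 4) by lra.
  apply Rabs_le_between in X. apply Rabs_le_between in Y.
  eapply Rle_trans; [apply Cmod_le_Re_Im|].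
  (* [1 + t] is the squared modulus of [1 + e], so the real part of the logarithm is half of
     [ln (1 + t)], a real estimate. *)
  set (t := 2 * x + r ^ 2).
  assert (ER : Re (clog (1 + (x, y)) - (x, y)) = (ln (1 + t) - t) / 2 + r ^ 2 / 2).
  { simpl. unfold Cmod; simpl.
    replace ((1 + x) * ((1 + x) * 1) + (0 + y) * ((0 + y) * 1)) with (1 + t) by (unfold t; nra).
    assert (0 < 1 + t) by (unfold t; nra).
    replace (ln (sqrt (1 + t))) with (ln (1 + t) / 2).
    - unfold t. simpl. field.
    - rewrite <- (sqrt_sqrt (1 + t)) at 1 by lra.
      rewrite ln_mult by (apply sqrt_lt_R0; lra). field. }
  assert (EI : Im (clog (1 + (x, y)) - (x, y)) =
     (atan (y / (1 + x)) - y / (1 + x)) - x * y / (1 + x)).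
  { simpl. rewrite Rplus_0_l. field. lra. }
  rewrite ER, EI.
  assert (T : Rabs t <= 9 / 4 * r).
  { unfold t. eapply Rle_trans; [apply Rabs_triang|].
    rewrite Rabs_mult, (Rabs_pos_eq 2), (Rabs_pos_eq (r ^ 2)) by nra. nra. }
  assert (B1 := ln_1p_bound t ltac:(lra)).
  assert (B2 := atan_sub_id_bound (y / (1 + x))).
  assert (B3 : t ^ 2 <= 81 / 16 * r ^ 2).
  { rewrite <- pow2_abs. assert (0 <= Rabs t) by apply Rabs_pos. nra. }
  assert (B4 : (y / (1 + x)) ^ 2 <= 2 * r ^ 2).
  { unfold Rdiv. rewrite Rpow_mult_distr.
    assert (y ^ 2 <= r ^ 2) by nra.
    assert ((/ (1 + x)) ^ 2 <= 2).
    { rewrite pow_inv. apply Rmult_le_reg_l with ((1 + x) ^ 2); [nra|].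
      rewrite Rinv_r by nra. nra. }
    assert (0 <= (/ (1 + x)) ^ 2) by (apply pow2_ge_0). nra. }
  assert (B5 : Rabs (x * y / (1 + x)) <= 4 / 3 * r ^ 2).
  { unfold Rdiv. rewrite !Rabs_mult, (Rabs_pos_eq (/ _)) by (left; apply Rinv_0_lt_compat; lra).
    assert (/ (1 + x) <= 4 / 3).
    { replace (4 / 3) with (/ (3 / 4)) by field. apply Rinv_le_contravar; lra. }
    assert (0 < / (1 + x)) by (apply Rinv_0_lt_compat; lra).
    assert (0 <= Rabs x) by apply Rabs_pos. assert (0 <= Rabs y) by apply Rabs_pos.
    assert (Rabs x * Rabs y <= r * r) by nra.
    assert (0 <= Rabs x * Rabs y) by nra. nra. }
  eapply Rle_trans.
  { apply Rplus_le_compat.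
    - eapply Rle_trans; [apply Rabs_triang|].
      unfold Rdiv at 1 2. rewrite !Rabs_mult. rewrite (Rabs_pos_eq (/ 2)) by lra.
      rewrite (Rabs_pos_eq (r ^ 2)) by nra.
      apply Rplus_le_compat_r. apply Rmult_le_compat_r; [lra|]. exact B1.
    - unfold Rminus at 1. eapply Rle_trans; [apply Rabs_triang|].
      rewrite Rabs_Ropp. apply Rplus_le_compat; [exact B2 | exact B5]. }
  nra.
Qed.

Lemma exp_near_0 r : Rabs r <= 1 -> Rabs (exp r - 1 - r) <= 2 * r ^ 2.
Proof.
  intros H. apply Rabs_le_between in H.
  assert (E := exp_ineq1_le r). assert (E2 := exp_ineq1_le (- r)).
  rewrite exp_Ropp in E2. assert (P := exp_pos r).
  destruct (Rle_dec r (1 / 2)).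
  - assert (exp r * (1 + - r) <= 1).
    { apply Rmult_le_reg_l with (/ exp r); [apply Rinv_0_lt_compat; trivial|].
      rewrite <- Rmult_assoc, Rinv_l by lra. lra. }
    apply Rabs_le; split; nra.
  - assert (exp r <= 3).
    { apply Rle_trans with (2 := exp_le_3).
      destruct (Req_dec r 1) as [->|]; [lra|]. left; apply exp_increasing; lra. }
    (* The bound [exp r <= 1 / (1 - r)] degenerates near 1. Applied at [r / 2] and squared, it
       remains good up to [r = 1]. *)
    assert (exp (r / 2) * (1 - r / 2) <= 1).
    { assert (E3 := exp_ineq1_le (- (r / 2))). rewrite exp_Ropp in E3.
      assert (P3 := exp_pos (r / 2)).
      apply Rmult_le_reg_l with (/ exp (r / 2)); [apply Rinv_0_lt_compat; trivial|].
      rewrite <- Rmult_assoc, Rinv_l by lra. lra. }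
    apply Rabs_le; split; try nra.
    assert (exp r <= 1 + r + 2 * r ^ 2); [|lra].
    destruct (Rle_dec 3 (1 + r + 2 * r ^ 2)); [lra|].
    assert (r < 1) by nra.
    assert (E6 : exp r = exp (r / 2) * exp (r / 2)).
    { rewrite <- exp_plus. f_equal; field. }
    assert (0 < exp (r / 2)) by apply exp_pos.
    set (a := exp (r / 2) * (1 - r / 2)) in *.
    assert (0 <= a) by (unfold a; nra).
    assert (E4 : exp r * (1 - r / 2) ^ 2 = a * a) by (unfold a; rewrite E6; ring).
    assert (a * a <= 1) by nra.
    assert (E5 : (1 + r + 2 * r ^ 2) * (1 - r / 2) ^ 2 = 1 + r ^ 2 * ((1 - r) * (5 / 4 - r / 2)))
      by field.
    assert (0 <= r ^ 2 * ((1 - r) * (5 / 4 - r / 2))).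
    { apply Rmult_le_pos; [nra|]. apply Rmult_le_pos; lra. }
    apply Rmult_le_reg_r with ((1 - r / 2) ^ 2); [nra|]. lra.
Qed.

Lemma sin_near_0 t : Rabs (sin t - t) <= t ^ 2.
Proof.
  destruct (MVT_cor4 (fun x => sin x - x) (fun x => cos x - 1) 0 (Rabs t)) with (b := t)
    as [c [Hc Hct]].
  - intros c _. auto_derive; trivial. ring.
  - rewrite Rminus_0_r; lra.
  - rewrite sin_0 in Hc. rewrite !Rminus_0_r in *.
    assert (E : sin t - t = (cos c - 1) * t) by lra. rewrite E, Rabs_mult.
    assert (B : Rabs (cos c - 1) <= Rabs c).
    { destruct (MVT_cor4 cos (fun x => - sin x) 0 (Rabs c)) with (b := c) as [d [Hd Hdc]].
      - intros d _. auto_derive; trivial. ring.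
      - rewrite Rminus_0_r; lra.
      - rewrite cos_0 in Hd. rewrite Hd, Rabs_mult, Rabs_Ropp, Rminus_0_r.
        assert (Rabs (sin d) <= 1) by (apply Rabs_le, SIN_bound).
        assert (0 <= Rabs c) by apply Rabs_pos. nra. }
    assert (Q := pow2_abs t). assert (0 <= Rabs t) by apply Rabs_pos.
    assert (0 <= Rabs c) by apply Rabs_pos. nra.
Qed.

Lemma cos_near_0 t : Rabs (cos t - 1) <= t ^ 2.
Proof.
  destruct (MVT_cor4 cos (fun x => - sin x) 0 (Rabs t)) with (b := t) as [d [Hd Hdc]].
  - intros d _. auto_derive; trivial. ring.
  - rewrite Rminus_0_r; lra.
  - rewrite cos_0 in Hd. rewrite Hd, Rabs_mult, Rabs_Ropp, !Rminus_0_r in *.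
    assert (Rabs (sin d) <= Rabs d).
    { destruct (MVT_cor4 sin cos 0 (Rabs d)) with (b := d) as [u [Hu Hud]].
      - intros u _. auto_derive; trivial. ring.
      - rewrite Rminus_0_r; lra.
      - rewrite sin_0, !Rminus_0_r in Hu. rewrite Hu, Rabs_mult.
        assert (Rabs (cos u) <= 1) by (apply Rabs_le, COS_bound).
        assert (0 <= Rabs d) by apply Rabs_pos. nra. }
    assert (Q := pow2_abs t). assert (0 <= Rabs t) by apply Rabs_pos.
    assert (0 <= Rabs (sin d)) by apply Rabs_pos. nra.
Qed.

Lemma cexp_near_0 (u : C) : Cmod u <= 1 -> Cmod (cexp u - 1 - u) <= 16 * Cmod u ^ 2.
Proof.
  intros H. destruct u as [x y].
  assert (Hx := re_le_Cmod (x, y)). assert (Hy := Im_le_Cmod (x, y)).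
  assert (H2 := Cmod2_alt (x, y)). simpl Re in *; simpl Im in *.
  set (r := Cmod (x, y)) in *. assert (Hr : 0 <= r) by apply Cmod_ge_0.
  eapply Rle_trans; [apply Cmod_le_Re_Im|].
  assert (B1 := exp_near_0 x ltac:(lra)). assert (B2 := sin_near_0 y). assert (B3 := cos_near_0 y).
  assert (Bc : Rabs (cos y) <= 1) by (apply Rabs_le, COS_bound).
  assert (Bs : Rabs (sin y) <= 2 * r).
  { replace (sin y) with ((sin y - y) + y) by ring.
    eapply Rle_trans; [apply Rabs_triang|]. nra. }
  assert (ER : Re (cexp (x, y) - 1 - (x, y)) =
     (exp x - 1 - x) * cos y + (1 + x) * (cos y - 1)) by (simpl; ring).
  assert (EI : Im (cexp (x, y) - 1 - (x, y)) =
     (exp x - 1 - x) * sin y + x * sin y + (sin y - y)) by (simpl; ring).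
  rewrite ER, EI.
  assert (X1 : Rabs (1 + x) <= 2).
  { eapply Rle_trans; [apply Rabs_triang|]. rewrite (Rabs_pos_eq 1); lra. }
  assert (0 <= Rabs x) by apply Rabs_pos. assert (0 <= Rabs y) by apply Rabs_pos.
  assert (0 <= Rabs (sin y)) by apply Rabs_pos. assert (0 <= Rabs (cos y)) by apply Rabs_pos.
  assert (0 <= Rabs (cos y - 1)) by apply Rabs_pos. assert (0 <= Rabs (1 + x)) by apply Rabs_pos.
  assert (0 <= Rabs (exp x - 1 - x)) by apply Rabs_pos.
  assert (x ^ 2 <= r ^ 2) by nra. assert (y ^ 2 <= r ^ 2) by nra.
  assert (T1 : Rabs ((exp x - 1 - x) * cos y + (1 + x) * (cos y - 1)) <= 4 * r ^ 2).
  { eapply Rle_trans; [apply Rabs_triang|]. rewrite !Rabs_mult. nra. }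
  assert (T2 : Rabs ((exp x - 1 - x) * sin y + x * sin y + (sin y - y)) <= 9 * r ^ 2).
  { eapply Rle_trans; [apply Rabs_triang|].
    eapply Rle_trans; [apply Rplus_le_compat_r, Rabs_triang|]. rewrite !Rabs_mult.
    assert (Rabs (exp x - 1 - x) * Rabs (sin y) <= 4 * r ^ 2) by nra.
    assert (Rabs x * Rabs (sin y) <= 2 * r ^ 2) by nra. nra. }
  nra.
Qed.

(** [|sin t|] is the distance from 1 to the line through 0 of direction [t = Im u], and [cexp u]
    lies on that line. With the companion bound for [cos t <= 0], this keeps [1 - cexp u] away from
    0 when [t] is away from the multiples of [2 PI], whatever the real part of [u]. *)
Lemma Cmod_1_minus_cexp_ge (u : C) : 0 <= cos (Im u) -> Rabs (sin (Im u)) <= Cmod (1 - cexp u).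
Proof.
  intros Hc. destruct u as [x t]; simpl in *.
  assert (H2 := Cmod2_alt (1 - cexp (x, t))). simpl in H2.
  apply Rabs_le_between.
  assert (S := sin2_cos2 t). unfold Rsqr in S.
  assert (0 <= Cmod (1 - cexp (x, t))) by apply Cmod_ge_0.
  set (m := Cmod (1 - cexp (x, t))) in *.
  assert (sin t ^ 2 <= m ^ 2).
  { assert (Q := pow2_ge_0 (exp x - cos t)).
    ring_simplify in Q. ring_simplify in H2. nra. }
  apply Rabs_le_between. rewrite <- (Rabs_pos_eq m) by trivial.
  apply pow_le_reg_abs || (rewrite <- sqrt_Rsqr_abs, <- sqrt_Rsqr_abs; apply sqrt_le_1_alt; unfold Rsqr; nra).
Qed.

Lemma Cmod_1_minus_cexp_ge_1 (u : C) : cos (Im u) <= 0 -> 1 <= Cmod (1 - cexp u).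
Proof.
  intros Hc. apply Rle_trans with (2 := re_le_Cmod _).
  apply Rle_trans with (2 := Rle_abs _). unfold cexp; simpl.
  assert (P := exp_pos (Re u)). unfold Re, Im in *. nra.
Qed.

(** * One step of the map near the fixed directions of the fiber *)

Lemma Cadd_le (x y : C) X Y : Cmod x <= X -> Cmod y <= Y -> Cmod (x + y) <= X + Y.
Proof. intros. eapply Rle_trans; [apply Cmod_triangle|]. lra. Qed.

Lemma Csub_le (x y : C) X Y : Cmod x <= X -> Cmod y <= Y -> Cmod (x - y) <= X + Y.
Proof. intros. eapply Rle_trans; [apply Cmod_minus_le|]. lra. Qed.

Lemma Copp_le (x : C) X : Cmod x <= X -> Cmod (- x) <= X.
Proof. rewrite Cmod_opp; trivial. Qed.

Lemma Cmul_le (x y : C) X Y : Cmod x <= X -> Cmod y <= Y -> Cmod (x * y) <= X * Y.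
Proof.
  intros. rewrite Cmod_mult. apply Rmult_le_compat; trivial; apply Cmod_ge_0.
Qed.

Lemma Cpow_le (x : C) X n : Cmod x <= X -> Cmod (x ^ n) <= X ^ n.
Proof.
  intros. rewrite Cmod_pow. apply pow_incr. split; trivial. apply Cmod_ge_0.
Qed.

Lemma Cdiv_le (x y : C) X Y : Cmod x <= X -> 0 < Y -> Y <= Cmod y -> Cmod (x / y) <= X / Y.
Proof.
  intros HX HY Hy. assert (y <> 0) by (apply Cmod_gt_0; lra).
  rewrite Cmod_div by trivial. unfold Rdiv.
  apply Rmult_le_compat; trivial; [apply Cmod_ge_0| |apply Rinv_le_contravar; trivial].
  left; apply Rinv_0_lt_compat; lra.
Qed.

(** Bounds the modulus of an expression by following its syntax: the goal is [Cmod e <= ?X], known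
    bounds are tried on the whole expression before it is split, and [?X] is assembled on the
    way. *)
Ltac cbd := first
  [ eassumption
  | match goal with
    | |- Cmod (?x + ?y)%C <= _ => eapply Cadd_le; cbd
    | |- Cmod (?x - ?y)%C <= _ => eapply Csub_le; cbd
    | |- Cmod (?x * ?y)%C <= _ => eapply Cmul_le; cbd
    | |- Cmod (- ?x)%C <= _ => eapply Copp_le; cbd
    | |- Cmod (?x ^ ?n)%C <= _ => eapply Cpow_le; cbd
    | |- Cmod (RtoC 1) <= _ => rewrite Cmod_1; apply Rle_refl
    end
  | apply Rle_refl ].

Definition base_bound (p : C -> C) (a : C) (M r : R) : Prop :=
  forall z : C, Cmod z < r -> Cmod (p z - (z - z ^ 2 + a * z ^ 3)) <= M * Cmod z ^ 4.

Definition fiber_bound (q : C -> C -> C) (b : R) (b03 b30 : C) (M r : R) : Prop :=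
  forall z w : C, Cmod z < r -> Cmod w < r ->
  Cmod (q z w - (w + w ^ 2 + RtoC b * z ^ 2 + b03 * w ^ 3 + b30 * z ^ 3))
    <= M * (Cmod z + Cmod w) ^ 4.

(* For the images [A'], [B'] of [A = w - lam z], [B = w - conj lam z], this is the numerator of
   [A' / B' - (A / B) F], written with all cancellations made explicit. *)
Lemma step_numerator_le (k zt bt : R) (B z w A dl G F lam lamb a b03 Gam R rz : C) :
  1 <= k -> 0 <= zt -> 0 <= bt -> zt <= k * bt -> bt <= 1 ->
  Cmod B <= bt -> Cmod z <= zt -> Cmod w <= k * bt -> Cmod A <= k * bt ->
  Cmod dl <= k * zt -> Cmod G <= k -> Cmod F <= k -> Cmod lam <= k -> Cmod lamb <= k ->
  Cmod b03 <= k -> Cmod Gam <= k ->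
  Cmod R <= k * zt ^ 3 + k * bt ^ 4 -> Cmod rz <= k * zt ^ 3 ->
  (w = B + lamb * z)%C ->
  Cmod (dl * (b03 * B ^ 2 * dl + A * B * (dl + z) + A * B * (Gam * B) * (B - dl - z)
              + b03 * (lamb * z * (w ^ 2 + w * B + B ^ 2)) + R
              - (b03 * w ^ 3 + R) * A * G)
        - rz * (lam * B - lamb * A * F))
    <= 22 * k ^ 11 * (bt ^ 2 * (zt ^ 2 + zt * bt ^ 2)).
Proof.
  intros Hk Hz Hb Hzb Hb1 HB Hzz Hw HA Hdl HG HF Hlam Hlamb Hb03 HGam HR Hrz Ew.
  assert (pk : forall n m, (n <= m)%nat -> k ^ n <= k ^ m) by (intros; apply Rle_pow; trivial).
  assert (k0 : forall n, 0 <= k ^ n) by (intros; apply pow_le; lra).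
  (* Every term of the bracket is [O(T)]. The outer factor [dl = O(zt)] turns [T] into
     [bt ^ 2 * (zt ^ 2 + zt * bt ^ 2)], whose factor [bt ^ 2] will cancel against the denominator
     [B B']. The powers of [k] only count factors. *)
  set (T := bt ^ 2 * zt + bt ^ 4).
  assert (T0 : 0 <= T) by (unfold T; apply Rplus_le_le_0_compat; [apply Rmult_le_pos|]; try apply pow_le; lra).
  assert (Tz : bt ^ 2 * zt <= T) by (unfold T; assert (0 <= bt ^ 4) by (apply pow_le; lra); lra).
  assert (Tb : bt ^ 4 <= T) by (unfold T; assert (0 <= bt ^ 2 * zt) by (apply Rmult_le_pos; [apply pow_le|]; lra); lra).
  assert (bz : 0 <= bt ^ 2 * zt) by (apply Rmult_le_pos; [apply pow_le|]; lra).
  assert (b4 : 0 <= bt ^ 4) by (apply pow_le; lra).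
  assert (z3 : zt ^ 3 <= k ^ 2 * (bt ^ 2 * zt)).
  { assert (zt ^ 2 <= (k * bt) ^ 2) by (apply pow_incr; lra).
    replace (zt ^ 3) with (zt ^ 2 * zt) by ring.
    replace (k ^ 2 * (bt ^ 2 * zt)) with ((k * bt) ^ 2 * zt) by ring.
    apply Rmult_le_compat_r; trivial. }
  assert (HR' : Cmod R <= 2 * k ^ 3 * T).
  { apply Rle_trans with (1 := HR).
    assert (k * zt ^ 3 <= k ^ 3 * T).
    { apply Rle_trans with (k * (k ^ 2 * (bt ^ 2 * zt))); [apply Rmult_le_compat_l; lra|].
      replace (k * (k ^ 2 * (bt ^ 2 * zt))) with (k ^ 3 * (bt ^ 2 * zt)) by ring.
      apply Rmult_le_compat_l; trivial. }
    assert (k * bt ^ 4 <= k ^ 3 * T).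
    { apply Rmult_le_compat; try lra. rewrite <- (pow_1 k) at 1. apply pk; lia. }
    lra. }
  assert (T1 : Cmod (b03 * B ^ 2 * dl) <= k ^ 10 * T).
  { eapply Rle_trans; [cbd|].
    replace (k * bt ^ 2 * (k * zt)) with (k ^ 2 * (bt ^ 2 * zt)) by ring.
    apply Rmult_le_compat; trivial. apply pk; lia. }
  assert (T2 : Cmod (A * B * (dl + z)) <= 2 * k ^ 10 * T).
  { eapply Rle_trans; [cbd|].
    replace (k * bt * bt * (k * zt + zt)) with ((k ^ 2 + k) * (bt ^ 2 * zt)) by ring.
    apply Rmult_le_compat; trivial; [nra|].
    assert (H1 := pk 2%nat 10%nat ltac:(lia)). assert (H2 := pk 1%nat 10%nat ltac:(lia)).
    rewrite pow_1 in H2. lra. }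
  assert (T3 : Cmod (A * B * (Gam * B) * (B - dl - z)) <= 3 * k ^ 10 * T).
  { eapply Rle_trans; [cbd|].
    apply Rle_trans with (k * bt * bt * (k * bt) * (3 * k ^ 2 * bt)).
    - apply Rmult_le_compat_l; [apply Rmult_le_pos; nra|].
      assert (k * zt <= k ^ 2 * bt) by nra. assert (bt <= k ^ 2 * bt) by nra. nra.
    - replace (k * bt * bt * (k * bt) * (3 * k ^ 2 * bt)) with (3 * k ^ 4 * bt ^ 4) by ring.
      apply Rmult_le_compat; trivial; [specialize (k0 4%nat); lra|].
      specialize (pk 4%nat 10%nat ltac:(lia)); lra. }
  assert (T4 : Cmod (b03 * (lamb * z * (w ^ 2 + w * B + B ^ 2))) <= 3 * k ^ 10 * T).
  { eapply Rle_trans; [cbd|].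
    apply Rle_trans with (k * (k * zt * (3 * k ^ 2 * bt ^ 2))).
    - apply Rmult_le_compat_l; [lra|]. apply Rmult_le_compat_l; [nra|].
      assert (0 <= bt ^ 2) by (apply pow_le; lra). assert (k * bt ^ 2 <= k ^ 2 * bt ^ 2) by nra.
      assert (bt ^ 2 <= k ^ 2 * bt ^ 2) by nra.
      replace ((k * bt) ^ 2 + k * bt * bt + bt ^ 2) with (k ^ 2 * bt ^ 2 + k * bt ^ 2 + bt ^ 2) by ring. lra.
    - replace (k * (k * zt * (3 * k ^ 2 * bt ^ 2))) with (3 * k ^ 4 * (bt ^ 2 * zt)) by ring.
      apply Rmult_le_compat; trivial; [specialize (k0 4%nat); lra|].
      specialize (pk 4%nat 10%nat ltac:(lia)); lra. }
  assert (T6 : Cmod ((b03 * w ^ 3 + R) * A * G) <= 3 * k ^ 9 * T).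
  { assert (X1 : Cmod (b03 * w ^ 3 * A * G) <= k ^ 6 * T).
    { eapply Rle_trans; [cbd|].
      replace (k * (k * bt) ^ 3 * (k * bt) * k) with (k ^ 6 * bt ^ 4) by ring.
      apply Rmult_le_compat_l; trivial. }
    assert (X2 : Cmod (R * A * G) <= 2 * k ^ 5 * T).
    { eapply Rle_trans; [eapply Cmul_le; [eapply Cmul_le; [exact HR'|exact HA]|exact HG]|].
      replace (2 * k ^ 3 * T * (k * bt) * k) with (2 * k ^ 5 * T * bt) by ring.
      rewrite <- (Rmult_1_r (2 * k ^ 5 * T)) at 2. apply Rmult_le_compat_l; trivial.
      apply Rmult_le_pos; trivial. specialize (k0 5%nat); lra. }
    replace ((b03 * w ^ 3 + R) * A * G)%C with (b03 * w ^ 3 * A * G + R * A * G)%C by ring.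
    eapply Rle_trans; [eapply Cadd_le; eassumption|].
    assert (H1 := pk 6%nat 9%nat ltac:(lia)). assert (H2 := pk 5%nat 9%nat ltac:(lia)).
    assert (k ^ 6 * T <= k ^ 9 * T) by (apply Rmult_le_compat_r; trivial).
    assert (k ^ 5 * T <= k ^ 9 * T) by (apply Rmult_le_compat_r; trivial). lra. }
  set (U := (b03 * B ^ 2 * dl + A * B * (dl + z) + A * B * (Gam * B) * (B - dl - z)
              + b03 * (lamb * z * (w ^ 2 + w * B + B ^ 2)) + R
              - (b03 * w ^ 3 + R) * A * G)%C).
  assert (HU : Cmod U <= 20 * k ^ 9 * T * k).
  { eapply Rle_trans.
    { unfold U. eapply Csub_le; [|exact T6].
      eapply Cadd_le; [|exact HR']. eapply Cadd_le; [|exact T4].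
      eapply Cadd_le; [|exact T3]. eapply Cadd_le; [exact T1|exact T2]. }
    assert (H1 := pk 3%nat 10%nat ltac:(lia)). assert (H2 := pk 9%nat 10%nat ltac:(lia)).
    assert (k ^ 3 * T <= k ^ 10 * T) by (apply Rmult_le_compat_r; trivial).
    assert (k ^ 9 * T <= k ^ 10 * T) by (apply Rmult_le_compat_r; trivial).
    assert (0 <= k ^ 10 * T) by (apply Rmult_le_pos; trivial).
    replace (20 * k ^ 9 * T * k) with (20 * (k ^ 10 * T)) by ring. lra. }
  assert (S1 : Cmod (dl * U) <= 20 * k ^ 11 * (bt ^ 2 * (zt ^ 2 + zt * bt ^ 2))).
  { eapply Rle_trans; [eapply Cmul_le; [exact Hdl|exact HU]|]. unfold T. right; ring. }
  (* The remainder of [p] does not come with a factor [dl]; one of its three factors [zt] is traded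
     for [k * bt] to reach the same weight. *)
  assert (S2 : Cmod (rz * (lam * B - lamb * A * F)) <= 2 * k ^ 5 * (bt ^ 2 * (zt ^ 2 + zt * bt ^ 2))).
  { eapply Rle_trans; [cbd|].
    apply Rle_trans with (k * zt ^ 3 * (2 * k ^ 3 * bt)).
    - apply Rmult_le_compat_l; [apply Rmult_le_pos; [lra|apply pow_le; lra]|].
      assert (k <= k ^ 3) by (rewrite <- (pow_1 k) at 1; apply pk; lia).
      replace (k * (k * bt) * k) with (k ^ 3 * bt) by ring. nra.
    - replace (k * zt ^ 3 * (2 * k ^ 3 * bt)) with (2 * k ^ 4 * bt * (zt ^ 2 * zt)) by ring.
      assert (0 <= zt ^ 2) by (apply pow_le; lra).
      apply Rle_trans with (2 * k ^ 4 * bt * (zt ^ 2 * (k * bt))).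
      + apply Rmult_le_compat_l; [|apply Rmult_le_compat_l; trivial].
        specialize (k0 4%nat); nra.
      + replace (2 * k ^ 4 * bt * (zt ^ 2 * (k * bt))) with (2 * k ^ 5 * (bt ^ 2 * zt ^ 2)) by ring.
        apply Rmult_le_compat_l; [specialize (k0 5%nat); lra|].
        apply Rmult_le_compat_l; [apply pow_le; lra|].
        assert (0 <= zt * bt ^ 2) by (apply Rmult_le_pos; [|apply pow_le]; lra). lra. }
  eapply Rle_trans; [eapply Csub_le; [exact S1|exact S2]|].
  assert (0 <= bt ^ 2 * (zt ^ 2 + zt * bt ^ 2)).
  { apply Rmult_le_pos; [apply pow_le; lra|]. apply Rplus_le_le_0_compat; [apply pow_le; lra|].
    apply Rmult_le_pos; [lra|apply pow_le; lra]. }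
  assert (H1 := pk 5%nat 11%nat ltac:(lia)).
  set (W := bt ^ 2 * (zt ^ 2 + zt * bt ^ 2)) in *.
  assert (k ^ 5 * W <= k ^ 11 * W) by (apply Rmult_le_compat_r; trivial). lra.
Qed.

(* [A] and [B] vanish on the two lines that the map preserves to second order; on [A / B] it acts
   as a near rotation. *)
Lemma step_ratio (p : C -> C) (q : C -> C -> C) (a b03 b30 : C) (b c M r L : R) :
  0 < r -> b = 1 / 4 + c ^ 2 -> 0 <= L ->
  base_bound p a M r -> fiber_bound q b b03 b30 M r ->
  exists K r0, 0 < K /\ 0 < r0 /\ forall z w : C,
    let lam := ((- (1 / 2))%R, c) in let lamb := ((- (1 / 2))%R, (- c)%R) in
    let A := (w - lam * z)%C in let B := (w - lamb * z)%C in
    let A' := (q z w - lam * p z)%C in let B' := (q z w - lamb * p z)%C in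
    0 < Cmod B -> Cmod B < r0 -> Cmod z <= L * Cmod B ->
    Cmod B / 2 <= Cmod B' /\
    Cmod (A' / B' - A / B * (1 + (0, (2 * c)%R) * z * (1 - (1 - b03) * B)))
      <= K * (Cmod z ^ 2 + Cmod z * Cmod B ^ 2).
Proof.
  intros Hr Hb HL Hp Hq.
  set (lam := ((- (1 / 2))%R, c) : C). set (lamb := ((- (1 / 2))%R, (- c)%R) : C).
  set (kap := (0, (2 * c)%R) : C).
  set (k1 := 2 + L + Cmod lam + Cmod lamb + Cmod kap + Cmod a + Cmod b03 + Cmod b30 + Rabs M).
  assert (n1 := Cmod_ge_0 lam). assert (n2 := Cmod_ge_0 lamb). assert (n3 := Cmod_ge_0 kap).
  assert (n4 := Cmod_ge_0 a). assert (n5 := Cmod_ge_0 b03). assert (n6 := Cmod_ge_0 b30).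
  assert (n7 := Rabs_pos M). assert (n8 := Rle_abs M).
  assert (Hk1 : 2 <= k1) by (unfold k1; lra).
  (* [k1] dominates the coefficients. The bounds for [w], [A], [F] and the remainders cost powers of
     [k1] up to 17; [k] absorbs them all, so that [step_numerator_le] receives a single constant. *)
  set (k := k1 ^ 20).
  assert (pk : forall n, (n <= 20)%nat -> k1 ^ n <= k) by (intros; unfold k; apply Rle_pow; lra || trivial).
  assert (k1k : k1 <= k) by (rewrite <- (pow_1 k1) at 1; apply pk; lia).
  assert (Hk : 1 <= k) by lra.
  exists (44 * k ^ 11), (Rmin 1 (Rmin (r / k) (/ (12 * k ^ 5)))).
  assert (k3 : 1 <= k ^ 5) by (apply pow_R1_Rle; trivial).
  split; [apply Rmult_lt_0_compat; [lra|apply pow_lt; lra]|].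
  split.
  { repeat apply Rmin_glb_lt; try lra. apply Rdiv_lt_0_compat; lra. apply Rinv_0_lt_compat; lra. }
  intros z w. cbv zeta.
  set (A := (w - lam * z)%C). set (B := (w - lamb * z)%C).
  set (A' := (q z w - lam * p z)%C). set (B' := (q z w - lamb * p z)%C).
  intros HB0 HB HzL.
  set (bt := Cmod B) in *. set (zt := Cmod z) in *.
  assert (Hb1 : bt <= 1) by (apply Rlt_le, Rlt_le_trans with (1 := HB), Rmin_l).
  assert (Hbr : bt * k < r).
  { apply Rmult_lt_reg_r with (/ k); [apply Rinv_0_lt_compat; lra|].
    rewrite Rmult_assoc, Rinv_r by lra. rewrite Rmult_1_r.
    apply Rlt_le_trans with (1 := HB), Rle_trans with (1 := Rmin_r _ _), Rmin_l. }
  assert (Hbk : bt * (12 * k ^ 5) < 1).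
  { apply Rmult_lt_reg_r with (/ (12 * k ^ 5)); [apply Rinv_0_lt_compat; lra|].
    rewrite Rmult_assoc, Rinv_r by lra. rewrite Rmult_1_r, Rmult_1_l.
    apply Rlt_le_trans with (1 := HB), Rle_trans with (1 := Rmin_r _ _), Rmin_r. }
  assert (Hz0 : 0 <= zt) by apply Cmod_ge_0.
  assert (Ew : w = (B + lamb * z)%C) by (unfold B; ring).
  assert (Hzk : zt <= k1 * bt) by (apply Rle_trans with (1 := HzL), Rmult_le_compat_r; unfold k1; lra).
  assert (Hw1 : Cmod w <= k1 ^ 3 * bt).
  { rewrite Ew. eapply Rle_trans; [eapply Cadd_le; [apply Rle_refl|eapply Cmul_le; apply Rle_refl]|].
    fold zt bt. assert (Cmod lamb <= k1) by (unfold k1; lra).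
    assert (Cmod lamb * zt <= k1 * (k1 * bt)) by (apply Rmult_le_compat; lra).
    assert (1 <= k1 ^ 2) by nra. assert (bt <= k1 ^ 2 * bt) by nra. nra. }
  assert (HA1 : Cmod A <= k1 ^ 3 * bt).
  { replace A with (B - kap * z)%C.
    2:{ unfold A, B, kap, lam, lamb. apply injective_projections; simpl; ring. }
    eapply Rle_trans; [eapply Csub_le; [apply Rle_refl|eapply Cmul_le; apply Rle_refl]|].
    fold zt bt. assert (Cmod kap <= k1) by (unfold k1; lra).
    assert (Cmod kap * zt <= k1 * (k1 * bt)) by (apply Rmult_le_compat; lra).
    assert (1 <= k1 ^ 2) by nra. assert (bt <= k1 ^ 2 * bt) by nra. nra. }
  assert (Hw : Cmod w <= k * bt) by (apply Rle_trans with (1 := Hw1), Rmult_le_compat_r; [lra|apply pk; lia]).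
  assert (HA : Cmod A <= k * bt) by (apply Rle_trans with (1 := HA1), Rmult_le_compat_r; [lra|apply pk; lia]).
  set (dl := (kap * z)%C). set (Gam := (1 - b03)%C). set (G := (1 - Gam * B)%C).
  set (F := (1 + dl * G)%C).
  assert (Hdl : Cmod dl <= k * zt).
  { unfold dl. rewrite Cmod_mult. apply Rmult_le_compat_r; trivial. unfold k1 in k1k; lra. }
  assert (HGam1 : Cmod Gam <= k1).
  { unfold Gam. eapply Rle_trans; [cbd|]. unfold k1; lra. }
  assert (HG1 : Cmod G <= k1 ^ 2).
  { unfold G. eapply Rle_trans; [cbd|]. fold bt. nra. }
  assert (HF1 : Cmod F <= k1 ^ 5).
  { assert (Cmod kap <= k1) by (unfold k1; lra).
    assert (zt <= k1) by nra.
    assert (Hd2 : Cmod dl <= k1 ^ 2).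
    { unfold dl. rewrite Cmod_mult. fold zt. simpl; rewrite Rmult_1_r. apply Rmult_le_compat; lra. }
    unfold F. eapply Rle_trans; [eapply Cadd_le; [rewrite Cmod_1; apply Rle_refl|eapply Cmul_le; eassumption]|].
    assert (1 <= k1 ^ 4) by (apply pow_R1_Rle; lra).
    replace (k1 ^ 5) with (k1 * k1 ^ 4) by ring.
    replace (k1 ^ 2 * k1 ^ 2) with (k1 ^ 4) by ring. nra. }
  assert (HG : Cmod G <= k) by (apply Rle_trans with (1 := HG1), pk; lia).
  assert (HF : Cmod F <= k) by (apply Rle_trans with (1 := HF1), pk; lia).
  set (R := (b30 * z ^ 3 + (q z w - (w + w ^ 2 + RtoC b * z ^ 2 + b03 * w ^ 3 + b30 * z ^ 3)))%C).
  set (rz := (a * z ^ 3 + (p z - (z - z ^ 2 + a * z ^ 3)))%C).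
  assert (Hzr : Cmod z < r) by (fold zt; nra).
  assert (Hwr : Cmod w < r) by nra.
  assert (Hq' := Hq z w Hzr Hwr). assert (Hp' := Hp z Hzr).
  assert (z4 : 0 <= zt ^ 3) by (apply pow_le; trivial).
  assert (Hzk' : zt <= k * bt) by nra.
  assert (HR : Cmod R <= k * zt ^ 3 + k * bt ^ 4).
  { unfold R. eapply Rle_trans; [eapply Cadd_le; [eapply Cmul_le; [apply Rle_refl|rewrite Cmod_pow; apply Rle_refl]|exact Hq']|].
    fold zt. apply Rplus_le_compat; [apply Rmult_le_compat_r; unfold k1 in k1k; lra|].
    assert (Hs : zt + Cmod w <= 2 * k1 ^ 3 * bt).
    { assert (k1 * bt <= k1 ^ 3 * bt); [|lra]. apply Rmult_le_compat_r; [lra|].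
      rewrite <- (pow_1 k1) at 1. apply Rle_pow; first [lra|lia]. }
    assert (Hs4 : (zt + Cmod w) ^ 4 <= (2 * k1 ^ 3 * bt) ^ 4).
    { apply pow_incr. split; trivial. assert (0 <= Cmod w) by apply Cmod_ge_0. lra. }
    assert (M <= k1) by (unfold k1; lra).
    apply Rle_trans with (k1 * (2 * k1 ^ 3 * bt) ^ 4).
    { assert (P4 : 0 <= (zt + Cmod w) ^ 4).
      { apply pow_le. assert (0 <= Cmod w) by apply Cmod_ge_0. lra. }
      apply Rle_trans with (k1 * (zt + Cmod w) ^ 4);
        [apply Rmult_le_compat_r|apply Rmult_le_compat_l]; lra. }
    replace (k1 * (2 * k1 ^ 3 * bt) ^ 4) with (2 ^ 4 * k1 ^ 13 * bt ^ 4) by ring.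
    apply Rmult_le_compat_r; [apply pow_le; lra|].
    apply Rle_trans with (k1 ^ 4 * k1 ^ 13).
    - apply Rmult_le_compat_r; [apply pow_le; lra|]. apply pow_incr; lra.
    - rewrite <- pow_add. apply pk; lia. }
  assert (Hrz : Cmod rz <= k * zt ^ 3).
  { unfold rz. eapply Rle_trans; [eapply Cadd_le; [eapply Cmul_le; [apply Rle_refl|rewrite Cmod_pow; apply Rle_refl]|exact Hp']|].
    fold zt.
    assert (zt <= k1) by nra.
    assert (M * zt ^ 4 <= Rabs M * k1 * zt ^ 3).
    { replace (M * zt ^ 4) with (M * zt * zt ^ 3) by ring. apply Rmult_le_compat_r; trivial.
      apply Rle_trans with (Rabs M * zt); [apply Rmult_le_compat_r|apply Rmult_le_compat_l]; trivial. }
    assert (Cmod a + Rabs M * k1 <= k1 ^ 2).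
    { assert (Cmod a + Rabs M <= k1) by (unfold k1; lra). nra. }
    assert (k1 ^ 2 <= k) by (apply pk; lia). nra. }
  assert (Hlam : Cmod lam <= k) by (unfold k1 in k1k; lra).
  assert (Hlamb : Cmod lamb <= k) by (unfold k1 in k1k; lra).
  assert (Hb03 : Cmod b03 <= k) by (unfold k1 in k1k; lra).
  assert (HGam : Cmod Gam <= k) by lra.
  assert (Hnum := @step_numerator_le k zt bt B z w A dl G F lam lamb a b03 Gam R rz
    Hk Hz0 (Rlt_le _ _ HB0) Hzk' Hb1 (Rle_refl _) (Rle_refl _) Hw HA Hdl HG HF Hlam Hlamb Hb03 HGam HR Hrz Ew).
  (* [lam] and [lamb] are the roots of [x ^ 2 + x + b]. The line [w = lam z] is preserved to second
     order because [lam ^ 2 + b = - lam], which is the coefficient of [z ^ 2] in [lam * p z]. *)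
  assert (Eb : RtoC b = (lam * lamb)%C).
  { rewrite Hb. unfold lam, lamb. apply injective_projections; simpl; field. }
  assert (Es : (lam + lamb = - 1)%C).
  { unfold lam, lamb. apply injective_projections; simpl; field. }
  assert (Ek : kap = (lam - lamb)%C).
  { unfold lam, lamb, kap. apply injective_projections; simpl; field. }
  assert (Eq : q z w = (w + w ^ 2 + lam * lamb * z ^ 2 + b03 * w ^ 3 + R)%C) by (unfold R; rewrite Eb; ring).
  assert (Ep : p z = (z - z ^ 2 + rz)%C) by (unfold rz; ring).
  (* The cross product of the two fractions. Its low-order terms cancel identically once
     [lamb = - 1 - lam] is substituted; what remains is the expression estimated in
     [step_numerator_le]. *)
  assert (EN : (B * A' - A * F * B' = dl * (b03 * B ^ 2 * dl + A * B * (dl + z) + A * B * (Gam * B) * (B - dl - z)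
              + b03 * (lamb * z * (w ^ 2 + w * B + B ^ 2)) + R
              - (b03 * w ^ 3 + R) * A * G)
        - rz * (lam * B - lamb * A * F))%C).
  { unfold A', B'. rewrite Eq, Ep. unfold F, G, Gam, dl. rewrite Ek.
    assert (El : lamb = (- 1 - lam)%C) by (rewrite <- Es; ring).
    unfold A, B. rewrite El. ring. }
  rewrite <- EN in Hnum.
  (* [B'] is [B] up to a relative error [O(bt)], so it cannot vanish and the quotient [A' / B']
     makes sense. *)
  assert (EB' : B' = (B + B * (A - z) + (b03 * w ^ 3 + R - lamb * rz))%C).
  { unfold B'. rewrite Eq, Ep.
    assert (El : lamb = (- 1 - lam)%C) by (rewrite <- Es; ring).
    unfold A, B. rewrite El. ring. }
  assert (bt2 : 0 <= bt ^ 2) by (apply pow_le; lra).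
  assert (HB' : bt / 2 <= Cmod B').
  { rewrite EB'.
    assert (Hz3 : zt ^ 3 <= k ^ 3 * bt ^ 2).
    { apply Rle_trans with ((k * bt) ^ 3); [apply pow_incr; lra|].
      replace ((k * bt) ^ 3) with (k ^ 3 * bt ^ 2 * bt) by ring.
      rewrite <- (Rmult_1_r (k ^ 3 * bt ^ 2)) at 2.
      apply Rmult_le_compat_l; trivial. apply Rmult_le_pos; trivial. apply pow_le; lra. }
    assert (E1 : Cmod (B * (A - z)) <= 2 * k ^ 5 * bt ^ 2).
    { eapply Rle_trans; [eapply Cmul_le; [apply Rle_refl|eapply Csub_le; [exact HA|exact Hzk']]|].
      fold bt. assert (k <= k ^ 5) by (rewrite <- (pow_1 k) at 1; apply Rle_pow; first [lra|lia]). nra. }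
    assert (E2 : Cmod (b03 * w ^ 3) <= k ^ 5 * bt ^ 2).
    { eapply Rle_trans; [eapply Cmul_le; [exact Hb03|eapply Cpow_le; exact Hw]|].
      replace (k * (k * bt) ^ 3) with (k ^ 4 * (bt ^ 2 * bt)) by ring.
      apply Rmult_le_compat; [apply pow_le; lra|nra| |nra].
      apply Rle_pow; first [lra|lia]. }
    assert (E3 : Cmod R <= 2 * k ^ 5 * bt ^ 2).
    { apply Rle_trans with (1 := HR).
      assert (k * zt ^ 3 <= k ^ 5 * bt ^ 2).
      { apply Rle_trans with (k * (k ^ 3 * bt ^ 2)); [apply Rmult_le_compat_l; lra|].
        replace (k * (k ^ 3 * bt ^ 2)) with (k ^ 4 * bt ^ 2) by ring.
        apply Rmult_le_compat_r; trivial. apply Rle_pow; first [lra|lia]. }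
      assert (k * bt ^ 4 <= k ^ 5 * bt ^ 2).
      { apply Rmult_le_compat; [lra|apply pow_le; lra| |].
        - rewrite <- (pow_1 k) at 1; apply Rle_pow; first [lra|lia].
        - replace (bt ^ 4) with (bt ^ 2 * bt ^ 2) by ring.
          rewrite <- (Rmult_1_r (bt ^ 2)) at 3. apply Rmult_le_compat_l; nra. }
      lra. }
    assert (E4 : Cmod (lamb * rz) <= k ^ 5 * bt ^ 2).
    { eapply Rle_trans; [eapply Cmul_le; [exact Hlamb|exact Hrz]|].
      apply Rle_trans with (k * (k * (k ^ 3 * bt ^ 2))); [|right; ring].
      apply Rmult_le_compat_l; [lra|]. apply Rmult_le_compat_l; lra. }
    assert (E5 : Cmod (B * (A - z) + (b03 * w ^ 3 + R - lamb * rz)) <= 6 * k ^ 5 * bt ^ 2).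
    { eapply Rle_trans; [eapply Cadd_le; [exact E1|eapply Csub_le; [eapply Cadd_le; [exact E2|exact E3]|exact E4]]|].
      lra. }
    rewrite <- Cplus_assoc.
    eapply Rle_trans; [|apply Cmod_plus_ge]. fold bt.
    assert (6 * k ^ 5 * bt ^ 2 <= bt / 2) by nra. lra. }
  split; trivial.
  assert (B0 : B <> 0) by (apply Cmod_gt_0; trivial).
  assert (B'0 : B' <> 0) by (apply Cmod_gt_0; lra).
  assert (HBB : bt ^ 2 / 2 <= Cmod (B * B')).
  { rewrite Cmod_mult. fold bt. nra. }
  change (1 + kap * z * (1 - (1 - b03) * B))%C with F.
  replace (A' / B' - A / B * F)%C with ((B * A' - A * F * B') / (B * B'))%C
    by (field; split; trivial).
  eapply Rle_trans; [eapply Cdiv_le; [exact Hnum| |exact HBB]; nra|].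
  right. fold zt bt. field. lra.
Qed.

(** [1 / (1 - cexp u)] has a simple pole with residue -1 at 0. Removing it leaves the quotient of
    [cexp u - 1 - u], which is [O(u ^ 2)], by a product of size comparable to [|u| ^ 2]. *)
Lemma cexp_kernel_near (u : C) : u <> 0 -> Cmod u <= 1 / 32 ->
  (1 - cexp u)%C <> 0 /\ Cmod (/ (1 - cexp u) + / u) <= 32.
Proof.
  intros Hu H.
  assert (H0 : 0 < Cmod u) by (apply Cmod_gt_0; trivial).
  assert (B := cexp_near_0 u ltac:(lra)).
  set (r := (cexp u - 1 - u)%C) in *.
  assert (E : (1 - cexp u = - (u + r))%C) by (unfold r; ring).
  assert (L : Cmod u / 2 <= Cmod (1 - cexp u)).
  { rewrite E, Cmod_opp. eapply Rle_trans; [|apply Cmod_plus_ge]. nra. }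
  assert (N : (1 - cexp u)%C <> 0) by (apply Cmod_gt_0; lra).
  split; trivial.
  replace (/ (1 - cexp u) + / u)%C with ((- r) / ((1 - cexp u) * u))%C.
  2:{ rewrite <- (Cmult_1_l (/ (1 - cexp u))), <- (Cmult_1_l (/ u)). unfold r. field.
      split; trivial. }
  eapply Rle_trans.
  { apply Cdiv_le with (X := 16 * Cmod u ^ 2) (Y := Cmod u / 2 * Cmod u).
    - rewrite Cmod_opp; exact B.
    - nra.
    - rewrite Cmod_mult. apply Rmult_le_compat_r; lra. }
  right; field. lra.
Qed.

(** For [cos t >= 0], [sin t ^ 2 = (1 - cos t) (1 + cos t)] is at least [1 - cos t], and on the
    interval the cosine is largest at the two ends. *)
Lemma sin_ge_away d t : 0 < d <= PI / 2 -> d <= t <= 2 * PI - d -> 0 <= cos t ->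
  1 - cos d <= sin t ^ 2.
Proof.
  intros Hd Ht Hc.
  assert (cos t <= cos d).
  { destruct (Rle_dec t PI).
    - apply cos_decr_1; lra.
    - replace (cos t) with (cos (2 * PI - t)).
      + apply cos_decr_1; lra.
      + rewrite cos_minus, cos_2PI, sin_2PI. ring. }
  assert (S := sin2_cos2 t). unfold Rsqr in S. assert (B := COS_bound t). nra.
Qed.

(* Partial fractions of [w / z] in the coordinate [X]: only the poles at both
   ends of the gate matter. *)
Lemma cexp_kernel (c : R) : 0 < c ->
  exists K eta, 0 < K /\ 0 < eta /\ forall X : C,
    0 < Re X < PI / c -> Rabs (Im X) <= eta ->
    (1 - cexp ((0, (2 * c)%R) * X))%C <> 0 /\
    Cmod ((0, (2 * c)%R) / (1 - cexp ((0, (2 * c)%R) * X)) + / X + / (X - RtoC (PI / c))) <= K.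
Proof.
  intros Hc. assert (HPI := PI_RGT_0). assert (HPI3 : 3 < PI) by (assert (H := PI2_3_2); unfold PI2 in H; lra).
  set (P := PI / c). set (kap := (0, (2 * c)%R) : C).
  (* With this [h], [|Y| <= h] gives [|kap Y| <= 1 / 32], the range of [cexp_kernel_near]. *)
  set (h := / (64 * c)).
  assert (Hh : 0 < h) by (apply Rinv_0_lt_compat; lra).
  assert (hc : c * h = / 64) by (unfold h; field; lra).
  assert (PC : c * P = PI) by (unfold P; field; lra).
  assert (Mk : Cmod kap = 2 * c).
  { replace kap with (Ci * RtoC (2 * c))%C.
    - rewrite Cmod_mult, Cmod_Ci, Cmod_RtoC_pos by lra. ring.
    - unfold kap. apply injective_projections; simpl; ring. }
  assert (kap0 : kap <> 0) by (apply Cmod_gt_0; lra).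
  assert (Hnu : 0 < 1 - cos (/ 64)).
  { assert (cos (/ 64) < cos 0) by (apply cos_decreasing_1; lra). rewrite cos_0 in *; lra. }
  set (nu := Rmin 1 (sqrt (1 - cos (/ 64)))).
  assert (nu0 : 0 < nu) by (apply Rmin_glb_lt; [lra|apply sqrt_lt_R0; trivial]).
  exists (2 * c / nu + 2 / h + 65 * c), (h / 2).
  assert (0 < / nu) by (apply Rinv_0_lt_compat; trivial).
  assert (0 < / h) by (apply Rinv_0_lt_compat; trivial).
  split; [unfold Rdiv; nra|]. split; [lra|].
  intros X HX HI.
  (* [Y] stands for whichever of [X] and [X - P] is small, and [V] for the other one. Translation by
     [P] changes [kap * X] by [2 PI i], so the pole at [P] is the pole at 0 again. *)
  assert (near : forall Y V : C, Y <> 0 -> Cmod Y <= h -> 1 / c <= Cmod V ->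
     cexp (kap * Y) = cexp (kap * X) ->
     (1 - cexp (kap * X))%C <> 0 /\ Cmod (kap / (1 - cexp (kap * X)) + / Y + / V) <= 65 * c).
  { intros Y V HY0 HY HV E.
    destruct (@cexp_kernel_near (kap * Y)) as [N B].
    - apply Cmult_neq_0; trivial.
    - rewrite Cmod_mult, Mk. nra.
    - rewrite E in N, B. split; trivial.
      assert (V0 : V <> 0).
      { apply Cmod_gt_0. assert (0 < 1 / c) by (apply Rdiv_lt_0_compat; lra). lra. }
      replace (kap / (1 - cexp (kap * X)) + / Y + / V)%C
        with (kap * (/ (1 - cexp (kap * X)) + / (kap * Y)) + 1 / V)%C by (field; auto).
      eapply Rle_trans.
      { eapply Cadd_le; [eapply Cmul_le; [right; exact Mk|exact B]|].
        apply Cdiv_le with (X := 1) (Y := 1 / c); [rewrite Cmod_1; lra| |exact HV].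
        apply Rdiv_lt_0_compat; lra. }
      right; field; lra. }
  assert (Hbig : 65 * c <= 2 * c / nu + 2 / h + 65 * c) by (unfold Rdiv; nra).
  assert (HPh : 1 / c <= P - h).
  { apply Rmult_le_reg_l with c; trivial. unfold Rdiv. rewrite Rmult_1_l, Rinv_r by lra. nra. }
  assert (X0 : X <> 0) by (intros ->; simpl in HX; lra).
  assert (XP : (X - RtoC P)%C <> 0).
  { intros E. apply (f_equal Re) in E. simpl in E. unfold Re in *. lra. }
  destruct (Rle_dec (Cmod X) h) as [H1|H1].
  { destruct (near X (X - RtoC P)%C) as [N B]; trivial.
    - rewrite Cmod_minus_sym. eapply Rle_trans; [|apply Cmod_minus_ge].
      rewrite Cmod_RtoC_pos; lra.
    - split; trivial. apply Rle_trans with (1 := B); trivial. }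
  destruct (Rle_dec (Cmod (X - RtoC P)) h) as [H2|H2].
  { destruct (near (X - RtoC P)%C X) as [N B]; trivial.
    - assert (Q := Cmod_minus_ge (RtoC P) X). rewrite Cmod_RtoC_pos in Q by lra.
      assert (Q2 := Cmod_dist_trans (RtoC P) X 0).
      rewrite (Cmod_minus_sym (RtoC P) X) in Q2.
      replace (RtoC P - 0)%C with (RtoC P) in Q2 by ring. replace (X - 0)%C with X in Q2 by ring.
      rewrite Cmod_RtoC_pos in Q2 by lra. lra.
    - replace (kap * X)%C with (kap * (X - RtoC P) + (0, (2 * PI)%R))%C.
      + symmetry; apply cexp_2PI.
      + unfold kap. destruct X as [x y]. apply injective_projections; simpl; [ring|].
        rewrite <- PC. ring.
    - split; trivial. eapply Rle_trans; [|exact Hbig].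
      replace (kap / (1 - cexp (kap * X)) + / X + / (X - RtoC P))%C
        with (kap / (1 - cexp (kap * X)) + / (X - RtoC P) + / X)%C by ring. exact B. }
  apply Rnot_le_lt in H1. apply Rnot_le_lt in H2.
  assert (s1 : h / 2 <= Re X).
  { assert (Q := Cmod_le_Re_Im X). rewrite (Rabs_pos_eq (Re X)) in Q by lra. lra. }
  assert (s2 : Re X <= P - h / 2).
  { assert (Q := Cmod_le_Re_Im (X - RtoC P)).
    replace (Re (X - RtoC P)) with (Re X - P) in Q by (destruct X; simpl; ring).
    replace (Im (X - RtoC P)) with (Im X) in Q by (destruct X; simpl; ring).
    rewrite (Rabs_left1 (Re X - P)) in Q by lra. lra. }
  (* Away from both poles the argument [2 c Re X] keeps a distance [1 / 64] from 0 and from [2 PI];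
     [nu] covers both signs of its cosine. *)
  assert (L : nu <= Cmod (1 - cexp (kap * X))).
  { assert (EI : Im (kap * X)%C = 2 * c * Re X) by (destruct X; simpl; ring).
    destruct (Rle_dec 0 (cos (Im (kap * X)%C))) as [Hcs|Hcs].
    - apply Rle_trans with (2 := Cmod_1_minus_cexp_ge (kap * X) Hcs).
      rewrite EI in *.
      assert (Q := @sin_ge_away (/ 64) (2 * c * Re X) ltac:(lra) ltac:(nra) Hcs).
      apply Rle_trans with (1 := Rmin_r _ _). rewrite <- sqrt_Rsqr_abs. apply sqrt_le_1_alt.
      unfold Rsqr; nra.
    - apply Rle_trans with (1 := Rmin_l _ _). apply Cmod_1_minus_cexp_ge_1. lra. }
  assert (N : (1 - cexp (kap * X))%C <> 0) by (apply Cmod_gt_0; lra).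
  split; trivial.
  assert (I1 : Cmod (/ X) <= / h) by (rewrite Cmod_inv by trivial; apply Rinv_le_contravar; lra).
  assert (I2 : Cmod (/ (X - RtoC P)) <= / h) by (rewrite Cmod_inv by trivial; apply Rinv_le_contravar; lra).
  eapply Rle_trans; [eapply Cadd_le; [eapply Cadd_le; [|exact I1]|exact I2]|].
  { apply Cdiv_le; [right; exact Mk|exact nu0|exact L]. }
  unfold Rdiv. nra.
Qed.

(** * Motion through the gate *)

(** A primitive of [1 / X + 1 / (X - P)]. Writing [P - X] instead of [X - P] keeps both arguments in
    the right half-plane as long as [0 < Re X < P]. *)
Definition gate_log (P : R) (X : C) : C := (clog X + clog (RtoC P - X))%C.

(** A coarse bound of the logarithm near 0, from [- ln y = 2 ln (1 / sqrt y)]. The weight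
    [1 / sqrt y] is integrable at 0, so it can be summed along the gate like any other power. *)
Lemma Rabs_ln_le y : 0 < y -> Rabs (ln y) <= y + 2 / sqrt y.
Proof.
  intros Hy. assert (Hs : 0 < sqrt y) by (apply sqrt_lt_R0; trivial).
  assert (Hi : 0 < / sqrt y) by (apply Rinv_0_lt_compat; trivial).
  assert (A : ln y <= y).
  { assert (E := exp_ineq1_le (ln y)). rewrite exp_ln in E by trivial. lra. }
  assert (B : - ln y <= 2 / sqrt y).
  { assert (E := exp_ineq1_le (ln (/ sqrt y))). rewrite exp_ln in E by trivial.
    rewrite ln_Rinv in E by trivial.
    assert (E2 : ln y = ln (sqrt y) + ln (sqrt y)).
    { rewrite <- ln_mult by trivial. f_equal. symmetry; apply sqrt_sqrt; lra. }
    unfold Rdiv; lra. }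
  assert (0 < 2 / sqrt y) by (unfold Rdiv; lra). apply Rabs_le; lra.
Qed.

Lemma Cmod_clog_le (Y : C) S : 0 < S -> S <= Re Y ->
  Cmod (clog Y) <= Cmod Y + 2 / sqrt S + 2.
Proof.
  intros HS HY. assert (L : S <= Cmod Y) by (apply Rle_trans with (1 := HY), Rle_trans with (2 := re_le_Cmod Y), Rle_abs).
  eapply Rle_trans; [apply Cmod_le_Re_Im|].
  assert (B := Im_clog_bound Y). assert (HPI : PI <= 4) by apply PI_4.
  assert (A := Rabs_ln_le (Cmod Y) ltac:(lra)).
  change (Re (clog Y)) with (ln (Cmod Y)).
  assert (2 / sqrt (Cmod Y) <= 2 / sqrt S).
  { apply Rmult_le_compat_l; [lra|]. apply Rinv_le_contravar; [apply sqrt_lt_R0; trivial|].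
    apply sqrt_le_1_alt; trivial. }
  lra.
Qed.

Lemma clog_increment (Y D : C) S : 0 < S -> S <= Re Y -> Cmod D <= S / 4 ->
  Cmod (clog (Y + D) - clog Y - D / Y) <= 16 * (Cmod D / S) ^ 2.
Proof.
  intros HS HY HD. assert (L : S <= Cmod Y) by (apply Rle_trans with (1 := HY), Rle_trans with (2 := re_le_Cmod Y), Rle_abs).
  assert (Y0 : Y <> 0) by (apply Cmod_gt_0; lra).
  assert (B : Cmod (D / Y) <= Cmod D / S) by (apply Cdiv_le; trivial; apply Rle_refl).
  assert (B4 : Cmod D / S <= 1 / 4).
  { apply Rmult_le_reg_r with S; trivial. unfold Rdiv. rewrite Rmult_assoc, Rinv_l by lra. lra. }
  replace (Y + D)%C with (Y * (1 + D / Y))%C by (field; trivial).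
  assert (R1 := re_le_Cmod (D / Y)). apply Rabs_le_between in R1 || idtac.
  assert (RD := re_le_Cmod D). apply Rabs_le_between in RD.
  assert (RY := re_le_Cmod (D / Y)). apply Rabs_le_between in RY.
  rewrite clog_mult; try lra.
  - replace (clog Y + clog (1 + D / Y) - clog Y - D / Y)%C with (clog (1 + D / Y) - D / Y)%C by ring.
    eapply Rle_trans; [apply clog_near_1; lra|]. apply Rmult_le_compat_l; [lra|].
    apply pow_incr; split; trivial. apply Cmod_ge_0.
  - replace (Re (1 + D / Y)%C) with (1 + Re (D / Y)%C) by (simpl; ring). lra.
  - replace (Y * (1 + D / Y))%C with (Y + D)%C by (field; trivial).
    replace (Re (Y + D)%C) with (Re Y + Re D) by (destruct Y, D; reflexivity). lra.
Qed.

(** Summation by parts. As [z] is the velocity of [X], the correction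
    [Gam * z ^ 2 * (/ X + / (X - P))] is nearly the increment of [Gam * z * gate_log P X];
    subtracting this product leaves the increment [z] and errors that can be summed. The lower bound
    [rho / n] on the distances to both ends makes one step short compared with them. *)
Lemma gate_step (P K1 Kz : R) (Gam : C) : 0 < P -> 0 <= K1 -> 0 <= Kz ->
  exists K rho0, 0 < K /\ 4 <= rho0 /\
  forall (n rho : R) (X X' z z' : C), rho0 <= rho -> rho0 <= n ->
    Cmod z <= 11 / 10 / n -> 19 / 20 / n <= Re z -> Cmod (z' - z) <= Kz / n ^ 2 ->
    rho / n <= Re X -> rho / n <= P - Re X -> Rabs (Im X) <= 1 ->
    Cmod (X' - X - z - Gam * z ^ 2 * (/ X + / (X - RtoC P)))
      <= K1 * (Cmod z ^ 2 + Cmod z ^ 3 * ((/ Re X) ^ 2 + (/ (P - Re X)) ^ 2)) ->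
    4 / 5 / n <= Re X' - Re X <= 6 / 5 / n /\
    Cmod (gate_log P X') <= K * (1 + / sqrt (Re X) + / sqrt (P - Re X)) /\
    Cmod (X' - Gam * z' * gate_log P X' - (X - Gam * z * gate_log P X) - z)
     <= K / n ^ 2 * (1 + / sqrt (Re X) + / sqrt (P - Re X))
        + K / n ^ 3 * ((/ Re X) ^ 2 + (/ (P - Re X)) ^ 2).
Proof.
  intros HP HK1 HKz.
  set (g := Cmod Gam). assert (g0 : 0 <= g) by apply Cmod_ge_0.
  set (K2 := 2 * g + 2 * K1 + 1).
  set (K3 := 24 + 3 * K2).
  set (KG := 2 * P + 14).
  set (K := 4 * K1 + 20 * g * K3 + 2 * g * Kz * KG + KG).
  assert (K2p : 1 <= K2) by (unfold K2; lra).
  assert (KG1 : 1 <= KG) by (unfold KG; lra).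
  assert (HK : 1 <= K).
  { unfold K. assert (0 <= g * K3) by (unfold K3; nra).
    assert (0 <= g * Kz * KG) by (unfold KG; apply Rmult_le_pos; nra). nra. }
  exists K, (100 * K2). split; [lra|]. split; [lra|].
  intros n rho X X' z z' Hrho Hn Hz Hz1 Hdz Hs Ht HI Hstep.
  set (s := Re X) in *. set (t := P - s) in *.
  assert (n0 : 0 < n) by lra.
  assert (u0 : 0 < / n) by (apply Rinv_0_lt_compat; trivial).
  assert (Hdz' : Cmod (z' - z) <= Kz * (/ n) ^ 2).
  { apply Rle_trans with (1 := Hdz). right. field. lra. }
  unfold Rdiv in *.
  set (u := / n) in *. assert (nu : n * u = 1) by (unfold u; apply Rinv_r; lra).
  assert (rho0 : 0 < rho) by lra.
  assert (ru : 0 < rho * u) by (apply Rmult_lt_0_compat; trivial).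
  assert (s0 : 0 < s) by lra.
  assert (t0 : 0 < t) by lra.
  set (sg := / s) in *. set (tu := / t) in *.
  assert (sg0 : 0 < sg) by (apply Rinv_0_lt_compat; trivial).
  assert (tu0 : 0 < tu) by (apply Rinv_0_lt_compat; trivial).
  assert (Es : s * sg = 1) by (apply Rinv_r; lra).
  assert (Et : t * tu = 1) by (apply Rinv_r; lra).
  assert (us : u * sg * rho <= 1) by (rewrite <- Es; nra).
  assert (ut : u * tu * rho <= 1) by (rewrite <- Et; nra).
  assert (us1 : 100 * K2 * (u * sg) <= 1) by (clear - us Hrho sg0 u0; assert (0 < u * sg) by nra; nra).
  assert (ut1 : 100 * K2 * (u * tu) <= 1) by (clear - ut Hrho tu0 u0; assert (0 < u * tu) by nra; nra).
  assert (uu1 : 100 * K2 * u <= 1) by nra.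
  assert (z0 : 0 <= Cmod z) by apply Cmod_ge_0.
  assert (LX : s <= Cmod X) by (apply Rle_trans with (2 := re_le_Cmod X), Rle_abs).
  assert (LXP : t <= Cmod (X - RtoC P)).
  { rewrite Cmod_minus_sym. apply Rle_trans with (2 := re_le_Cmod _).
    apply Rle_trans with (2 := Rle_abs _). unfold t, s. destruct X; simpl; lra. }
  assert (X0 : X <> 0) by (apply Cmod_gt_0; lra).
  assert (XP0 : (X - RtoC P)%C <> 0) by (apply Cmod_gt_0; lra).
  assert (IX : Cmod (/ X) <= sg) by (rewrite Cmod_inv by trivial; apply Rinv_le_contravar; trivial).
  assert (IXP : Cmod (/ (X - RtoC P)) <= tu) by (rewrite Cmod_inv by trivial; apply Rinv_le_contravar; trivial).
  set (S2 := sg ^ 2 + tu ^ 2) in *. assert (S20 : 0 <= S2) by (unfold S2; nra).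
  assert (z2 : Cmod z ^ 2 <= 3 / 2 * u ^ 2) by (clear - z0 Hz u0; nra).
  assert (z20 : 0 <= Cmod z ^ 2) by apply pow2_ge_0.
  assert (z3 : Cmod z ^ 3 <= 2 * u ^ 3).
  { replace (Cmod z ^ 3) with (Cmod z * Cmod z ^ 2) by ring.
    apply Rle_trans with (11 * / 10 * u * (3 / 2 * u ^ 2)); [apply Rmult_le_compat; trivial|].
    assert (0 < u ^ 3) by (apply pow_lt; trivial).
    replace (11 * / 10 * u * (3 / 2 * u ^ 2)) with (33 / 20 * u ^ 3) by field. lra. }
  assert (HstepU : Cmod (X' - X - z - Gam * z ^ 2 * (/ X + / (X - P))) <= 2 * K1 * (u ^ 2 + u ^ 3 * S2)).
  { apply Rle_trans with (1 := Hstep).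
    assert (Cmod z ^ 3 * S2 <= 2 * u ^ 3 * S2) by (apply Rmult_le_compat_r; trivial).
    assert (0 <= u ^ 2) by apply pow2_ge_0.
    apply Rle_trans with (K1 * (2 * u ^ 2 + 2 * u ^ 3 * S2)); [apply Rmult_le_compat_l; lra|].
    right; ring. }
  assert (D1 : Cmod (X' - X - z) <= K2 * u ^ 2 * (1 + sg + tu)).
  { replace (X' - X - z)%C with ((X' - X - z - Gam * z ^ 2 * (/ X + / (X - P))) + Gam * z ^ 2 * (/ X + / (X - P)))%C by ring.
    eapply Rle_trans.
    { eapply Cadd_le; [exact HstepU|]. eapply Cmul_le; [|eapply Cadd_le; eassumption].
      eapply Cmul_le; [apply Rle_refl|]. rewrite Cmod_pow; exact z2. }
    fold g.
    assert (u ^ 3 * S2 <= u ^ 2 * (sg + tu)).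
    { unfold S2. replace (u ^ 3 * (sg ^ 2 + tu ^ 2)) with (u ^ 2 * (u * sg * sg + u * tu * tu)) by ring.
      apply Rmult_le_compat_l; [apply pow2_ge_0|]. clear - us1 ut1 K2p sg0 tu0 u0.
      assert (0 < u * sg) by (apply Rmult_lt_0_compat; trivial).
      assert (0 < u * tu) by (apply Rmult_lt_0_compat; trivial).
      assert (u * sg <= 1) by nra. assert (u * tu <= 1) by nra. nra. }
    assert (0 <= u ^ 2) by apply pow2_ge_0.
    assert (0 <= u ^ 2 * (sg + tu)) by (apply Rmult_le_pos; lra).
    unfold K2.
    replace ((2 * g + 2 * K1 + 1) * u ^ 2 * (1 + sg + tu)) with
      (2 * g * (u ^ 2 * (sg + tu)) + 2 * g * u ^ 2 + 2 * K1 * (u ^ 2 + u ^ 2 * (sg + tu)) + (u ^ 2 + u ^ 2 * (sg + tu))) by ring.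
    replace (g * (3 / 2 * u ^ 2) * (sg + tu)) with (3 / 2 * g * (u ^ 2 * (sg + tu))) by ring.
    assert (0 <= g * (u ^ 2 * (sg + tu))) by (apply Rmult_le_pos; lra).
    assert (0 <= g * u ^ 2) by (apply Rmult_le_pos; lra).
    assert (K1 * (u ^ 2 + u ^ 3 * S2) <= K1 * (u ^ 2 + u ^ 2 * (sg + tu))) by (apply Rmult_le_compat_l; lra).
    lra. }
  assert (D1' : Cmod (X' - X - z) <= u * (3 / 100)).
  { apply Rle_trans with (1 := D1).
    replace (K2 * u ^ 2 * (1 + sg + tu)) with (u * (K2 * u + K2 * (u * sg) + K2 * (u * tu))) by ring.
    apply Rmult_le_compat_l; lra. }
  assert (DR := Re_ge_of_dist (X' - X) z (u * (3 / 100)) D1').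
  replace (Re (X' - X)%C) with (Re X' - s) in DR by (unfold s; destruct X, X'; reflexivity).
  apply Rabs_le_between in DR.
  assert (RZ := re_le_Cmod z). apply Rabs_le_between in RZ.
  split; [lra|].
  assert (KGK : KG <= K).
  { unfold K. assert (0 <= g * K3) by (apply Rmult_le_pos; unfold K3; lra).
    assert (0 <= g * Kz * KG) by (apply Rmult_le_pos; [apply Rmult_le_pos; lra|lra]). lra. }
  set (D := (X' - X)%C).
  assert (HD : Cmod D <= 6 / 5 * u).
  { unfold D. replace (X' - X)%C with ((X' - X - z) + z)%C by ring.
    eapply Rle_trans; [eapply Cadd_le; [exact D1'|exact Hz]|]. lra. }
  assert (ru2 : 100 * u <= rho * u) by (apply Rmult_le_compat_r; lra).
  assert (Q1 : Cmod D <= s / 4) by lra.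
  assert (Q2 : Cmod D <= t / 4) by lra.
  assert (G1 := @clog_increment X D s s0 (Rle_refl _) Q1).
  assert (Ht' : t <= Re (RtoC P - X)%C) by (unfold t, s; destruct X; simpl; lra).
  assert (G2 := @clog_increment (RtoC P - X) (- D) t t0 Ht' ltac:(rewrite Cmod_opp; trivial)).
  rewrite Cmod_opp in G2.
  replace (X + D)%C with X' in G1 by (unfold D; ring).
  replace (P - X + - D)%C with (P - X')%C in G2 by (unfold D; ring).
  assert (HG : Cmod (gate_log P X' - gate_log P X - z * (/ X + / (X - P))) <= K3 * u ^ 2 * (1 + S2)).
  { replace (gate_log P X' - gate_log P X - z * (/ X + / (X - P)))%C with
      ((clog X' - clog X - D / X) + (clog (P - X') - clog (P - X) - - D / (P - X))
        + (D - z) * (/ X + / (X - P)))%C.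
    2:{ unfold gate_log. field. split; [|split]; trivial.
        intros E; apply XP0. replace (X - P)%C with (- (P - X))%C by ring. rewrite E. ring. }
    eapply Rle_trans.
    { eapply Cadd_le; [eapply Cadd_le; [exact G1|exact G2]|].
      eapply Cmul_le; [exact D1|eapply Cadd_le; eassumption]. }
    assert (P1 : (Cmod D / s) ^ 2 <= 3 / 2 * u ^ 2 * sg ^ 2).
    { unfold Rdiv. fold sg. rewrite Rpow_mult_distr. apply Rmult_le_compat_r; [apply pow2_ge_0|].
      assert (D0 : 0 <= Cmod D) by apply Cmod_ge_0. clear - D0 HD u0. nra. }
    assert (P2 : (Cmod D / t) ^ 2 <= 3 / 2 * u ^ 2 * tu ^ 2).
    { unfold Rdiv. fold tu. rewrite Rpow_mult_distr. apply Rmult_le_compat_r; [apply pow2_ge_0|].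
      assert (D0 : 0 <= Cmod D) by apply Cmod_ge_0. clear - D0 HD u0. nra. }
    assert (P3 : (1 + sg + tu) * (sg + tu) <= 3 * (1 + S2)).
    { unfold S2. assert (0 <= (sg - tu) ^ 2) by apply pow2_ge_0.
      assert (0 <= (sg - 1) ^ 2) by apply pow2_ge_0. assert (0 <= (tu - 1) ^ 2) by apply pow2_ge_0. lra. }
    assert (U2 : 0 <= u ^ 2) by apply pow2_ge_0.
    assert (P4 : K2 * u ^ 2 * ((1 + sg + tu) * (sg + tu)) <= K2 * u ^ 2 * (3 * (1 + S2))).
    { apply Rmult_le_compat_l; trivial. apply Rmult_le_pos; lra. }
    unfold K3. replace (K2 * u ^ 2 * (1 + sg + tu) * (sg + tu)) with (K2 * u ^ 2 * ((1 + sg + tu) * (sg + tu))) by ring.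
    assert (3 / 2 * u ^ 2 * sg ^ 2 + 3 / 2 * u ^ 2 * tu ^ 2 = 3 / 2 * u ^ 2 * S2) by (unfold S2; ring).
    replace ((24 + 3 * K2) * u ^ 2 * (1 + S2)) with (24 * u ^ 2 + 24 * u ^ 2 * S2 + K2 * u ^ 2 * (3 * (1 + S2))) by ring.
    lra. }
  set (rs := / sqrt s). set (rt := / sqrt t).
  assert (rs0 : 0 < rs) by (apply Rinv_0_lt_compat, sqrt_lt_R0; trivial).
  assert (rt0 : 0 < rt) by (apply Rinv_0_lt_compat, sqrt_lt_R0; trivial).
  assert (u1 : u <= 1) by (clear - uu1 K2p u0; nra).
  assert (HX' : X' = (X + D)%C) by (unfold D; ring).
  assert (MX : Cmod X <= P + 1).
  { eapply Rle_trans; [apply Cmod_le_Re_Im|]. fold s. rewrite (Rabs_pos_eq s) by lra. unfold t in *; lra. }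
  assert (MXP : Cmod (P - X) <= P + 1).
  { eapply Rle_trans; [apply Cmod_le_Re_Im|].
    replace (Re (P - X)%C) with t by (unfold t, s; destruct X; simpl; ring).
    replace (Im (P - X)%C) with (- Im X) by (destruct X; simpl; ring).
    rewrite Rabs_Ropp, (Rabs_pos_eq t) by lra. unfold t in *; lra. }
  assert (L1 : Cmod (clog X') <= P + 1 + 6 / 5 + 2 * rs + 2).
  { eapply Rle_trans; [apply (@Cmod_clog_le X' s); lra|].
    assert (Cmod X' <= P + 1 + 6 / 5).
    { rewrite HX'. eapply Rle_trans; [eapply Cadd_le; [exact MX|exact HD]|]. lra. }
    unfold rs, Rdiv. lra. }
  assert (L2 : Cmod (clog (P - X')) <= P + 1 + 6 / 5 + 4 * rt + 2).
  { eapply Rle_trans; [apply (@Cmod_clog_le (P - X') (t / 4)); [lra|]|].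
    - replace (Re (P - X')%C) with (P - Re X') by (destruct X'; simpl; ring). unfold t in *; lra.
    - assert (Cmod (P - X') <= P + 1 + 6 / 5).
      { replace (P - X')%C with (P - X - D)%C by (rewrite HX'; ring).
        eapply Rle_trans; [eapply Csub_le; [exact MXP|exact HD]|]. lra. }
      assert (2 / sqrt (t / 4) = 4 * rt).
      { unfold rt. assert (0 < sqrt t) by (apply sqrt_lt_R0; trivial).
        replace (t / 4) with (t * (/ 2 * / 2)) by field.
        rewrite sqrt_mult, sqrt_square by lra. field. lra. }
      lra. }
  assert (HG' : Cmod (gate_log P X') <= KG * (1 + rs + rt)).
  { unfold gate_log. eapply Rle_trans; [eapply Cadd_le; [exact L1|exact L2]|].
    unfold KG. clear - HP rs0 rt0. nra. }
  split.
  { apply Rle_trans with (1 := HG'). fold rs rt. apply Rmult_le_compat_r; lra. }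
  (* Exact splitting: the error of the step, the second-order error of the logarithm along the step,
     and the variation of [z], which is [O(1 / n ^ 2)] but multiplied by a logarithm that is large
     near the ends. *)
  replace (X' - Gam * z' * gate_log P X' - (X - Gam * z * gate_log P X) - z)%C with
    ((X' - X - z - Gam * z ^ 2 * (/ X + / (X - P)))
     - Gam * z * (gate_log P X' - gate_log P X - z * (/ X + / (X - P)))
     - Gam * (z' - z) * gate_log P X')%C by ring.
  eapply Rle_trans.
  { eapply Csub_le; [eapply Csub_le; [exact HstepU|]|].
    - eapply Cmul_le; [eapply Cmul_le; [apply Rle_refl|exact Hz]|exact HG].
    - eapply Cmul_le; [eapply Cmul_le; [apply Rle_refl|exact Hdz']|exact HG']. }
  fold g rs rt.
  replace (/ n ^ 2) with (u ^ 2) by (unfold u; rewrite pow_inv; trivial).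
  replace (/ n ^ 3) with (u ^ 3) by (unfold u; rewrite pow_inv; trivial).
  assert (U2 : 0 <= u ^ 2) by apply pow2_ge_0. assert (U3 : 0 <= u ^ 3) by (apply pow_le; lra).
  assert (U32 : u ^ 3 <= u ^ 2).
  { replace (u ^ 3) with (u ^ 2 * u) by ring. clear - U2 u1. nra. }
  set (V := 1 + rs + rt). assert (V1 : 1 <= V) by (unfold V; lra).
  assert (W1 : u ^ 2 <= u ^ 2 * V) by (clear - U2 V1; nra).
  assert (W3 : 0 <= u ^ 3 * S2) by (apply Rmult_le_pos; trivial).
  assert (gK3 : 0 <= g * K3) by (apply Rmult_le_pos; unfold K3; lra).
  assert (gKG : 0 <= g * Kz * KG).
  { apply Rmult_le_pos; [apply Rmult_le_pos; lra|unfold KG; lra]. }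
  assert (F1 : K1 * (u ^ 2 + u ^ 3 * S2) <= K1 * (u ^ 2 * V + u ^ 3 * S2)) by (apply Rmult_le_compat_l; lra).
  assert (F2 : g * K3 * (u ^ 3 + u ^ 3 * S2) <= g * K3 * (u ^ 2 * V + u ^ 3 * S2)) by (apply Rmult_le_compat_l; lra).
  assert (F3 : 0 <= g * Kz * KG * (u ^ 2 * V)) by (apply Rmult_le_pos; lra).
  assert (F4 : 0 <= g * Kz * KG * (u ^ 3 * S2)) by (apply Rmult_le_pos; lra).
  assert (F5 : 0 <= K1 * (u ^ 2 * V + u ^ 3 * S2)) by (apply Rmult_le_pos; lra).
  assert (F6 : 0 <= g * K3 * (u ^ 2 * V + u ^ 3 * S2)) by (apply Rmult_le_pos; lra).
  unfold K.
  replace (g * (11 * / 10 * u) * (K3 * u ^ 2 * (1 + S2))) with (11 / 10 * (g * K3 * (u ^ 3 + u ^ 3 * S2))) by field.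
  replace (g * (Kz * u ^ 2) * (KG * V)) with (g * Kz * KG * (u ^ 2 * V)) by ring.
  replace (_ * u ^ 2 * V + _ * u ^ 3 * S2) with
    (4 * (K1 * (u ^ 2 * V + u ^ 3 * S2)) + 20 * (g * K3 * (u ^ 2 * V + u ^ 3 * S2))
     + 2 * (g * Kz * KG * (u ^ 2 * V)) + 2 * (g * Kz * KG * (u ^ 3 * S2)) + KG * (u ^ 2 * V + u ^ 3 * S2)) by ring.
  assert (F7 : 0 <= KG * (u ^ 2 * V + u ^ 3 * S2)) by (apply Rmult_le_pos; lra).
  lra.
Qed.

(** * The base dynamics *)

(** The single form in which times are required to be late: a large [Q] absorbs constants as well as
    [ln x] and its square. The square serves where a quantity of size [ln n / n] is squared and then
    multiplied by [n]. *)
Definition big (Q x : R) : Prop := 1 <= x /\ Q * (1 + ln x) ^ 2 <= x.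

Lemma ln_nonneg x : 1 <= x -> 0 <= ln x.
Proof. intros H. rewrite <- ln_1. apply ln_le; lra. Qed.

Lemma big_ev Q : exists M, forall x, M <= x -> big Q x.
Proof.
  exists (Rmax 1 ((25 * Rabs Q) ^ 2)). intros x Hx.
  assert (H1 : 1 <= x) by (apply Rle_trans with (2 := Hx), Rmax_l).
  assert (H2 : (25 * Rabs Q) ^ 2 <= x) by (apply Rle_trans with (2 := Hx), Rmax_r).
  split; trivial.
  (* With the fourth root, [ln x = 4 ln y <= 4 y], hence [(1 + ln x) ^ 2 <= 25 sqrt x]; the square
     in the chosen threshold gives [25 Q <= sqrt x] for the other half. *)
  set (y := sqrt (sqrt x)).
  assert (y2 : y * y = sqrt x) by (apply sqrt_sqrt, sqrt_pos).
  assert (x2 : sqrt x * sqrt x = x) by (apply sqrt_sqrt; lra).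
  assert (sx : 1 <= sqrt x) by (rewrite <- sqrt_1; apply sqrt_le_1_alt; trivial).
  assert (y1 : 1 <= y) by (rewrite <- sqrt_1; apply sqrt_le_1_alt; trivial).
  assert (E : ln x = 4 * ln y).
  { rewrite <- x2, ln_mult, <- y2, ln_mult by lra. ring. }
  assert (L : ln y <= y).
  { assert (E' := exp_ineq1_le (ln y)). rewrite exp_ln in E' by lra. lra. }
  assert (L0 := ln_nonneg x H1).
  assert (B : (1 + ln x) ^ 2 <= 25 * sqrt x).
  { rewrite <- y2. clear - E L L0 y1. nra. }
  assert (A : 25 * Rabs Q <= sqrt x).
  { rewrite <- (sqrt_pow2 (25 * Rabs Q)); [apply sqrt_le_1_alt; trivial|].
    assert (0 <= Rabs Q) by apply Rabs_pos. lra. }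
  assert (Q0 := Rabs_pos Q). assert (Q1 := Rle_abs Q).
  apply Rle_trans with (Rabs Q * (1 + ln x) ^ 2); [apply Rmult_le_compat_r; trivial; apply pow2_ge_0|].
  apply Rle_trans with (Rabs Q * (25 * sqrt x)); [apply Rmult_le_compat_l; trivial|].
  clear - A x2 sx. nra.
Qed.

Lemma big_ev_INR Q : exists M : nat, forall j, (M <= j)%nat -> big Q (INR j).
Proof.
  destruct (big_ev Q) as [M HM]. destruct (nfloor_ex (Rmax 0 M)) as [N HN]; [apply Rmax_l|].
  exists (S N). intros j Hj. apply HM.
  apply le_INR in Hj. rewrite S_INR in Hj. assert (H := Rmax_r 0 M). lra.
Qed.

Lemma big_mono Q Q' x : Q' <= Q -> big Q x -> big Q' x.
Proof.
  intros H [H1 H2]. split; trivial. apply Rle_trans with (2 := H2).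
  apply Rmult_le_compat_r; trivial. apply pow2_ge_0.
Qed.

Lemma big_ge Q x : 0 <= Q -> big Q x -> Q <= x.
Proof.
  intros HQ [H1 H2]. assert (L := ln_nonneg x H1).
  apply Rle_trans with (2 := H2). clear - HQ L. nra.
Qed.

Lemma big_lin Q x : 0 <= Q -> big Q x -> Q * (1 + ln x) <= x.
Proof.
  intros HQ [H1 H2]. assert (L := ln_nonneg x H1).
  apply Rle_trans with (2 := H2). apply Rmult_le_compat_l; trivial. clear - L. nra.
Qed.

(* [a] and [d] are the only data of the base orbit that the fiber dynamics sees. *)
Definition clock (a d : C) (z : nat -> C) (m : nat) : Prop :=
  forall j, (m <= j)%nat -> z j <> 0 /\
    Cmod (/ z j - (RtoC (INR j) + (1 - a) * RtoC (ln (INR j)) + d)) <= 1.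

(** An approximate primitive of [z_j]: the expansion [1 / n - ((1 - a) ln n + d) / n ^ 2] of the
    inverse of [n + (1 - a) ln n + d] is the increment of [drift] up to [O(1 / n ^ 2)]. *)
Definition drift (a d : C) (x : R) : C :=
  (RtoC (ln x) + (1 - a) * RtoC (ln x / x) + d * RtoC (/ x))%C.

Lemma ln_succ_bounds n : 2 <= n -> Rabs (ln (n + 1) - ln n - / n) <= 4 / n ^ 2.
Proof.
  intros Hn. assert (0 < / n) by (apply Rinv_0_lt_compat; lra).
  assert (E : ln (n + 1) - ln n = ln (1 + / n)).
  { replace (n + 1) with (n * (1 + / n)) by (field; lra). rewrite ln_mult by lra. ring. }
  rewrite E.
  assert (/ n <= / 2) by (apply Rinv_le_contravar; lra).
  assert (B := ln_1p_bound (/ n)). rewrite Rabs_pos_eq in B by lra.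
  specialize (B ltac:(lra)). unfold Rdiv. rewrite <- pow_inv. exact B.
Qed.

Lemma drift_step (a d : C) (n : R) : 4 <= n -> Cmod d <= n ->
  Cmod (drift a d (n + 1) - drift a d n
        - (RtoC (/ n) - ((1 - a) * RtoC (ln n) + d) * RtoC (/ n ^ 2)))
    <= (5 + 8 * Cmod (1 - a)) / n ^ 2.
Proof.
  intros Hn Hd.
  assert (B1 := ln_succ_bounds n ltac:(lra)).
  assert (L0 : 0 <= ln n) by (apply ln_nonneg; lra).
  assert (Ln : ln n <= n).
  { assert (E' := exp_ineq1_le (ln n)). rewrite exp_ln in E' by lra. lra. }
  set (D := ln (n + 1) - ln n) in *.
  assert (HD : 0 <= D <= 2 / n).
  { apply Rabs_le_between in B1.
    assert (4 / n ^ 2 <= / n).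
    { apply Rmult_le_reg_r with (n ^ 2); [nra|]. unfold Rdiv. rewrite Rmult_assoc, Rinv_l by nra.
      replace (/ n * n ^ 2) with n by (field; lra). lra. }
    unfold Rdiv in *. lra. }
  replace (drift a d (n + 1) - drift a d n
        - (RtoC (/ n) - ((1 - a) * RtoC (ln n) + d) * RtoC (/ n ^ 2)))%C with
    (RtoC (D - / n) + (1 - a) * RtoC (D / (n + 1) + ln n / (n ^ 2 * (n + 1)))
      + d * RtoC (/ (n ^ 2 * (n + 1))))%C.
  2:{ replace (D / (n + 1) + ln n / (n ^ 2 * (n + 1))) with
        (ln (n + 1) / (n + 1) - ln n / n + ln n * / n ^ 2) by (unfold D; field; lra).
      replace (/ (n ^ 2 * (n + 1))) with (/ (n + 1) - / n + / n ^ 2) by (field; lra).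
      unfold drift, D. rewrite !RtoC_plus, !RtoC_minus, !RtoC_mult. ring. }
  assert (V2 : / (n ^ 2 * (n + 1)) <= / n ^ 2 * / n).
  { rewrite <- Rinv_mult. apply Rinv_le_contravar; nra. }
  assert (V3 : 0 < / (n ^ 2 * (n + 1))) by (apply Rinv_0_lt_compat; nra).
  assert (T2 : 0 <= D / (n + 1) + ln n / (n ^ 2 * (n + 1)) <= 3 * / n ^ 2).
  { assert (0 < / (n + 1)) by (apply Rinv_0_lt_compat; lra).
    assert (/ (n + 1) <= / n) by (apply Rinv_le_contravar; lra).
    unfold Rdiv in *. split; [apply Rplus_le_le_0_compat; apply Rmult_le_pos; lra|].
    assert (D * / (n + 1) <= 2 * / n ^ 2).
    { replace (2 * / n ^ 2) with (2 * / n * / n) by (field; lra). apply Rmult_le_compat; lra. }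
    assert (ln n * / (n ^ 2 * (n + 1)) <= n * (/ n ^ 2 * / n)) by (apply Rmult_le_compat; lra).
    replace (n * (/ n ^ 2 * / n)) with (/ n ^ 2) in * by (field; lra). lra. }
  assert (T3 : Cmod d * / (n ^ 2 * (n + 1)) <= / n ^ 2).
  { apply Rle_trans with (n * (/ n ^ 2 * / n)).
    - apply Rmult_le_compat; try lra. apply Cmod_ge_0.
    - right; field; lra. }
  eapply Rle_trans.
  { eapply Cadd_le; [eapply Cadd_le; [rewrite Cmod_R; exact B1|]|].
    - eapply Cmul_le; [apply Rle_refl|]. rewrite Cmod_RtoC_pos by lra. apply T2.
    - rewrite Cmod_mult, Cmod_RtoC_pos by lra. exact T3. }
  unfold Rdiv. assert (0 <= Cmod (1 - a)) by apply Cmod_ge_0.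
  assert (0 <= Cmod (1 - a) * / n ^ 2) by (apply Rmult_le_pos; lra). lra.
Qed.

(** The order of the quantifiers matters: [Kz] depends on [a] alone, and only the threshold [Q]
    depends on the bound [rho] for [d]; the last estimate displays its [rho] explicitly. This is how
    the error constants of a passage come to be independent of [rho]. *)
Lemma clock_step (a : C) : exists Kz, 1 <= Kz /\ forall rho, 1 <= rho -> exists Q, 1 <= Q /\
  forall (d : C) (z : nat -> C) (m j : nat), Cmod d <= rho -> clock a d z m -> (m <= j)%nat ->
  big Q (INR j) ->
  let n := INR j in
  Cmod (z j) <= 11 / 10 / n /\ 19 / 20 / n <= Re (z j) /\
  Cmod (z (S j) - z j) <= Kz / n ^ 2 /\
  Cmod (drift a d (n + 1) - drift a d n - z j) <= Kz / n ^ 2 /\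
  Cmod (z j - RtoC (/ n)) <= Kz * rho * (1 + ln n) / n ^ 2.
Proof.
  set (k := Cmod (1 - a)). assert (k0 : 0 <= k) by apply Cmod_ge_0.
  exists (20 + 20 * k). split; [lra|]. intros rho Hrho.
  set (kk := k + rho + 1).
  exists (1000 * kk ^ 2). assert (Hkk : 2 <= kk) by (unfold kk; lra).
  split; [clear - Hkk; nra|].
  intros d z m j Hd Hcl Hj HB n.
  assert (Hn1 : 1 <= n) by apply HB.
  assert (HQn : 4000 <= n).
  { assert (H := @big_ge (1000 * kk ^ 2) n ltac:(clear - Hkk; nra) HB). clear - H Hkk. nra. }
  set (L := 1 + ln n). assert (L1 : 1 <= L) by (unfold L; assert (H := ln_nonneg n Hn1); lra).
  assert (HL2 : 1000 * (kk * L) ^ 2 <= n).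
  { destruct HB as [_ HB]. fold n L in HB. rewrite Rpow_mult_distr. lra. }
  assert (kL : 2 <= kk * L) by (clear - Hkk L1; nra).
  assert (HL1 : 100 * (kk * L) <= n) by (clear - HL2 kL; nra).
  destruct (Hcl j Hj) as [Z0 HZ]. fold n in HZ.
  set (zt := (/ z j)%C) in *.
  assert (Ez : z j = (/ zt)%C) by (unfold zt; field; trivial).
  assert (dist : forall (y : R) e, 0 <= y -> Cmod e <= 1 -> Cmod ((1 - a) * RtoC y + d + e) <= kk * (1 + y)).
  { intros y e Hy He. eapply Rle_trans.
    { eapply Cadd_le; [eapply Cadd_le; [eapply Cmul_le; [apply Rle_refl|rewrite Cmod_RtoC_pos by trivial; apply Rle_refl]|exact Hd]|exact He]. }
    fold k. unfold kk. clear - k0 Hrho Hy. nra. }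
  set (e := (zt - (RtoC n + (1 - a) * RtoC (ln n) + d))%C) in *.
  set (y := (zt - RtoC n)%C).
  assert (Hy : Cmod y <= kk * L).
  { replace y with ((1 - a) * RtoC (ln n) + d + e)%C by (unfold y, e; ring).
    apply dist; trivial. apply ln_nonneg; trivial. }
  assert (Mzt : 99 / 100 * n <= Cmod zt).
  { replace zt with (RtoC n + y)%C by (unfold y; ring).
    eapply Rle_trans; [|apply Cmod_plus_ge]. rewrite Cmod_RtoC_pos by lra. lra. }
  assert (zt0 : zt <> 0) by (apply Cmod_gt_0; lra).
  assert (u0 : 0 < / n) by (apply Rinv_0_lt_compat; lra).
  assert (n0 : RtoC n <> 0) by (intros E; apply RtoC_inj in E; lra).
  assert (V1 : 0 < n ^ 2) by (apply pow_lt; lra).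
  assert (V0 : 0 < / n ^ 2) by (apply Rinv_0_lt_compat; trivial).
  assert (D1 : Cmod (z j - RtoC (/ n)) <= 2 * (kk * L) / n ^ 2).
  { rewrite Ez, RtoC_inv by lra.
    replace (/ zt - / RtoC n)%C with ((- y) / (zt * RtoC n))%C by (unfold y; field; split; trivial).
    eapply Rle_trans.
    { apply Cdiv_le with (X := kk * L) (Y := 99 / 100 * n * n).
      - rewrite Cmod_opp; trivial.
      - nra.
      - rewrite Cmod_mult, Cmod_RtoC_pos by lra. apply Rmult_le_compat_r; lra. }
    replace (kk * L / (99 / 100 * n * n)) with (100 / 99 * (kk * L) * / n ^ 2) by (field; lra).
    unfold Rdiv. apply Rmult_le_compat_r; lra. }
  assert (D2 : 2 * (kk * L) / n ^ 2 <= / 50 * / n).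
  { apply Rmult_le_reg_r with (n ^ 2); trivial. unfold Rdiv.
    rewrite Rmult_assoc, Rinv_l by lra. replace (/ 50 * / n * n ^ 2) with (n / 50) by (field; lra). lra. }
  assert (D3 : Rabs (Re (z j) - / n) <= / 50 * / n).
  { assert (H := Re_ge_of_dist (z j) (RtoC (/ n)) _ (Rle_trans _ _ _ D1 D2)). exact H. }
  assert (D4 : Cmod (z j) <= 51 / 50 * / n).
  { replace (z j) with (RtoC (/ n) + (z j - RtoC (/ n)))%C by ring.
    eapply Rle_trans; [eapply Cadd_le; [rewrite Cmod_RtoC_pos by lra; apply Rle_refl|exact (Rle_trans _ _ _ D1 D2)]|]. lra. }
  apply Rabs_le_between in D3.
  split; [unfold Rdiv; lra|]. split; [unfold Rdiv; lra|].
  split; [|split].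
  - destruct (Hcl (S j) ltac:(lia)) as [Z0' HZ']. rewrite S_INR in HZ'. fold n in HZ'.
    set (zt' := (/ z (S j))%C) in *.
    assert (Ez' : z (S j) = (/ zt')%C) by (unfold zt'; field; trivial).
    set (D := ln (n + 1) - ln n).
    assert (HD : Rabs D <= 1).
    { assert (H := ln_succ_bounds n ltac:(lra)). fold D in H.
      assert (4 / n ^ 2 <= / 2).
      { unfold Rdiv. apply Rmult_le_reg_r with (n ^ 2); trivial. rewrite Rmult_assoc, Rinv_l by lra. clear - HQn. nra. }
      assert (/ n <= / 2) by (apply Rinv_le_contravar; lra).
      apply Rabs_le_between in H. apply Rabs_le; lra. }
    assert (Hd' : Cmod (zt' - zt) <= 3 + k).
    { replace (zt' - zt)%C with ((zt' - (RtoC (n + 1) + (1 - a) * RtoC (ln (n + 1)) + d)) - e + 1 + (1 - a) * RtoC D)%C.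
      - eapply Rle_trans.
        { eapply Cadd_le; [eapply Cadd_le; [eapply Csub_le; [exact HZ'|exact HZ]|rewrite Cmod_1; apply Rle_refl]|].
          eapply Cmul_le; [apply Rle_refl|rewrite Cmod_R; exact HD]. }
        fold k. lra.
      - unfold e, D. rewrite RtoC_minus, RtoC_plus. ring. }
    assert (Mzt' : 1 / 2 * n <= Cmod zt').
    { replace zt' with (zt + (zt' - zt))%C by ring. eapply Rle_trans; [|apply Cmod_plus_ge].
      assert (k <= kk * L) by (unfold kk in *; clear - k0 Hrho L1; nra). lra. }
    assert (zt'0 : zt' <> 0) by (apply Cmod_gt_0; lra).
    rewrite Ez, Ez'. replace (/ zt' - / zt)%C with ((- (zt' - zt)) / (zt' * zt))%C by (field; split; trivial).
    eapply Rle_trans.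
    { apply Cdiv_le with (X := 3 + k) (Y := 1 / 2 * n * (99 / 100 * n)).
      - rewrite Cmod_opp; trivial.
      - nra.
      - rewrite Cmod_mult. apply Rmult_le_compat; lra. }
    replace ((3 + k) / (1 / 2 * n * (99 / 100 * n))) with (200 / 99 * (3 + k) * / n ^ 2) by (field; lra).
    unfold Rdiv. apply Rmult_le_compat_r; lra.
  - assert (S1 := @drift_step a d n ltac:(lra) ltac:(unfold kk in *; clear - Hd HL1 L1 k0 Hrho; nra)).
    fold k in S1.
    replace (drift a d (n + 1) - drift a d n - z j)%C with
      ((drift a d (n + 1) - drift a d n - (RtoC (/ n) - ((1 - a) * RtoC (ln n) + d) * RtoC (/ n ^ 2)))
       - (y ^ 2 / (RtoC (n ^ 2) * zt) - e * RtoC (/ n ^ 2)))%C.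
    (* Geometric expansion of [/ zt] around [n]: the first two terms match the increment of [drift],
       and the third is [O(1 / n ^ 2)] because [|y| ^ 2 <= n]. *)
    2:{ assert (Hy2 : y = ((1 - a) * RtoC (ln n) + d + e)%C) by (unfold y, e; ring).
        assert (EQ : (/ zt = / RtoC n - y / RtoC n ^ 2 + y ^ 2 / (RtoC n ^ 2 * zt))%C).
        { unfold y. field. split; trivial. }
        rewrite Ez, EQ, !RtoC_inv, !RtoC_pow by lra.
        set (W := (y ^ 2 / (RtoC n ^ 2 * zt))%C). rewrite Hy2. field. trivial. }
    assert (S2 : Cmod (y ^ 2 / (RtoC (n ^ 2) * zt)) <= / n ^ 2).
    { eapply Rle_trans.
      { apply Cdiv_le with (X := (kk * L) ^ 2) (Y := n ^ 2 * (99 / 100 * n)).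
        - apply Cpow_le; trivial.
        - apply Rmult_lt_0_compat; lra.
        - rewrite Cmod_mult, Cmod_RtoC_pos by lra. apply Rmult_le_compat_l; lra. }
      apply Rmult_le_reg_r with (n ^ 2 * (99 / 100 * n)); [apply Rmult_lt_0_compat; lra|].
      unfold Rdiv at 1. rewrite Rmult_assoc, Rinv_l, Rmult_1_r by (apply Rgt_not_eq, Rmult_lt_0_compat; lra).
      rewrite <- Rmult_assoc, Rinv_l by lra. lra. }
    eapply Rle_trans.
    { eapply Csub_le; [exact S1|eapply Csub_le; [exact S2|]].
      eapply Cmul_le; [exact HZ|rewrite Cmod_RtoC_pos by lra; apply Rle_refl]. }
    unfold Rdiv. assert (0 <= k * / n ^ 2) by (apply Rmult_le_pos; lra). lra.
  - apply Rle_trans with (1 := D1). unfold Rdiv. fold L. apply Rmult_le_compat_r; [lra|].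
    rewrite <- Rmult_assoc. apply Rmult_le_compat_r; [lra|]. unfold kk.
    clear - k0 Hrho. nra.
Qed.

(** * Crossing the gate *)

(* Its increments dominate the step errors, so summing the errors along the gate telescopes. *)
Definition gate_potential (P K m s : R) : R :=
  4 * K / m * (s + sqrt s - sqrt (P - s)) + 4 * K / m ^ 2 * (/ (P - s) - / s).

(** Term by term, [/ sqrt s] is paid by the growth of [sqrt s] and [(/ s) ^ 2] by that of [- / s],
    and symmetrically in [P - s]. As [s] advances by about [1 / n], one factor [1 / n] is used up
    and the others are replaced by [1 / m]. *)
Lemma gate_potential_step (P K m n s s' : R) :
  0 < K -> 1 <= m -> m <= n -> 4 / n <= s -> 4 / n <= P - s ->
  4 / 5 / n <= s' - s <= 6 / 5 / n ->
  K / n ^ 2 * (1 + / sqrt s + / sqrt (P - s)) + K / n ^ 3 * ((/ s) ^ 2 + (/ (P - s)) ^ 2)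
    <= gate_potential P K m s' - gate_potential P K m s.
Proof.
  intros HK Hm Hmn Hs Ht HD.
  assert (n0 : 0 < n) by lra.
  assert (u0 : 0 < / n) by (apply Rinv_0_lt_compat; trivial).
  unfold Rdiv in *.
  set (u := / n) in *. set (t := P - s) in *. set (t' := P - s').
  assert (Ett : t - t' = s' - s) by (unfold t, t'; ring).
  set (D := s' - s) in *.
  assert (s0 : 0 < s) by lra. assert (t0 : 0 < t) by lra.
  assert (t'0 : 0 < t') by lra. assert (s'0 : 0 < s') by (unfold D in *; lra).
  assert (A1 : u * / sqrt s <= 3 * (sqrt s' - sqrt s)).
  { assert (q : 0 < sqrt s) by (apply sqrt_lt_R0; trivial).
    assert (qq : sqrt s * sqrt s = s) by (apply sqrt_sqrt; lra).
    assert (qq' : sqrt s' * sqrt s' = s') by (apply sqrt_sqrt; lra).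
    assert (q' : 0 < sqrt s') by (apply sqrt_lt_R0; trivial).
    assert (B : sqrt s' <= 6 / 5 * sqrt s).
    { apply Rsqr_incr_0; [|lra|lra]. unfold Rsqr.
      replace (6 / 5 * sqrt s * (6 / 5 * sqrt s)) with (36 / 25 * (sqrt s * sqrt s)) by field.
      rewrite qq, qq'. unfold D in *. lra. }
    apply Rmult_le_reg_r with (sqrt s); trivial. rewrite Rmult_assoc, Rinv_l by lra.
    assert (E : (sqrt s' - sqrt s) * (sqrt s' + sqrt s) = D) by (unfold D; nra).
    assert (P1 : 0 <= sqrt s' - sqrt s).
    { assert (sqrt s <= sqrt s') by (apply sqrt_le_1_alt; unfold D in *; lra). lra. }
    clear - E P1 B q HD u0. nra. }
  assert (A2 : u * / sqrt t <= 3 * (sqrt t - sqrt t')).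
  { assert (q : 0 < sqrt t) by (apply sqrt_lt_R0; trivial).
    assert (qq : sqrt t * sqrt t = t) by (apply sqrt_sqrt; lra).
    assert (qq' : sqrt t' * sqrt t' = t') by (apply sqrt_sqrt; lra).
    assert (q' : 0 < sqrt t') by (apply sqrt_lt_R0; trivial).
    assert (B : sqrt t' <= sqrt t) by (apply sqrt_le_1_alt; lra).
    apply Rmult_le_reg_r with (sqrt t); trivial. rewrite Rmult_assoc, Rinv_l by lra.
    assert (E : (sqrt t - sqrt t') * (sqrt t + sqrt t') = D) by (rewrite <- Ett; clear - qq qq'; nra).
    clear - E B q HD u0. nra. }
  assert (A3 : u * (/ s) ^ 2 <= 2 * (/ s - / s')).
  { replace (/ s - / s') with (D * (/ s * / s')) by (unfold D; field; lra).
    assert (i : 0 < / s) by (apply Rinv_0_lt_compat; trivial).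
    assert (B : / s <= 13 / 10 * / s').
    { replace (/ s) with (13 / 10 * / (13 / 10 * s)) by (field; lra).
      apply Rmult_le_compat_l; [lra|]. apply Rinv_le_contravar; unfold D in *; lra. }
    assert (C1 : / s * / s <= 13 / 10 * (/ s * / s')) by (clear - i B; nra).
    assert (0 < / s * / s) by (apply Rmult_lt_0_compat; trivial).
    clear - C1 HD H u0. simpl. rewrite Rmult_1_r. nra. }
  assert (A4 : u * (/ t) ^ 2 <= 2 * (/ t' - / t)).
  { replace (/ t' - / t) with (D * (/ t * / t')) by (rewrite <- Ett; field; lra).
    assert (i : 0 < / t) by (apply Rinv_0_lt_compat; trivial).
    assert (B : / t <= / t') by (apply Rinv_le_contravar; lra).
    assert (C1 : / t * / t <= / t * / t') by (clear - i B; nra).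
    assert (0 < / t * / t) by (apply Rmult_lt_0_compat; trivial).
    clear - C1 HD H u0. simpl. rewrite Rmult_1_r. nra. }
  set (v := / m). assert (v0 : 0 < v) by (apply Rinv_0_lt_compat; lra).
  assert (uv : u <= v) by (apply Rinv_le_contravar; lra).
  rewrite <- !pow_inv. fold u.
  assert (I1 : 0 < / sqrt s) by (apply Rinv_0_lt_compat, sqrt_lt_R0; trivial).
  assert (I2 : 0 < / sqrt t) by (apply Rinv_0_lt_compat, sqrt_lt_R0; trivial).
  assert (R1 : K * u ^ 2 * (1 + / sqrt s + / sqrt t) <= 4 * K * v * (D + (sqrt s' - sqrt s) + (sqrt t - sqrt t'))).
  { replace (K * u ^ 2 * (1 + / sqrt s + / sqrt t)) with (K * (u * (u + u * / sqrt s + u * / sqrt t))) by ring.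
    replace (4 * K * v * (D + (sqrt s' - sqrt s) + (sqrt t - sqrt t'))) with
      (K * (v * (4 * (D + (sqrt s' - sqrt s) + (sqrt t - sqrt t'))))) by ring.
    assert (0 < u * / sqrt s) by (apply Rmult_lt_0_compat; trivial).
    assert (0 < u * / sqrt t) by (apply Rmult_lt_0_compat; trivial).
    apply Rmult_le_compat_l; [lra|]. apply Rmult_le_compat; lra. }
  assert (R2 : K * u ^ 3 * ((/ s) ^ 2 + (/ t) ^ 2) <= 4 * K * v ^ 2 * ((/ s - / s') + (/ t' - / t))).
  { replace (K * u ^ 3 * ((/ s) ^ 2 + (/ t) ^ 2)) with (K * (u ^ 2 * (u * (/ s) ^ 2 + u * (/ t) ^ 2))) by ring.
    replace (4 * K * v ^ 2 * ((/ s - / s') + (/ t' - / t))) with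
      (K * (v ^ 2 * (4 * ((/ s - / s') + (/ t' - / t))))) by ring.
    assert (0 <= u * (/ s) ^ 2) by (apply Rmult_le_pos; [lra|apply pow2_ge_0]).
    assert (0 <= u * (/ t) ^ 2) by (apply Rmult_le_pos; [lra|apply pow2_ge_0]).
    apply Rmult_le_compat_l; [lra|]. apply Rmult_le_compat; try lra.
    - apply pow2_ge_0.
    - apply pow_incr; lra. }
  unfold gate_potential, Rdiv. fold t t'. rewrite <- !pow_inv. fold v.
  unfold D in R1. lra.
Qed.

Lemma least_after (Pr : nat -> Prop) (m : nat) :
  (exists j, (m <= j)%nat /\ Pr j) ->
  exists e, (m <= e)%nat /\ Pr e /\ forall j, (m <= j < e)%nat -> ~ Pr j.
Proof.
  intros [j [Hj Hp]].
  destruct (dec_inh_nat_subset_has_unique_least_element (fun j => (m <= j)%nat /\ Pr j))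
    as [e [[[He Hpe] Hl] _]].
  - intros n; apply classic.
  - exists j; split; trivial.
  - exists e. split; [trivial|split; trivial]. intros i Hi Hpi.
    specialize (Hl i (conj (proj1 Hi) Hpi)). lia.
Qed.

Lemma ln_unbounded_INR (B : R) (m : nat) : exists j, (m <= j)%nat /\ B < ln (INR j).
Proof.
  destruct (nfloor_ex (exp B)) as [N HN]; [left; apply exp_pos|].
  exists (S (N + m)). split; [lia|].
  rewrite <- (ln_exp B) at 1. apply ln_increasing; [apply exp_pos|].
  rewrite S_INR, plus_INR. assert (H := pos_INR m). lra.
Qed.

(** A bootstrap: the summed errors keep [|Im X|] below [eta], and this is what the estimate of the
    next step requires. Hence the step hypothesis is asked only for times whose whole past lies in
    the gate. *)
Lemma gate (a Gam : C) (P K1 eta : R) : 0 < P -> 0 <= K1 -> 0 < eta <= 1 ->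
  exists K rho0, 0 < K /\ 4 <= rho0 /\ forall rho, rho0 <= rho -> exists Q, 1 <= Q /\
  forall (d : C) (z : nat -> C) (m : nat) (X : nat -> C),
  Cmod d <= rho -> clock a d z m -> (forall j, (m <= j)%nat -> big Q (INR j)) ->
  rho / 2 / INR m <= Re (X m) -> Cmod (X m) <= 5 * rho / INR m ->
  (forall j, (m <= j)%nat ->
     (forall i, (m <= i <= j)%nat -> rho / 2 / INR i <= Re (X i) /\
        rho / 2 / INR i <= P - Re (X i) /\ Rabs (Im (X i)) <= eta) ->
     Cmod (X (S j) - X j - z j - Gam * z j ^ 2 * (/ X j + / (X j - RtoC P)))
      <= K1 * (Cmod (z j) ^ 2 + Cmod (z j) ^ 3 * ((/ Re (X j)) ^ 2 + (/ (P - Re (X j))) ^ 2))) ->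
  exists e, (m < e)%nat /\
    (forall j, (m <= j <= e)%nat ->
       rho / 2 / INR j <= Re (X j) /\ rho / 2 / INR j <= P - Re (X j) /\ Rabs (Im (X j)) <= eta) /\
    (rho - 2) / INR e <= P - Re (X e) <= rho / INR e /\
    ln (INR e) - ln (INR m) <= 5 / 4 * P /\
    Cmod (X e - X m - Gam * (z e * gate_log P (X e) - z m * gate_log P (X m))
          - (drift a d (INR e) - drift a d (INR m))) <= K / INR m.
Proof.
  intros HP HK1 Heta.
  destruct (clock_step a) as [Kz [HKz Hclock]].
  destruct (@gate_step P K1 Kz Gam HP HK1 ltac:(lra)) as [K2 [rho2 [HK2 [Hrho2 Hgs]]]].
  set (Kt := K2 + Kz).
  (* The variation of [gate_potential] across the gate, times [m]. The term [/ (P - s)] may reach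
     [n] at the end, and [n] is at most [exp (5 / 4 * P)] times [m], since the logarithm of time
     advances at most [5 / 4] as fast as the position. *)
  set (K := 4 * Kt * (P + 2 * sqrt P + exp (5 / 4 * P) + 1)).
  set (g := Cmod Gam). assert (g0 : 0 <= g) by apply Cmod_ge_0.
  set (k := Cmod (1 - a)). assert (k0 : 0 <= k) by apply Cmod_ge_0.
  assert (HsP := sqrt_pos P). assert (HeP := exp_pos (5 / 4 * P)).
  assert (HK : 0 < K).
  { unfold K. apply Rmult_lt_0_compat; unfold Kt; lra. }
  exists K, (2 * rho2 + 20). split; trivial. split; [lra|].
  intros rho Hrho.
  destruct (Hclock rho ltac:(lra)) as [Qc [HQc Hcs]].
  (* Inside the gate [gate_log] is at most of order [sqrt n] and [z] is of order [1 / n];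
     [sqrt n >= q] makes their product, times [Gam], at most [eta / 10]. *)
  set (q := 100 * (g + 1) * (K2 + P + 10) / eta).
  assert (ie : 1 <= / eta) by (rewrite <- Rinv_1; apply Rinv_le_contravar; lra).
  set (Q := Qc + rho2 + 100 * (k + rho + 1) * / eta + 100 * K * / eta + q ^ 2 + 10 * rho / P).
  assert (Q1 : 0 <= (k + rho + 1) * / eta) by (apply Rmult_le_pos; lra).
  assert (Q2 : 0 <= K * / eta) by (apply Rmult_le_pos; lra).
  assert (Q3 : 0 <= q ^ 2) by apply pow2_ge_0.
  assert (Q4 : 0 <= 10 * rho / P) by (unfold Rdiv; apply Rmult_le_pos; [lra|left; apply Rinv_0_lt_compat; trivial]).
  assert (q0 : 0 <= q) by (unfold q, Rdiv; repeat apply Rmult_le_pos; lra).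
  exists Q. split; [unfold Q; lra|].
  intros d z m X Hd Hcl HQ HXm HXm' Hstep.
  assert (HQc' : forall j, (m <= j)%nat -> big Qc (INR j)).
  { intros j Hj. apply big_mono with (2 := HQ j Hj). unfold Q; lra. }
  set (F := fun j => (X j - Gam * (z j * gate_log P (X j)) - drift a d (INR j))%C).
  set (M := INR m) in *.
  assert (HM : Q <= M) by (apply big_ge; [unfold Q; lra|apply HQ; lia]).
  assert (Hn : forall j, (m <= j)%nat -> M <= INR j) by (intros; apply le_INR; trivial).
  assert (HMq : q ^ 2 <= M) by (unfold Q in HM; lra).
  assert (sqn : forall j, (m <= j)%nat -> q <= sqrt (INR j)).
  { intros j Hj. rewrite <- (sqrt_pow2 q) by trivial. apply sqrt_le_1_alt. specialize (Hn j Hj). lra. }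
  assert (M1 : 1 <= M) by (unfold Q in HM; lra).
  (* The fourth clause bounds the elapsed time by the position, which makes the process end; the
     fifth is the accumulated error, already in telescoped form. *)
  set (Inv := fun j => rho / 2 / INR j <= Re (X j) /\ rho / 2 / INR j <= P - Re (X j) /\
     Rabs (Im (X j)) <= eta /\ ln (INR j) - ln M <= 5 / 4 * (Re (X j) - Re (X m)) /\
     Cmod (F j - F m) <= gate_potential P Kt M (Re (X j)) - gate_potential P Kt M (Re (X m))).
  assert (M5 : 5 * rho / M <= P / 2).
  { apply Rmult_le_reg_r with (M * 2 / P); [apply Rdiv_lt_0_compat; lra|].
    replace (5 * rho / M * (M * 2 / P)) with (10 * rho / P) by (field; lra).
    replace (P / 2 * (M * 2 / P)) with M by (field; lra). unfold Q in HM; lra. }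
  assert (HXR := re_le_Cmod (X m)). assert (HXI := Im_le_Cmod (X m)).
  apply Rabs_le_between in HXR.
  assert (pot : forall j, (m <= j)%nat -> rho / 2 / INR j <= Re (X j) -> rho / 2 / INR j <= P - Re (X j) ->
     ln (INR j) - ln M <= 5 / 4 * (Re (X j) - Re (X m)) ->
     gate_potential P Kt M (Re (X j)) - gate_potential P Kt M (Re (X m)) <= K / M).
  { intros j Hj A B L. specialize (Hn j Hj).
    set (n := INR j) in *. set (s := Re (X j)) in *. set (s0 := Re (X m)) in *.
    assert (rn : 1 / n <= rho / 2 / n).
    { unfold Rdiv. apply Rmult_le_compat_r; [left; apply Rinv_0_lt_compat; lra|lra]. }
    assert (rM : 1 / M <= rho / 2 / M).
    { unfold Rdiv. apply Rmult_le_compat_r; [left; apply Rinv_0_lt_compat; lra|lra]. }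
    assert (n1 : 0 < 1 / n) by (apply Rdiv_lt_0_compat; lra).
    assert (B1 : / (P - s) <= n).
    { rewrite <- (Rinv_inv n). apply Rinv_le_contravar; [apply Rinv_0_lt_compat; lra|]. unfold Rdiv in *; lra. }
    assert (B2 : / s0 <= M).
    { rewrite <- (Rinv_inv M). apply Rinv_le_contravar; [apply Rinv_0_lt_compat; lra|]. unfold Rdiv in *; lra. }
    assert (B3 : 0 < / s) by (apply Rinv_0_lt_compat; lra).
    assert (B4 : 0 < / (P - s0)) by (apply Rinv_0_lt_compat; lra).
    assert (B5 : n <= M * exp (5 / 4 * P)).
    { rewrite <- (exp_ln n), <- (exp_ln M), <- exp_plus by lra.
      destruct (Rle_lt_or_eq_dec (ln n) (ln M + 5 / 4 * P)) as [H|H]; [lra| |right; f_equal; exact H].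
      left; apply exp_increasing; exact H. }
    assert (C1 : sqrt s <= sqrt P) by (apply sqrt_le_1_alt; lra).
    assert (C2 : sqrt (P - s0) <= sqrt P) by (apply sqrt_le_1_alt; lra).
    assert (C3 := sqrt_pos s0). assert (C4 := sqrt_pos (P - s)).
    assert (Kt0 : 0 < 4 * Kt) by (unfold Kt; lra).
    assert (v0 : 0 < / M) by (apply Rinv_0_lt_compat; lra).
    apply Rle_trans with (4 * Kt / M * (P + 2 * sqrt P) + 4 * Kt / M ^ 2 * (M * exp (5 / 4 * P) + M)).
    - unfold gate_potential.
      replace (4 * Kt / M * (s + sqrt s - sqrt (P - s)) + 4 * Kt / M ^ 2 * (/ (P - s) - / s) -
        (4 * Kt / M * (s0 + sqrt s0 - sqrt (P - s0)) + 4 * Kt / M ^ 2 * (/ (P - s0) - / s0))) with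
        (4 * Kt / M * ((s + sqrt s - sqrt (P - s)) - (s0 + sqrt s0 - sqrt (P - s0))) +
         4 * Kt / M ^ 2 * ((/ (P - s) - / s) - (/ (P - s0) - / s0))) by ring.
      apply Rplus_le_compat; apply Rmult_le_compat_l; try lra.
      + unfold Rdiv; apply Rmult_le_pos; lra.
      + unfold Rdiv; apply Rmult_le_pos; [lra|]. rewrite <- pow_inv. apply pow_le; lra.
    - right. unfold K. field. lra. }
  (* The leading term [ln x] of [drift] is real, so the imaginary part only sees [ln x / x] and
     [1 / x]. *)
  assert (imb : forall x, big Q x -> Rabs (Im (drift a d x)) <= eta / 10).
  { intros x Hx. assert (Hx1 : 1 <= x) by apply Hx.
    assert (L := ln_nonneg x Hx1).
    assert (HL := @big_lin Q x ltac:(unfold Q; lra) Hx).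
    assert (i : 0 < / x) by (apply Rinv_0_lt_compat; lra).
    replace (Im (drift a d x)) with (Im ((1 - a) * RtoC (ln x / x) + d * RtoC (/ x))%C).
    2:{ unfold drift. destruct a, d; simpl; ring. }
    eapply Rle_trans; [apply Im_le_Cmod|].
    eapply Rle_trans.
    { eapply Cadd_le; (eapply Cmul_le; [first [exact Hd|apply Rle_refl]|]).
      - rewrite Cmod_RtoC_pos; [apply Rle_refl|]. unfold Rdiv; apply Rmult_le_pos; lra.
      - rewrite Cmod_RtoC_pos; [apply Rle_refl|lra]. }
    fold k.
    apply Rmult_le_reg_r with x; [lra|].
    replace ((k * (ln x / x) + rho * / x) * x) with (k * ln x + rho) by (field; lra).
    assert (T1 : k * ln x + rho <= (k + rho + 1) * (1 + ln x)).
    { assert (0 <= rho * ln x) by (apply Rmult_le_pos; lra). lra. }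
    apply Rle_trans with (1 := T1).
    apply Rmult_le_reg_l with (/ eta); [lra|].
    replace (/ eta * (eta / 10 * x)) with (x / 10) by (field; lra).
    assert (T2 : 100 * (k + rho + 1) * / eta * (1 + ln x) <= Q * (1 + ln x)).
    { apply Rmult_le_compat_r; [lra|]. unfold Q; lra. }
    replace (/ eta * ((k + rho + 1) * (1 + ln x))) with ((100 * (k + rho + 1) * / eta * (1 + ln x)) / 100) by (field; lra).
    lra. }
  assert (M6 : 5 * rho / M <= eta / 10).
  { apply Rmult_le_reg_r with (M * / eta); [apply Rmult_lt_0_compat; lra|].
    replace (5 * rho / M * (M * / eta)) with (5 * (rho * / eta)) by (field; lra).
    replace (eta / 10 * (M * / eta)) with (M / 10) by (field; lra).
    assert (0 <= k * / eta) by (apply Rmult_le_pos; lra).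
    unfold Q in HM. lra. }
  assert (v0 : 0 < / M) by (apply Rinv_0_lt_compat; lra).
  assert (rM : / M <= rho / 2 / M).
  { unfold Rdiv. rewrite <- (Rmult_1_l (/ M)) at 1. apply Rmult_le_compat_r; lra. }
  assert (glm : Cmod (Gam * (z m * gate_log P (X m))) <= eta / 10).
  { destruct (Hcs d z m m Hd Hcl ltac:(lia) (HQc' m (le_n m))) as [Hz _].
    fold M in Hz.
    assert (sM : 1 <= sqrt M) by (rewrite <- sqrt_1; apply sqrt_le_1_alt; trivial).
    assert (Es : 2 / sqrt (/ M) = 2 * sqrt M).
    { rewrite sqrt_inv. unfold Rdiv. rewrite Rinv_inv. trivial. }
    assert (L1 := @Cmod_clog_le (X m) (/ M) v0 ltac:(lra)).
    assert (L2 := @Cmod_clog_le (P - X m) (/ M) v0).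
    replace (Re (P - X m)%C) with (P - Re (X m)) in L2 by (destruct (X m); simpl; ring).
    specialize (L2 ltac:(unfold Rdiv in *; lra)).
    assert (L3 := Cmod_minus_le P (X m)). rewrite Cmod_RtoC_pos in L3 by lra.
    assert (G1 : Cmod (gate_log P (X m)) <= (2 * P + 8) * sqrt M).
    { unfold gate_log. eapply Rle_trans; [eapply Cadd_le; [exact L1|exact L2]|]. rewrite Es.
      clear - sM L3 M5 HXm' HP. nra. }
    eapply Rle_trans; [eapply Cmul_le; [apply Rle_refl|eapply Cmul_le; [exact Hz|exact G1]]|].
    fold g.
    assert (EM : M = sqrt M * sqrt M) by (symmetry; apply sqrt_sqrt; lra).
    assert (Hq := sqn m (le_n m)). fold M in Hq.
    replace (g * (11 / 10 / M * ((2 * P + 8) * sqrt M))) with (11 / 10 * g * (2 * P + 8) / sqrt M).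
    2:{ rewrite EM at 2. field. lra. }
    apply Rmult_le_reg_r with (sqrt M); [lra|]. unfold Rdiv at 1. rewrite Rmult_assoc, Rinv_l, Rmult_1_r by lra.
    apply Rle_trans with (eta / 10 * q); [|apply Rmult_le_compat_l; lra].
    unfold q. replace (eta / 10 * (100 * (g + 1) * (K2 + P + 10) / eta)) with (10 * (g + 1) * (K2 + P + 10)) by (field; lra).
    clear - g0 HK2 HP. nra. }
  assert (Inv0 : Inv m).
  { unfold Inv. fold M. repeat split; try lra.
    replace (F m - F m)%C with (RtoC 0) by ring. rewrite Cmod_0. lra. }
  assert (InvS : forall j, (m <= j)%nat -> (forall i, (m <= i <= j)%nat -> Inv i) ->
     Re (X j) < P - rho / INR j -> Inv (S j)).
  { intros j Hj HI Hlt. destruct (HI j ltac:(lia)) as (I1 & I2 & I3 & I4 & I5).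
    assert (Hnj := Hn j Hj). set (n := INR j) in *.
    assert (n0 : 0 < n) by lra. assert (u0 : 0 < / n) by (apply Rinv_0_lt_compat; trivial).
    destruct (Hcs d z m j Hd Hcl Hj (HQc' j Hj))
      as (Z1 & Z2 & Z3 & Z4 & Z5). fold n in Z1, Z2, Z3, Z4, Z5.
    destruct (Hgs n (rho / 2) (X j) (X (S j)) (z j) (z (S j))) as (G1 & G2 & G3); trivial; try lra.
    { unfold Q in HM; lra. }
    { apply Hstep; [trivial|]. intros i Hi. destruct (HI i ltac:(lia)) as (A1 & A2 & A3 & _); repeat split; trivial. }
    assert (En : INR (S j) = n + 1) by apply S_INR.
    set (s := Re (X j)) in *. set (s' := Re (X (S j))) in *.
    assert (u1 : / (n + 1) <= / n) by (apply Rinv_le_contravar; lra).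
    assert (J1 : rho / 2 / INR (S j) <= s').
    { rewrite En. unfold Rdiv in *. assert (rho * / 2 * / (n + 1) <= rho * / 2 * / n) by (apply Rmult_le_compat_l; lra). lra. }
    assert (J2 : rho / 2 / INR (S j) <= P - s').
    { rewrite En. unfold Rdiv in *. assert (rho * / 2 * / (n + 1) <= rho * / 2 * / n) by (apply Rmult_le_compat_l; lra).
      assert (20 * / n <= rho * / n) by (apply Rmult_le_compat_r; lra). lra. }
    assert (J4 : ln (INR (S j)) - ln M <= 5 / 4 * (s' - Re (X m))).
    { rewrite En. assert (ln (n + 1) - ln n <= / n).
      { replace (n + 1) with (n * (1 + / n)) by (field; lra). rewrite ln_mult by lra.
        assert (E := exp_ineq1_le (/ n)).
        assert (ln (1 + / n) <= / n); [|lra].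
        rewrite <- (ln_exp (/ n)) at 2. apply ln_le; lra. }
      unfold Rdiv in *. lra. }
    assert (J5 : Cmod (F (S j) - F m) <= gate_potential P Kt M s' - gate_potential P Kt M (Re (X m))).
    { eapply Rle_trans; [apply (Cmod_dist_trans _ (F j))|].
      assert (Cmod (F (S j) - F j) <= gate_potential P Kt M s' - gate_potential P Kt M s); [|lra].
      assert (r4 : 4 / n <= rho / 2 / n) by (unfold Rdiv; apply Rmult_le_compat_r; lra).
      eapply Rle_trans; [|apply (@gate_potential_step P Kt M n s s'); trivial; unfold Kt; lra].
      unfold F. fold n. rewrite En.
      replace (X (S j) - Gam * (z (S j) * gate_log P (X (S j))) - drift a d (n + 1) -
        (X j - Gam * (z j * gate_log P (X j)) - drift a d n))%C with
        ((X (S j) - Gam * z (S j) * gate_log P (X (S j)) - (X j - Gam * z j * gate_log P (X j)) - z j)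
         - (drift a d (n + 1) - drift a d n - z j))%C by ring.
      eapply Rle_trans; [eapply Csub_le; [exact G3|exact Z4]|].
      assert (V2 : 0 < / n ^ 2) by (apply Rinv_0_lt_compat, pow_lt; trivial).
      assert (V3 : 0 < / n ^ 3) by (apply Rinv_0_lt_compat, pow_lt; trivial).
      assert (s1 : 0 < / sqrt s) by (apply Rinv_0_lt_compat, sqrt_lt_R0; unfold Rdiv in *; lra).
      assert (s2 : 0 < / sqrt (P - s)) by (apply Rinv_0_lt_compat, sqrt_lt_R0; unfold Rdiv in *; lra).
      set (W := 1 + / sqrt s + / sqrt (P - s)). assert (W1 : 1 <= W) by (unfold W; lra).
      set (Y := (/ s) ^ 2 + (/ (P - s)) ^ 2).
      assert (Y0 : 0 <= Y) by (apply Rplus_le_le_0_compat; apply pow2_ge_0).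
      unfold Kt, Rdiv.
      assert (Kz * / n ^ 2 <= Kz * / n ^ 2 * W).
      { rewrite <- (Rmult_1_r (Kz * / n ^ 2)) at 1. apply Rmult_le_compat_l; trivial.
        apply Rmult_le_pos; lra. }
      assert (0 <= Kz * / n ^ 3 * Y) by (apply Rmult_le_pos; trivial; apply Rmult_le_pos; lra).
      lra. }
    assert (Hbig := HQ (S j) ltac:(lia)).
    unfold Inv. fold s'. split; [trivial|split; [trivial|split; [|split; trivial]]].
    assert (pj := pot (S j) ltac:(lia) J1 J2 J4). fold s' in pj.
    assert (KM : K / M <= eta / 10).
    { apply Rmult_le_reg_r with (M * / eta); [apply Rmult_lt_0_compat; lra|].
      replace (K / M * (M * / eta)) with (K * / eta) by (field; lra).
      replace (eta / 10 * (M * / eta)) with (M / 10) by (field; lra). unfold Q in HM. lra. }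
    destruct (Hcs d z m (S j) Hd Hcl ltac:(lia) (HQc' (S j) ltac:(lia))) as [Zs _].
    rewrite En in Zs.
    assert (GG : Cmod (Gam * (z (S j) * gate_log P (X (S j)))) <= eta / 10).
    { assert (sN : 1 <= sqrt n) by (rewrite <- sqrt_1; apply sqrt_le_1_alt; lra).
      assert (rn : / n <= rho / 2 / n).
      { unfold Rdiv. rewrite <- (Rmult_1_l (/ n)) at 1. apply Rmult_le_compat_r; lra. }
      assert (inv_s : forall y, rho / 2 / n <= y -> / sqrt y <= sqrt n).
      { intros y Hy. rewrite <- (Rinv_inv (sqrt n)).
        apply Rinv_le_contravar; [apply Rinv_0_lt_compat; lra|].
        rewrite <- sqrt_inv. apply sqrt_le_1_alt; lra. }
      assert (G2' : Cmod (gate_log P (X (S j))) <= 3 * K2 * sqrt n).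
      { apply Rle_trans with (1 := G2). assert (A1 := inv_s s I1). assert (A2 := inv_s (P - s) I2).
        replace (3 * K2 * sqrt n) with (K2 * (3 * sqrt n)) by ring. apply Rmult_le_compat_l; lra. }
      assert (Zs' : Cmod (z (S j)) <= 11 / 10 / n).
      { apply Rle_trans with (1 := Zs). unfold Rdiv. apply Rmult_le_compat_l; lra. }
      eapply Rle_trans; [eapply Cmul_le; [apply Rle_refl|eapply Cmul_le; [exact Zs'|exact G2']]|].
      fold g.
      assert (EM : n = sqrt n * sqrt n) by (symmetry; apply sqrt_sqrt; lra).
      assert (Hq := sqn j Hj). fold n in Hq.
      replace (g * (11 / 10 / n * (3 * K2 * sqrt n))) with (11 / 10 * g * (3 * K2) / sqrt n).
      2:{ rewrite EM at 2. field. lra. }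
      apply Rmult_le_reg_r with (sqrt n); [lra|]. unfold Rdiv at 1. rewrite Rmult_assoc, Rinv_l, Rmult_1_r by lra.
      apply Rle_trans with (eta / 10 * q); [|apply Rmult_le_compat_l; lra].
      unfold q. replace (eta / 10 * (100 * (g + 1) * (K2 + P + 10) / eta)) with (10 * (g + 1) * (K2 + P + 10)) by (field; lra).
      clear - g0 HK2 HP. nra. }
    (* [X] is recovered from the nearly conserved quantity [F]; each of the six terms has imaginary
       part at most [eta / 10]. *)
    assert (EX : X (S j) = ((F (S j) - F m) + X m + Gam * (z (S j) * gate_log P (X (S j)))
       - Gam * (z m * gate_log P (X m)) + drift a d (INR (S j)) - drift a d M)%C).
    { unfold F. fold M. ring. }
    assert (EI : forall u1 u2 u3 u4 u5 u6 : C, Im (u1 + u2 + u3 - u4 + u5 - u6)%C =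
       Im u1 + Im u2 + Im u3 - Im u4 + Im u5 - Im u6).
    { intros. unfold Im, Cplus, Cminus, Copp; simpl; ring. }
    rewrite EX, EI.
    assert (T1 := Im_le_Cmod (F (S j) - F m)). assert (T3 := Im_le_Cmod (Gam * (z (S j) * gate_log P (X (S j))))).
    assert (T4 := Im_le_Cmod (Gam * (z m * gate_log P (X m)))).
    assert (T5 := imb _ Hbig). assert (T6 := imb _ (HQ m (le_n m))). fold M in T6.
    apply Rabs_le_between in T1. apply Rabs_le_between in T3. apply Rabs_le_between in T4.
    apply Rabs_le_between in T5. apply Rabs_le_between in T6. apply Rabs_le_between in HXI.
    apply Rabs_le; lra. }
  destruct (@least_after (fun j => P - rho / INR j <= Re (X j)) m) as (e & He & Hpe & Hmin).
  (* If the end were never reached, the invariant would hold forever and bound [ln j] by the length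
     of the gate. *)
  { apply NNPP. intros Hno.
    assert (All : forall l i, (m <= i <= m + l)%nat -> Inv i).
    { induction l as [|l IH]; intros i Hi; [replace i with m by lia; trivial|].
      destruct (Nat.eq_dec i (m + S l)) as [Ei|Ei]; [rewrite Ei|apply IH; lia].
      replace (m + S l)%nat with (S (m + l)) by lia. apply InvS; [lia|intros; apply IH; lia|].
      apply Rnot_le_lt. intros H. apply Hno. exists (m + l)%nat. split; [lia|trivial]. }
    destruct (ln_unbounded_INR (ln M + 5 / 4 * P) m) as [j [Hj Hlnj]].
    specialize (All (j - m)%nat j ltac:(lia)).
    destruct All as (A1 & A2 & A3 & A4 & A5).
    assert (0 < rho / 2 / INR j).
    { apply Rdiv_lt_0_compat; [lra|]. specialize (Hn j Hj). lra. }
    unfold Rdiv in *. lra. }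
  assert (All : forall j, (m <= j <= e)%nat -> Inv j).
  { assert (All : forall l i, (m + l <= e)%nat -> (m <= i <= m + l)%nat -> Inv i).
    { induction l as [|l IH]; intros i Hk Hi; [replace i with m by lia; trivial|].
      destruct (Nat.eq_dec i (m + S l)) as [Ei|Ei]; [rewrite Ei|apply IH; lia].
      replace (m + S l)%nat with (S (m + l)) by lia. apply InvS; [lia|intros; apply IH; lia|].
      apply Rnot_le_lt. apply Hmin. lia. }
    intros j Hj. apply (All (j - m)%nat); lia. }
  assert (Hme : (m < e)%nat).
  { destruct (Nat.eq_dec m e) as [E|E]; [|lia]. subst e. fold M in Hpe. exfalso.
    unfold Rdiv in *. assert (20 * / M <= rho * / M) by (apply Rmult_le_compat_r; lra). lra. }
  exists e. split; trivial. split; [|split; [|split]].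
  - intros j Hj. destruct (All j Hj) as (A1 & A2 & A3 & _). repeat split; trivial.
  - split; [|lra].
    (* One step earlier [Re X] was still below [P - rho / n], and a step is at most [6 / 5 / n]
       long; hence the lower bound with [rho - 2]. *)
    destruct e as [|e]; [lia|].
    assert (Hlt := Hmin e ltac:(lia)). apply Rnot_le_lt in Hlt.
    assert (Hje : (m <= e)%nat) by lia.
    destruct (All e ltac:(lia)) as (I1 & I2 & I3 & I4 & I5).
    assert (Hne := Hn e Hje). set (n := INR e) in *.
    destruct (Hcs d z m e Hd Hcl Hje (HQc' e Hje))
      as (Z1 & Z2 & Z3 & Z4 & Z5). fold n in Z1, Z2, Z3, Z4, Z5.
    destruct (Hgs n (rho / 2) (X e) (X (S e)) (z e) (z (S e))) as (G1 & G2 & G3); trivial; try lra.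
    { unfold Q in HM; lra. }
    { apply Hstep; [trivial|]. intros i Hi. destruct (All i ltac:(lia)) as (A1 & A2 & A3 & _); repeat split; trivial. }
    rewrite S_INR. fold n.
    assert (u0 : 0 < / n) by (apply Rinv_0_lt_compat; lra).
    apply Rle_trans with ((rho - 2) / n).
    + unfold Rdiv. apply Rmult_le_compat_l; [lra|]. apply Rinv_le_contravar; lra.
    + unfold Rdiv in *. lra.
  - destruct (All e ltac:(lia)) as (I1 & I2 & I3 & I4 & I5).
    assert (0 < rho / 2 / INR e).
    { apply Rdiv_lt_0_compat; [lra|]. specialize (Hn e He). lra. }
    assert (0 < rho / 2 / M) by lra. fold M. unfold Rdiv in *. lra.
  - destruct (All e ltac:(lia)) as (I1 & I2 & I3 & I4 & I5).
    assert (Hpot := pot e He I1 I2 I4).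
    fold M. eapply Rle_trans; [|exact Hpot]. eapply Rle_trans; [|exact I5].
    right. f_equal. unfold F. fold M. ring.
Qed.

(** With [y = - z / w], the quotient of [w - lam z] by [w - lamb z] is [(1 + lam y) / (1 + lamb y)].
    Its logarithm divided by [kap = lam - lamb] is [y + O(y ^ 2)]: at the entrance [X] is nearly [z]
    times the coordinate [- 1 / w]. *)
Lemma gate_start (c : R) : 0 < c ->
  let lam := ((- (1 / 2))%R, c) : C in let lamb := ((- (1 / 2))%R, (- c)%R) : C in
  let kap := (0, (2 * c)%R) : C in
  exists K dl, 0 < K /\ 0 < dl <= 1 /\ forall y : C, Cmod y <= dl -> exists X : C,
    (1 + lamb * y)%C <> 0 /\ (cexp (kap * X) * (1 + lamb * y) = 1 + lam * y)%C /\
    Cmod (X - y) <= K * Cmod y ^ 2.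
Proof.
  intros Hc lam lamb kap.
  assert (Mk : Cmod kap = 2 * c).
  { replace kap with (Ci * RtoC (2 * c))%C.
    - rewrite Cmod_mult, Cmod_Ci, Cmod_RtoC_pos by lra. ring.
    - unfold kap. apply injective_projections; simpl; ring. }
  assert (k0 : kap <> 0) by (apply Cmod_gt_0; lra).
  set (g := Cmod lamb). assert (g0 : 0 <= g) by apply Cmod_ge_0.
  exists (2 * g + 128 * c), (/ (2 + 2 * g + 16 * c)).
  assert (d0 : 0 < / (2 + 2 * g + 16 * c)) by (apply Rinv_0_lt_compat; lra).
  split; [lra|]. split.
  { split; trivial. rewrite <- Rinv_1. apply Rinv_le_contravar; lra. }
  intros y Hy.
  assert (Hy1 : (2 + 2 * g + 16 * c) * Cmod y <= 1).
  { apply Rmult_le_reg_l with (/ (2 + 2 * g + 16 * c)); trivial.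
    rewrite <- Rmult_assoc, Rinv_l by lra. lra. }
  assert (y0 : 0 <= Cmod y) by apply Cmod_ge_0.
  set (D := (1 + lamb * y)%C).
  assert (HD : 1 / 2 <= Cmod D).
  { eapply Rle_trans; [|apply Cmod_plus_ge]. rewrite Cmod_1, Cmod_mult. fold g. clear - Hy1 y0 g0 Hc. nra. }
  assert (D0 : D <> 0) by (apply Cmod_gt_0; lra).
  set (ep := (kap * y / D)%C).
  assert (Ek : kap = (lam - lamb)%C) by (unfold kap, lam, lamb; apply injective_projections; simpl; field).
  assert (Hep : Cmod ep <= 4 * c * Cmod y).
  { unfold ep. eapply Rle_trans.
    { apply Cdiv_le with (X := 2 * c * Cmod y) (Y := 1 / 2); trivial; [|lra].
      rewrite Cmod_mult, Mk. lra. }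
    right; field. }
  assert (Hep4 : Cmod ep <= 1 / 4) by (clear - Hep Hy1 y0 g0 Hc; nra).
  assert (Hep' : Cmod (ep - kap * y) <= 4 * c * g * Cmod y ^ 2).
  { replace (ep - kap * y)%C with ((- (kap * y * (lamb * y))) / D)%C.
    - eapply Rle_trans.
      { apply Cdiv_le with (X := 2 * c * Cmod y * (g * Cmod y)) (Y := 1 / 2); trivial; [|lra].
        rewrite Cmod_opp, !Cmod_mult, Mk. fold g. lra. }
      right; field.
    - unfold ep. replace (lamb * y)%C with (D - 1)%C by (unfold D; ring). field. trivial. }
  assert (RE := re_le_Cmod ep). apply Rabs_le_between in RE.
  exists (clog (1 + ep) / kap)%C. split; trivial. split.
  - replace (kap * (clog (1 + ep) / kap))%C with (clog (1 + ep)) by (field; trivial).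
    rewrite cexp_clog.
    + unfold ep. replace (1 + lam * y)%C with (D + kap * y)%C by (unfold D; rewrite Ek; ring).
      field. trivial.
    + replace (Re (1 + ep)%C) with (1 + Re ep) by (destruct ep; simpl; ring). lra.
  - assert (HL := clog_near_1 ep Hep4).
    replace (clog (1 + ep) / kap - y)%C with (((clog (1 + ep) - ep) + (ep - kap * y)) / kap)%C by (field; trivial).
    eapply Rle_trans.
    { apply Cdiv_le with (X := 16 * Cmod ep ^ 2 + 4 * c * g * Cmod y ^ 2) (Y := 2 * c); [|lra|lra].
      eapply Cadd_le; eassumption. }
    assert (Cmod ep ^ 2 <= (4 * c * Cmod y) ^ 2) by (apply pow_incr; split; trivial; apply Cmod_ge_0).
    apply Rmult_le_reg_r with (2 * c); [lra|]. unfold Rdiv. rewrite Rmult_assoc, Rinv_l, Rmult_1_r by lra.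
    replace ((2 * g + 128 * c) * Cmod y ^ 2 * (2 * c)) with (16 * (4 * c * Cmod y) ^ 2 + 4 * c * g * Cmod y ^ 2) by ring.
    lra.
Qed.

(** The relation forces [w - lamb z = kap z / (1 - cexp (kap U))], and for small [U] the pole of
    this kernel gives [w = - (z / U) (1 + O(U))]. It is meant for [U = X - P], which satisfies the
    same relation as [X] by periodicity. *)
Lemma gate_end (c : R) : 0 < c ->
  let lam := ((- (1 / 2))%R, c) : C in let lamb := ((- (1 / 2))%R, (- c)%R) : C in
  let kap := (0, (2 * c)%R) : C in
  exists K dl, 0 < K /\ 0 < dl /\ forall U z w : C, U <> 0 -> Cmod U <= dl -> z <> 0 ->
    (w - lam * z = cexp (kap * U) * (w - lamb * z))%C ->
    w <> 0 /\ Cmod (- / w - U / z) <= K * Cmod U ^ 2 / Cmod z.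
Proof.
  intros Hc lam lamb kap.
  assert (Mk : Cmod kap = 2 * c).
  { replace kap with (Ci * RtoC (2 * c))%C.
    - rewrite Cmod_mult, Cmod_Ci, Cmod_RtoC_pos by lra. ring.
    - unfold kap. apply injective_projections; simpl; ring. }
  assert (k0 : kap <> 0) by (apply Cmod_gt_0; lra).
  assert (Ek : kap = (lam - lamb)%C) by (unfold kap, lam, lamb; apply injective_projections; simpl; field).
  set (g := Cmod lamb). assert (g0 : 0 <= g) by apply Cmod_ge_0.
  set (C0 := 64 * c + g).
  exists (2 * C0), (/ (2 * C0)).
  assert (C00 : 0 < C0) by (unfold C0; lra).
  split; [lra|]. split; [apply Rinv_0_lt_compat; lra|].
  intros U z w HU HUd Hz E.
  assert (U0 : 0 < Cmod U) by (apply Cmod_gt_0; trivial).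
  assert (z0 : 0 < Cmod z) by (apply Cmod_gt_0; trivial).
  assert (HU1 : 2 * C0 * Cmod U <= 1).
  { apply Rmult_le_reg_l with (/ (2 * C0)); [apply Rinv_0_lt_compat; lra|].
    rewrite <- Rmult_assoc, Rinv_l by lra. lra. }
  destruct (@cexp_kernel_near (kap * U)) as [N B].
  { apply Cmult_neq_0; trivial. }
  { rewrite Cmod_mult, Mk. unfold C0 in HU1. clear - HU1 g0 U0 Hc. nra. }
  set (x := cexp (kap * U)) in *.
  set (e := (kap * (/ (1 - x) + / (kap * U)) + lamb)%C).
  assert (He : Cmod e <= C0).
  { unfold e. eapply Rle_trans; [eapply Cadd_le; [eapply Cmul_le; [right; exact Mk|exact B]|apply Rle_refl]|].
    unfold C0; fold g; lra. }
  assert (Ew : w = (- (z / U) * (1 - e * U))%C).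
  { assert (Eb : ((1 - x) * (w - lamb * z) = kap * z)%C).
    { rewrite Ek. replace ((lam - lamb) * z)%C with ((w - lamb * z) - (w - lam * z))%C by ring.
      rewrite E. ring. }
    assert (Eb2 : (w - lamb * z = kap * z / (1 - x))%C).
    { rewrite <- Eb. field. trivial. }
    replace w with (kap * z / (1 - x) + lamb * z)%C by (rewrite <- Eb2; ring).
    unfold e. field. repeat split; trivial. }
  assert (HeU : Cmod (e * U) <= 1 / 2).
  { rewrite Cmod_mult. clear - He HU1 U0. nra. }
  assert (HD : 1 / 2 <= Cmod (1 - e * U)).
  { eapply Rle_trans; [|apply Cmod_minus_ge]. rewrite Cmod_1. lra. }
  assert (D0 : (1 - e * U)%C <> 0) by (apply Cmod_gt_0; lra).
  split.
  - rewrite Ew. apply Cmult_neq_0; trivial. apply Cmod_gt_0. rewrite Cmod_opp, Cmod_div by trivial.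
    apply Rdiv_lt_0_compat; trivial.
  - replace (- / w - U / z)%C with (e * U * U / ((1 - e * U) * z))%C.
    2:{ rewrite Ew. field. repeat split; trivial. }
    eapply Rle_trans.
    { apply Cdiv_le with (X := C0 * Cmod U * Cmod U) (Y := 1 / 2 * Cmod z).
      - rewrite !Cmod_mult. apply Rmult_le_compat_r; [lra|]. apply Rmult_le_compat_r; lra.
      - lra.
      - rewrite Cmod_mult. apply Rmult_le_compat_r; lra. }
    right. field. lra.
Qed.

(** The logarithm of [step_ratio]: [X] advances by [z - (1 - b03) z B] up to small errors, and [B]
    is the function [kap z / (1 - cexp (kap X))] of [X], whose poles [cexp_kernel] makes explicit.
    The new [X'] adds the logarithm of a ratio close to 1, so the lift of [A / B] never jumps by a
    period. *)
Lemma gate_orbit_step (p : C -> C) (q : C -> C -> C) (a b03 b30 : C) (b c M r : R) :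
  0 < r -> 0 < c -> b = 1 / 4 + c ^ 2 -> base_bound p a M r -> fiber_bound q b b03 b30 M r ->
  let lam := ((- (1 / 2))%R, c) : C in let lamb := ((- (1 / 2))%R, (- c)%R) : C in
  let kap := (0, (2 * c)%R) : C in let P := PI / c in
  exists K1 K eta rho0, 0 < K1 /\ 0 < K /\ 0 < eta <= 1 /\ 4 <= rho0 /\
  forall (n rho : R) (X z w : C), rho0 <= rho -> rho <= n -> z <> 0 -> Cmod z <= 11 / 10 / n ->
    rho / 2 / n <= Re X -> rho / 2 / n <= P - Re X -> Rabs (Im X) <= eta ->
    (cexp (kap * X) * (w - lamb * z) = w - lam * z)%C ->
    let A := (w - lam * z)%C in let B := (w - lamb * z)%C in
    let A' := (q z w - lam * p z)%C in let B' := (q z w - lamb * p z)%C in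
    let X' := (X + clog (A' / B' / (A / B)) / kap)%C in
    (cexp (kap * X') * B' = A')%C /\ Cmod w <= K / rho /\
    Cmod (X' - X - z - (1 - b03) * z ^ 2 * (/ X + / (X - RtoC P)))
      <= K1 * (Cmod z ^ 2 + Cmod z ^ 3 * ((/ Re X) ^ 2 + (/ (P - Re X)) ^ 2)).
Proof.
  intros Hr Hc Hb Hp Hq lam lamb kap P.
  assert (Mk : Cmod kap = 2 * c).
  { replace kap with (Ci * RtoC (2 * c))%C.
    - rewrite Cmod_mult, Cmod_Ci, Cmod_RtoC_pos by lra. ring.
    - unfold kap. apply injective_projections; simpl; ring. }
  assert (k0 : kap <> 0) by (apply Cmod_gt_0; lra).
  assert (Ek : kap = (lam - lamb)%C) by (unfold kap, lam, lamb; apply injective_projections; simpl; field).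
  destruct (@cexp_kernel c Hc) as (Kk & eta & HKk & Heta & Hker).
  set (E := exp (2 * c)). assert (E1 : 1 <= E) by (unfold E; assert (H := exp_ineq1_le (2 * c)); lra).
  set (L := (1 + E) / (2 * c)).
  assert (HL : 0 < L) by (apply Rdiv_lt_0_compat; lra).
  destruct (@step_ratio p q a b03 b30 b c M r L Hr Hb ltac:(lra) Hp Hq) as (Ks & r0 & HKs & Hr0 & Hstep).
  set (g := Cmod (1 - b03)). assert (g0 : 0 <= g) by apply Cmod_ge_0.
  set (gb := Cmod lamb). assert (gb0 : 0 <= gb) by apply Cmod_ge_0.
  set (Ce := 2 * c * (1 + g) + 2 * E * Ks).
  assert (ESp : 0 < E * Ks) by (apply Rmult_lt_0_compat; lra).
  assert (Cep : 0 < Ce) by (unfold Ce; assert (0 <= c * g) by (apply Rmult_le_pos; lra); lra).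
  set (T := (E * Ks + 16 * Ce ^ 2) / (2 * c)).
  assert (T0 : 0 < T) by (unfold T; apply Rdiv_lt_0_compat; [assert (0 <= Ce ^ 2) by apply pow2_ge_0; lra|lra]).
  set (KB := 2 * Kk + 8).
  exists (T * (2 + 3 * Kk ^ 2) + g * Kk + 3 * T), (KB + 2 * gb), (Rmin 1 eta),
    (4 + 4 * Ce * 2 + 2 * KB / r0 + 2 * KB).
  assert (kk2 : 0 <= Kk ^ 2) by apply pow2_ge_0.
  assert (gK : 0 <= g * Kk) by (apply Rmult_le_pos; lra).
  assert (TK : 0 <= T * Kk ^ 2) by (apply Rmult_le_pos; lra).
  assert (KBr : 0 <= 2 * KB / r0) by (unfold Rdiv, KB; apply Rmult_le_pos; [lra|left; apply Rinv_0_lt_compat; trivial]).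
  split; [lra|]. split; [unfold KB; lra|]. split.
  { split; [apply Rmin_glb_lt; lra|apply Rmin_l]. }
  split; [unfold KB in *; lra|].
  intros n rho X z w Hrho Hn Hz0 Hz Hs Ht HI HX A B A' B' X'.
  assert (HIe : Rabs (Im X) <= eta) by (apply Rle_trans with (1 := HI), Rmin_r).
  assert (HI1 : Rabs (Im X) <= 1) by (apply Rle_trans with (1 := HI), Rmin_l).
  assert (n0 : 0 < n) by (unfold KB in *; lra).
  assert (u0 : 0 < / n) by (apply Rinv_0_lt_compat; trivial).
  assert (rn0 : 0 < rho / 2 / n) by (unfold Rdiv, KB in *; apply Rmult_lt_0_compat; lra).
  destruct (Hker X ltac:(fold P; lra) HIe) as [N HB]. fold kap P in N, HB.
  set (x := cexp (kap * X)) in *.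
  assert (EB : (B * (1 - x) = kap * z)%C).
  { unfold B. rewrite Ek. replace ((w - lamb * z) * (1 - x))%C with ((w - lamb * z) - x * (w - lamb * z))%C by ring.
    rewrite HX. ring. }
  assert (EB2 : B = (kap * z / (1 - x))%C) by (rewrite <- EB; field; trivial).
  set (zt := Cmod z) in *. assert (z1 : 0 < zt) by (apply Cmod_gt_0; trivial).
  assert (B0 : B <> 0).
  { intros EE. rewrite EE in EB. apply (Cmult_neq_0 kap z k0 Hz0). rewrite <- EB. ring. }
  assert (Bp : 0 < Cmod B) by (apply Cmod_gt_0; trivial).
  set (s := Re X) in *. set (t := P - s) in *.
  assert (s0 : 0 < s) by lra. assert (t0 : 0 < t) by lra.
  set (sg := / s) in *. set (tu := / t) in *.
  assert (sg0 : 0 < sg) by (apply Rinv_0_lt_compat; trivial).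
  assert (tu0 : 0 < tu) by (apply Rinv_0_lt_compat; trivial).
  assert (LX : s <= Cmod X) by (apply Rle_trans with (2 := re_le_Cmod X), Rle_abs).
  assert (LXP : t <= Cmod (X - RtoC P)).
  { rewrite Cmod_minus_sym. apply Rle_trans with (2 := re_le_Cmod _).
    apply Rle_trans with (2 := Rle_abs _). unfold t, s. destruct X; simpl; lra. }
  assert (X0 : X <> 0) by (apply Cmod_gt_0; lra).
  assert (XP0 : (X - RtoC P)%C <> 0) by (apply Cmod_gt_0; lra).
  assert (IX : Cmod (/ X) <= sg) by (rewrite Cmod_inv by trivial; apply Rinv_le_contravar; trivial).
  assert (IXP : Cmod (/ (X - RtoC P)) <= tu) by (rewrite Cmod_inv by trivial; apply Rinv_le_contravar; trivial).
  set (ker := (kap / (1 - x) + / X + / (X - P))%C) in *.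
  assert (EB3 : B = (z * (ker - / X - / (X - P)))%C).
  { rewrite EB2. unfold ker. field. repeat split; trivial. }
  assert (HBt : Cmod B <= zt * (Kk + sg + tu)).
  { rewrite EB3, Cmod_mult. fold zt. apply Rmult_le_compat_l; [lra|].
    eapply Rle_trans; [eapply Csub_le; [eapply Csub_le; [exact HB|exact IX]|exact IXP]|]. lra. }
  assert (in_s : forall y, rho / 2 / n <= y -> / y <= 2 * n / rho).
  { intros y Hy. replace (2 * n / rho) with (/ (rho / 2 / n)) by (field; unfold KB in *; lra).
    apply Rinv_le_contravar; trivial. }
  assert (sgn := in_s s Hs). assert (tun := in_s t Ht). fold sg in sgn. fold tu in tun.
  assert (rho0 : 0 < rho) by (unfold KB in *; lra).
  assert (nr : 1 <= n / rho).
  { apply Rmult_le_reg_r with rho; trivial. unfold Rdiv. rewrite Rmult_assoc, Rinv_l by lra. lra. }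
  assert (HBr : Cmod B <= KB / rho).
  { apply Rle_trans with (1 := HBt).
    apply Rle_trans with (11 / 10 / n * ((Kk + 4) * (n / rho))).
    - apply Rmult_le_compat; try lra. unfold Rdiv in *.
      assert (Kk <= Kk * (n * / rho)) by (clear - nr HKk; nra). lra.
    - replace (11 / 10 / n * ((Kk + 4) * (n / rho))) with (11 / 10 * (Kk + 4) * / rho) by (field; lra).
      unfold Rdiv. apply Rmult_le_compat_r; [left; apply Rinv_0_lt_compat; trivial|]. unfold KB; lra. }
  assert (HBr0 : Cmod B < r0).
  { apply Rle_lt_trans with (1 := HBr). apply Rmult_lt_reg_r with (rho / r0).
    - apply Rdiv_lt_0_compat; trivial.
    - replace (KB / rho * (rho / r0)) with (KB / r0) by (field; lra).
      replace (r0 * (rho / r0)) with rho by (field; lra). unfold Rdiv, KB in *. lra. }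
  assert (HB1 : Cmod B <= 1).
  { apply Rle_trans with (1 := HBr). apply Rmult_le_reg_r with rho; trivial.
    unfold Rdiv. rewrite Rmult_assoc, Rinv_l by lra. lra. }
  assert (zn : zt <= 11 / 10 / rho).
  { apply Rle_trans with (1 := Hz). unfold Rdiv. apply Rmult_le_compat_l; [lra|]. apply Rinv_le_contravar; lra. }
  assert (zCe : 4 * Ce * zt <= 1).
  { apply Rle_trans with (4 * Ce * (11 / 10 / rho)); [apply Rmult_le_compat_l; lra|].
    apply Rmult_le_reg_r with rho; trivial. unfold Rdiv, KB in *.
    replace (4 * Ce * (11 * / 10 * / rho) * rho) with (4 * Ce * (11 / 10)) by (field; lra). lra. }
  assert (z11 : zt <= 1).
  { apply Rle_trans with (1 := zn). apply Rmult_le_reg_r with rho; trivial. unfold Rdiv, KB in *.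
    rewrite Rmult_assoc, Rinv_l by lra. lra. }
  (* Since [Im X] is bounded, [A] and [B] are comparable in size; this yields the bound of [z] by
     [B] that [step_ratio] requires, and allows the division by [x] below. *)
  assert (Mx : exp (- (2 * c)) <= Cmod x <= E).
  { unfold x. rewrite Cmod_cexp.
    replace (Re (kap * X)%C) with (- (2 * c * Im X)) by (unfold kap; destruct X; simpl; ring).
    apply Rabs_le_between in HI1.
    assert (mono : forall u v, u <= v -> exp u <= exp v).
    { intros u v [H|H]; [left; apply exp_increasing; trivial|right; f_equal; trivial]. }
    split; [apply mono|unfold E; apply mono]; clear - HI1 Hc; nra. }
  assert (xp : 0 < Cmod x) by (assert (H := exp_pos (- (2 * c))); lra).
  assert (x0 : x <> 0) by (apply Cmod_gt_0; trivial).
  assert (ix : / Cmod x <= E).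
  { rewrite exp_Ropp in Mx. fold E in Mx. rewrite <- (Rinv_inv E).
    apply Rinv_le_contravar; [apply Rinv_0_lt_compat; lra|lra]. }
  assert (HzL : zt <= L * Cmod B).
  { assert (HH : Cmod B * Cmod (1 - x) = 2 * c * zt).
    { rewrite <- Cmod_mult, EB, Cmod_mult, Mk. trivial. }
    assert (H1x : Cmod (1 - x) <= 1 + E).
    { eapply Rle_trans; [apply Cmod_minus_le|]. rewrite Cmod_1. lra. }
    unfold L. apply Rmult_le_reg_l with (2 * c); [lra|].
    replace (2 * c * ((1 + E) / (2 * c) * Cmod B)) with (Cmod B * (1 + E)) by (field; lra).
    rewrite <- HH. apply Rmult_le_compat_l; lra. }
  destruct (Hstep z w Bp HBr0 HzL) as [HB' HR]. fold lam lamb kap A B A' B' in HB', HR. fold zt in HR.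
  assert (EA : A = (x * B)%C) by (symmetry; exact HX).
  assert (EAB : (A / B = x)%C) by (rewrite EA; field; trivial).
  rewrite EAB in HR.
  assert (B'0 : B' <> 0) by (apply Cmod_gt_0; lra).
  set (ratio := (A' / B' / (A / B))%C) in *.
  assert (Er : ratio = (A' / B' / x)%C) by (unfold ratio; rewrite EAB; trivial).
  set (S2 := sg ^ 2 + tu ^ 2).
  set (V := zt ^ 2 + zt * Cmod B ^ 2) in *.
  assert (B20 : 0 <= Cmod B ^ 2) by apply pow2_ge_0.
  assert (V0 : 0 <= V) by (unfold V; apply Rplus_le_le_0_compat; [apply pow2_ge_0|apply Rmult_le_pos; lra]).
  assert (VV : V <= 2 * zt).
  { unfold V. clear - z11 z1 HB1 Bp. assert (Cmod B ^ 2 <= 1) by nra. nra. }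
  set (ep := (ratio - 1)%C).
  assert (H1 : Cmod (ep - kap * z * (1 - (1 - b03) * B)) <= E * Ks * V).
  { replace (ep - kap * z * (1 - (1 - b03) * B))%C with
      ((A' / B' - x * (1 + kap * z * (1 - (1 - b03) * B))) * / x)%C.
    2:{ unfold ep. rewrite Er. field. split; trivial. }
    rewrite Cmod_mult, Cmod_inv by trivial.
    apply Rle_trans with (Ks * V * E); [|right; ring].
    apply Rmult_le_compat; trivial; [apply Cmod_ge_0|left; apply Rinv_0_lt_compat; trivial]. }
  assert (H2 : Cmod ep <= Ce * zt).
  { replace ep with ((ep - kap * z * (1 - (1 - b03) * B)) + kap * z * (1 - (1 - b03) * B))%C by ring.
    eapply Rle_trans.
    { eapply Cadd_le; [exact H1|]. eapply Cmul_le; [eapply Cmul_le; [right; exact Mk|apply Rle_refl]|].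
      eapply Csub_le; [rewrite Cmod_1; apply Rle_refl|]. eapply Cmul_le; [apply Rle_refl|exact HB1]. }
    fold zt g. unfold Ce.
    assert (E * Ks * V <= E * Ks * (2 * zt)) by (apply Rmult_le_compat_l; lra). lra. }
  assert (H3 : Cmod ep <= 1 / 4) by lra.
  assert (H4 := clog_near_1 ep H3).
  assert (Erat : ratio = (1 + ep)%C) by (unfold ep; ring).
  assert (H5 : Cmod (X' - X - z + (1 - b03) * z * B) <= T * (zt ^ 2 + V)).
  { unfold X'. rewrite Erat.
    replace (X + clog (1 + ep) / kap - X - z + (1 - b03) * z * B)%C with
      (((clog (1 + ep) - ep) + (ep - kap * z * (1 - (1 - b03) * B))) / kap)%C by (field; trivial).
    eapply Rle_trans.
    { apply Cdiv_le with (X := 16 * Cmod ep ^ 2 + E * Ks * V) (Y := 2 * c); [|lra|lra].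
      eapply Cadd_le; eassumption. }
    assert (Cmod ep ^ 2 <= Ce ^ 2 * zt ^ 2).
    { rewrite <- Rpow_mult_distr. apply pow_incr; split; trivial. apply Cmod_ge_0. }
    unfold T. replace ((E * Ks + 16 * Ce ^ 2) / (2 * c) * (zt ^ 2 + V)) with
      ((E * Ks + 16 * Ce ^ 2) * (zt ^ 2 + V) / (2 * c)) by (field; lra).
    apply Rmult_le_compat_r; [left; apply Rinv_0_lt_compat; lra|].
    assert (0 <= zt ^ 2) by apply pow2_ge_0.
    assert (0 <= Ce ^ 2) by apply pow2_ge_0.
    assert (0 <= E * Ks * zt ^ 2) by (apply Rmult_le_pos; lra).
    assert (0 <= Ce ^ 2 * V) by (apply Rmult_le_pos; lra). lra. }
  split; [|split].
  - unfold X'. replace (kap * (X + clog ratio / kap))%C with (kap * X + clog ratio)%C by (field; trivial).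
    rewrite cexp_add, cexp_clog.
    + fold x. rewrite Er. field. split; trivial.
    + rewrite Erat. assert (RE := re_le_Cmod ep). apply Rabs_le_between in RE.
      replace (Re (1 + ep)%C) with (1 + Re ep) by (destruct ep; simpl; ring). lra.
  - replace w with (B + lamb * z)%C by (unfold B; ring).
    eapply Rle_trans; [eapply Cadd_le; [exact HBr|eapply Cmul_le; [apply Rle_refl|exact zn]]|].
    fold gb. unfold Rdiv. assert (0 < / rho) by (apply Rinv_0_lt_compat; trivial).
    assert (0 <= gb * / rho) by (apply Rmult_le_pos; lra). lra.
  - replace (X' - X - z - (1 - b03) * z ^ 2 * (/ X + / (X - P)))%C with
      ((X' - X - z + (1 - b03) * z * B) - (1 - b03) * z ^ 2 * ker)%C by (rewrite EB3; ring).
    eapply Rle_trans.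
    { eapply Csub_le; [exact H5|]. eapply Cmul_le; [eapply Cmul_le; [apply Rle_refl|]|exact HB].
      rewrite Cmod_pow; apply Rle_refl. }
    fold g zt S2.
    assert (zt2 : 0 <= zt ^ 2) by apply pow2_ge_0.
    assert (S20 : 0 <= S2) by (unfold S2; apply Rplus_le_le_0_compat; apply pow2_ge_0).
    assert (zt3 : 0 <= zt ^ 3) by (apply pow_le; lra).
    assert (W3 : 0 <= zt ^ 3 * S2) by (apply Rmult_le_pos; trivial).
    (* [|B| <= |z| (Kk + sg + tu)] turns the term [|z| |B| ^ 2] into [|z| ^ 3] times the squared
       inverse distances to the two ends. *)
    assert (HV : V <= zt ^ 2 + 3 * Kk ^ 2 * zt ^ 2 + 3 * (zt ^ 3 * S2)).
    { unfold V.
      assert (Cmod B ^ 2 <= zt ^ 2 * (3 * (Kk ^ 2 + S2))).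
      { apply Rle_trans with ((zt * (Kk + sg + tu)) ^ 2); [apply pow_incr; lra|].
        rewrite Rpow_mult_distr. apply Rmult_le_compat_l; trivial. unfold S2.
        assert (Y1 := pow2_ge_0 (Kk - sg)). assert (Y2 := pow2_ge_0 (Kk - tu)). assert (Y3 := pow2_ge_0 (sg - tu)).
        lra. }
      assert (zt * Cmod B ^ 2 <= zt * (zt ^ 2 * (3 * (Kk ^ 2 + S2)))) by (apply Rmult_le_compat_l; lra).
      assert (zt * (Kk ^ 2 * zt ^ 2) <= 1 * (Kk ^ 2 * zt ^ 2)).
      { apply Rmult_le_compat_r; trivial. apply Rmult_le_pos; trivial. }
      replace (zt * (zt ^ 2 * (3 * (Kk ^ 2 + S2)))) with (3 * (zt * (Kk ^ 2 * zt ^ 2)) + 3 * (zt ^ 3 * S2)) in * by ring.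
      lra. }
    assert (T * (zt ^ 2 + V) <= T * (2 * zt ^ 2 + 3 * Kk ^ 2 * zt ^ 2 + 3 * (zt ^ 3 * S2))) by (apply Rmult_le_compat_l; lra).
    assert (0 <= T * (zt ^ 3 * S2)) by (apply Rmult_le_pos; lra).
    assert (0 <= T * zt ^ 2) by (apply Rmult_le_pos; lra).
    assert (0 <= g * Kk * (zt ^ 3 * S2)) by (apply Rmult_le_pos; lra).
    assert (0 <= T * Kk ^ 2 * (zt ^ 3 * S2)) by (apply Rmult_le_pos; lra).
    lra.
Qed.

Definition orbit_from (p : C -> C) (q : C -> C -> C) (z w : nat -> C) (m : nat) : Prop :=
  forall j, (m <= j)%nat -> z (S j) = p (z j) /\ w (S j) = q (z j) (w j).

Fixpoint partial_sum (X0 : C) (r : nat -> C) (k : nat) : C :=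
  match k with
  | O => X0
  | S k' => (partial_sum X0 r k' + r k')%C
  end.

(** Ties the abstract sequence of [gate] to an orbit: [gate_start] provides the first value of the
    lift, [gate_orbit_step] continues it and supplies the step estimate, and the same steps show
    that [w] stays of size [1 / rho] throughout. *)
Lemma gate_orbit (p : C -> C) (q : C -> C -> C) (a b03 b30 : C) (b c M r : R) :
  0 < r -> 0 < c -> b = 1 / 4 + c ^ 2 -> base_bound p a M r -> fiber_bound q b b03 b30 M r ->
  let lam := ((- (1 / 2))%R, c) : C in let lamb := ((- (1 / 2))%R, (- c)%R) : C in
  let kap := (0, (2 * c)%R) : C in let P := PI / c in
  exists K rho0, 0 < K /\ 4 <= rho0 /\ forall rho, rho0 <= rho -> exists Q, 1 <= Q /\
  forall (d : C) (z w : nat -> C) (m : nat),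
  orbit_from p q z w m -> Cmod d <= rho -> clock a d z m ->
  (forall j, (m <= j)%nat -> big Q (INR j)) -> w m <> 0 ->
  Cmod (- / w m) <= 3 * rho -> rho - 1 <= Re (- / w m)%C ->
  exists (e : nat) (Xm Xe : C), (m < e)%nat /\
    Cmod (RtoC (INR m) * Xm - - / w m) <= 1 /\
    (rho - 2) / INR e <= P - Re Xe <= rho / INR e /\ Rabs (Im Xe) <= 1 /\
    (w e - lam * z e = cexp (kap * Xe) * (w e - lamb * z e))%C /\
    ln (INR e) - ln (INR m) <= 5 / 4 * P /\
    Cmod (Xe - Xm - (1 - b03) * (z e * gate_log P Xe - z m * gate_log P Xm)
          - (drift a d (INR e) - drift a d (INR m))) <= K / INR m /\
    (forall j, (m <= j <= e)%nat -> Cmod (w j) <= K / rho).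
Proof.
  intros Hr Hc Hb Hp Hq lam lamb kap P.
  assert (HPI := PI_RGT_0).
  assert (P0 : 0 < P) by (apply Rdiv_lt_0_compat; trivial).
  destruct (@gate_orbit_step p q a b03 b30 b c M r Hr Hc Hb Hp Hq)
    as (K1 & Kw & eta & rho1 & HK1 & HKw & Heta & Hrho1 & Hst).
  destruct (@gate_start c Hc) as (Ks & dl & HKs & Hdl & Hstart).
  destruct (@gate a (1 - b03)%C P K1 eta P0 ltac:(lra) Heta) as (Kg & rho2 & HKg & Hrho2 & Hgate).
  destruct (clock_step a) as (Kz & HKz & Hclock).
  exists (Kg + Kw), (rho1 + rho2). split; [lra|]. split; [lra|].
  intros rho Hrho.
  destruct (Hgate rho ltac:(lra)) as (Qg & HQg & Hg).
  destruct (Hclock rho ltac:(lra)) as (Qc & HQc & Hcs).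
  assert (id : 0 < / dl) by (apply Rinv_0_lt_compat; lra).
  assert (rd : 0 <= 4 * rho * / dl) by (apply Rmult_le_pos; lra).
  assert (rk : 0 <= 32 * Ks * rho ^ 2) by (apply Rmult_le_pos; [lra|apply pow2_ge_0]).
  assert (rz : 0 <= 6 * Kz * rho ^ 2) by (apply Rmult_le_pos; [lra|apply pow2_ge_0]).
  set (Q := Qg + Qc + rho + 4 * rho * / dl + 32 * Ks * rho ^ 2 + 6 * Kz * rho ^ 2).
  exists Q. split; [unfold Q; lra|].
  intros d z w m Horb Hd Hcl HQ Hw0 HZ HZr.
  assert (HQc' : forall j, (m <= j)%nat -> big Qc (INR j)).
  { intros j Hj. apply big_mono with (2 := HQ j Hj). unfold Q; lra. }
  assert (HQg' : forall j, (m <= j)%nat -> big Qg (INR j)).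
  { intros j Hj. apply big_mono with (2 := HQ j Hj). unfold Q; lra. }
  set (n := INR m).
  assert (HQn : Q <= n) by (apply big_ge; [unfold Q; lra|apply HQ; lia]).
  assert (n0 : 0 < n) by (unfold Q in HQn; lra).
  assert (u0 : 0 < / n) by (apply Rinv_0_lt_compat; trivial).
  destruct (Hcs d z m m Hd Hcl (le_n m) (HQc' m (le_n m))) as (Z1 & _ & _ & _ & Z5). fold n in Z1, Z5.
  set (Z := (- / w m)%C) in *. set (y := (z m * Z)%C).
  assert (Z0 : 0 <= Cmod Z) by apply Cmod_ge_0.
  assert (Hy : Cmod y <= 4 * rho / n).
  { unfold y. rewrite Cmod_mult. apply Rle_trans with (11 / 10 / n * (3 * rho)).
    - apply Rmult_le_compat; trivial. apply Cmod_ge_0.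
    - unfold Rdiv. assert (0 <= rho * / n) by (apply Rmult_le_pos; lra). lra. }
  assert (Hydl : Cmod y <= dl).
  { apply Rle_trans with (1 := Hy). apply Rmult_le_reg_r with (n * / dl); [apply Rmult_lt_0_compat; trivial|].
    replace (4 * rho / n * (n * / dl)) with (4 * rho * / dl) by (field; lra).
    replace (dl * (n * / dl)) with n by (field; lra). unfold Q in HQn; lra. }
  destruct (Hstart y Hydl) as (Xm & Hy0 & HXm & HXy). fold lam lamb kap in HXm.
  assert (HXZ : Cmod (RtoC n * Xm - Z) <= 1).
  { replace (RtoC n * Xm - Z)%C with (RtoC n * (Xm - y) + (z m - RtoC (/ n)) * (RtoC n * Z))%C.
    2:{ unfold y. rewrite RtoC_inv by lra. field. intros E; apply RtoC_inj in E; lra. }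
    eapply Rle_trans.
    { eapply Cadd_le; (eapply Cmul_le; [first [exact Z5|rewrite Cmod_RtoC_pos by lra; apply Rle_refl]|]); [exact HXy|].
      eapply Cmul_le; [rewrite Cmod_RtoC_pos by lra; apply Rle_refl|exact HZ]. }
    assert (A1 : n * (Ks * Cmod y ^ 2) <= 1 / 2).
    { apply Rle_trans with (n * (Ks * (4 * rho / n) ^ 2)).
      - apply Rmult_le_compat_l; [lra|]. apply Rmult_le_compat_l; [lra|]. apply pow_incr; split; trivial. apply Cmod_ge_0.
      - apply Rmult_le_reg_r with n; trivial.
        replace (n * (Ks * (4 * rho / n) ^ 2) * n) with (16 * Ks * rho ^ 2) by (field; lra). unfold Q in HQn; lra. }
    assert (A2 : Kz * rho * (1 + ln n) / n ^ 2 * (n * (3 * rho)) <= 1 / 2).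
    { apply Rmult_le_reg_r with n; trivial.
      replace (Kz * rho * (1 + ln n) / n ^ 2 * (n * (3 * rho)) * n) with (6 * Kz * rho ^ 2 * (1 + ln n) / 2) by (field; lra).
      assert (H := @big_lin Q n ltac:(unfold Q; lra) (HQ m (le_n m))).
      assert (L := ln_nonneg n ltac:(unfold Q in HQn; lra)).
      assert (6 * Kz * rho ^ 2 * (1 + ln n) <= Q * (1 + ln n)) by (apply Rmult_le_compat_r; [lra|unfold Q; lra]). lra. }
    lra. }
  set (A := fun j => (w j - lam * z j)%C). set (B := fun j => (w j - lamb * z j)%C).
  set (rr := fun k => (clog (A (S (m + k)) / B (S (m + k)) / (A (m + k)%nat / B (m + k)%nat)) / kap)%C).
  (* [X] is defined at all times by adding up logarithms. That it is a logarithm of [A / B] is only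
     proved as long as the past stays in the gate, which matches the form of the hypothesis of
     [gate]. *)
  set (X := fun j => partial_sum Xm rr (j - m)).
  assert (Xmm : X m = Xm) by (unfold X; rewrite Nat.sub_diag; trivial).
  assert (XS : forall j, (m <= j)%nat -> X (S j) = (X j + clog (A (S j) / B (S j) / (A j / B j)) / kap)%C).
  { intros j Hj. unfold X. replace (S j - m)%nat with (S (j - m)) by lia. simpl. f_equal.
    unfold rr. replace (m + (j - m))%nat with j by lia. trivial. }
  set (Rg := fun i => rho / 2 / INR i <= Re (X i) /\ rho / 2 / INR i <= P - Re (X i) /\ Rabs (Im (X i)) <= eta).
  assert (Hn : forall j, (m <= j)%nat -> n <= INR j) by (intros; apply le_INR; trivial).
  assert (Hone : forall j, (m <= j)%nat -> Rg j -> (cexp (kap * X j) * B j = A j)%C ->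
     (cexp (kap * X (S j)) * B (S j) = A (S j))%C /\ Cmod (w j) <= Kw / rho /\
     Cmod (X (S j) - X j - z j - (1 - b03) * z j ^ 2 * (/ X j + / (X j - RtoC P)))
      <= K1 * (Cmod (z j) ^ 2 + Cmod (z j) ^ 3 * ((/ Re (X j)) ^ 2 + (/ (P - Re (X j))) ^ 2))).
  { intros j Hj (R1 & R2 & R3) HR.
    destruct (Hcs d z m j Hd Hcl Hj (HQc' j Hj)) as (Zj & _).
    destruct (Horb j Hj) as [Ez Ew]. destruct (Hcl j Hj) as [z0 _].
    specialize (Hn j Hj).
    rewrite XS by trivial. unfold A, B. rewrite Ez, Ew.
    apply (Hst (INR j) rho (X j) (z j) (w j)); trivial; unfold Q in HQn; lra. }
  assert (Hhist : forall k, (forall i, (m <= i < m + k)%nat -> Rg i) ->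
     (cexp (kap * X (m + k)%nat) * B (m + k)%nat = A (m + k)%nat)%C).
  { induction k as [|k IH]; intros H.
    - rewrite Nat.add_0_r, Xmm.
      assert (Ew : w m = (- / Z)%C) by (unfold Z; field; trivial).
      assert (Zn : Z <> 0).
      { unfold Z. intros E. apply (f_equal Copp) in E.
        assert (E2 : (/ w m)%C = 0) by (replace (/ w m)%C with (- - / w m)%C by ring; rewrite E; ring).
        assert (E3 := Cinv_r (w m) Hw0). rewrite E2 in E3.
        apply (f_equal Re) in E3. simpl in E3. lra. }
      unfold A, B. rewrite Ew.
      replace (- / Z - lamb * z m)%C with (- / Z * (1 + lamb * y))%C by (unfold y; field; trivial).
      replace (- / Z - lam * z m)%C with (- / Z * (1 + lam * y))%C by (unfold y; field; trivial).
      rewrite <- HXm. ring.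
    - replace (m + S k)%nat with (S (m + k)) by lia. apply Hone; [lia|apply H; lia|].
      apply IH. intros i Hi. apply H; lia. }
  assert (Xb : Cmod (RtoC n * Xm) <= 3 * rho + 1).
  { replace (RtoC n * Xm)%C with (Z + (RtoC n * Xm - Z))%C by ring.
    eapply Rle_trans; [eapply Cadd_le; eassumption|]. lra. }
  rewrite Cmod_mult, Cmod_RtoC_pos in Xb by lra.
  assert (Xr : rho - 2 <= n * Re Xm).
  { assert (H := Re_ge_of_dist _ _ _ HXZ). apply Rabs_le_between in H.
    replace (Re (RtoC n * Xm)%C) with (n * Re Xm) in H by (destruct Xm; simpl; ring). lra. }
  destruct (Hg d z m X Hd Hcl HQg') as (e & He & Hrange & Hend & Hln & Hform).
  - rewrite Xmm. fold n. apply Rmult_le_reg_l with n; trivial.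
    replace (n * (rho / 2 / n)) with (rho / 2) by (field; lra). lra.
  - rewrite Xmm. fold n. apply Rmult_le_reg_l with n; trivial.
    replace (n * (5 * rho / n)) with (5 * rho) by (field; lra). lra.
  - intros j Hj HR. apply Hone; trivial.
    + apply HR; lia.
    + replace j with (m + (j - m))%nat by lia. apply Hhist. intros i Hi. apply HR; lia.
  - exists e, Xm, (X e). rewrite Xmm in Hform.
    assert (Hrel : forall j, (m <= j <= e)%nat -> (cexp (kap * X j) * B j = A j)%C).
    { intros j Hj. replace j with (m + (j - m))%nat by lia. apply Hhist. intros i Hi. apply Hrange; lia. }
    split; [trivial|]. split; [trivial|]. split; [trivial|]. split.
    { destruct (Hrange e ltac:(lia)) as (_ & _ & H). lra. }
    split; [symmetry; apply (Hrel e); lia|]. split; [trivial|]. split.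
    + apply Rle_trans with (1 := Hform). unfold Rdiv. apply Rmult_le_compat_r; [left; exact u0|lra].
    + intros j Hj. destruct (Hone j ltac:(lia) (Hrange j Hj) (Hrel j Hj)) as (_ & H & _).
      apply Rle_trans with (1 := H). unfold Rdiv. apply Rmult_le_compat_r; [left; apply Rinv_0_lt_compat; lra|lra].
Qed.

(** The tangent to the logarithm at [2 C] lies above it, and its slope makes [C * ln N] absorb only
    half of [N]. *)
Lemma log_absorb (N T C : R) : 1 <= C -> 0 < N -> N <= T + C * ln N -> N <= 2 * T + 2 * C * ln (2 * C).
Proof.
  intros HC HN H.
  assert (E := exp_ineq1_le (ln (N / (2 * C)))).
  assert (0 < N / (2 * C)) by (apply Rdiv_lt_0_compat; lra).
  rewrite exp_ln in E by trivial.
  unfold Rdiv in E at 1. rewrite ln_mult, ln_Rinv in E by (try apply Rinv_0_lt_compat; lra).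
  assert (C * (ln N - ln (2 * C)) <= C * (N / (2 * C))) by (apply Rmult_le_compat_l; lra).
  replace (C * (N / (2 * C))) with (N / 2) in * by (field; lra). lra.
Qed.

(** Adding [ln n] rescales the singular factor: [ln |V| + ln n = ln (n |V|)], where [n |V|] is
    roughly the size of [1 / w]. The other factor [P - V] stays away from 0 and infinity, and the
    arguments are bounded. *)
Lemma gate_log_end (P : R) : 0 < P -> exists K, 0 < K /\ forall (n : R) (V : C),
  1 <= n -> 0 < Re V <= P / 2 -> Cmod V <= P + 2 -> 1 <= n * Cmod V ->
  Cmod (gate_log P V + RtoC (ln n)) <= K + ln (n * Cmod V).
Proof.
  intros HP. exists (4 + Rabs (ln (P / 2)) + Rabs (ln (2 * P + 2))).
  assert (A1 := Rabs_pos (ln (P / 2))). assert (A2 := Rabs_pos (ln (2 * P + 2))).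
  split; [lra|]. intros n V Hn HV HM HN.
  unfold gate_log.
  assert (M0 : 0 < Cmod V).
  { apply Rlt_le_trans with (1 := proj1 HV). apply Rle_trans with (2 := re_le_Cmod V), Rle_abs. }
  set (Y := (P - V)%C).
  assert (Y1 : P / 2 <= Cmod Y).
  { apply Rle_trans with (2 := re_le_Cmod Y). apply Rle_trans with (2 := Rle_abs _).
    unfold Y. replace (Re (P - V)%C) with (P - Re V) by (destruct V; simpl; ring). lra. }
  assert (Y2 : Cmod Y <= 2 * P + 2).
  { unfold Y. eapply Rle_trans; [apply Cmod_minus_le|]. rewrite Cmod_RtoC_pos by lra. lra. }
  assert (B1 := Im_clog_bound V). assert (B2 := Im_clog_bound Y). assert (HPI : PI <= 4) by apply PI_4.
  eapply Rle_trans; [apply Cmod_le_Re_Im|].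
  replace (Re (clog V + clog Y + RtoC (ln n))%C) with (ln (n * Cmod V) + ln (Cmod Y)).
  2:{ rewrite ln_mult by lra. simpl. ring. }
  replace (Im (clog V + clog Y + RtoC (ln n))%C) with (Im (clog V) + Im (clog Y)) by (simpl; ring).
  assert (L := ln_nonneg _ HN).
  assert (L1 : ln (P / 2) <= ln (Cmod Y)) by (apply ln_le; lra).
  assert (L2 : ln (Cmod Y) <= ln (2 * P + 2)) by (apply ln_le; lra).
  assert (R1 := Rle_abs (ln (2 * P + 2))). assert (R2 := Rle_abs (- ln (P / 2))). rewrite Rabs_Ropp in R2.
  assert (T1 : Rabs (ln (n * Cmod V) + ln (Cmod Y)) <= ln (n * Cmod V) + Rabs (ln (P / 2)) + Rabs (ln (2 * P + 2))).
  { apply Rabs_le; lra. }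
  assert (T2 : Rabs (Im (clog V) + Im (clog Y)) <= 4).
  { eapply Rle_trans; [apply Rabs_triang|]. lra. }
  lra.
Qed.

Lemma gate_log_sym (P : R) (X : C) : gate_log P (RtoC P - X) = gate_log P X.
Proof.
  unfold gate_log. replace (RtoC P - (RtoC P - X))%C with X by ring. ring.
Qed.

Lemma exp_sub1_le t : Rabs t <= 1 / 2 -> Rabs (exp t - 1) <= 2 * Rabs t.
Proof.
  intros H. assert (B := exp_near_0 t ltac:(lra)).
  replace (exp t - 1) with ((exp t - 1 - t) + t) by ring.
  eapply Rle_trans; [apply Rabs_triang|].
  assert (E := pow2_abs t). assert (0 <= Rabs t) by apply Rabs_pos. nra.
Qed.

(* The equation of a gate, multiplied by [alpha n], becomes affine up to bounded terms. *)
Lemma gate_affine (P th n k t T N rho L K1 : R) (d V Xm Ze Zm R : C) :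
  0 < P -> 1 <= n -> 1 <= k -> 1 <= L -> 1 <= rho -> 1 <= K1 -> 0 <= T ->
  ln k - ln n = P + t -> ln k <= L -> Cmod d <= rho -> N = k * Cmod V ->
  N <= K1 * rho -> Rabs t <= K1 * (rho * L) / k -> 1000 * K1 ^ 2 * (rho * L) ^ 2 <= k ->
  Cmod (RtoC n * Xm - Zm) <= 1 -> Cmod (Ze + RtoC k * V) <= 1 -> Cmod R <= T / n ->
  (RtoC P - V - Xm - RtoC (ln k - ln n) + RtoC th * RtoC (ln k / k - ln n / n)
     - d * RtoC (/ k - / n) = R)%C ->
  Cmod (Ze - d - RtoC (exp P) * (Zm - d)
        - RtoC (k - exp P * n - th * (1 - exp P) * ln n))
    <= exp P * T + exp P + 10 + Rabs th * (P + 2).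
Proof.
  intros HP Hn Hk HL Hrho HK1 HT Hln HlnL Hd HN HNr Ht Hbig HX HZ HR E.
  set (al := exp P) in *. assert (al0 : 0 < al) by apply exp_pos.
  (* [s] is the factor by which the equation is multiplied. It equals [k * exp (- t)] with [t] of
     order [rho L / k], so [s] and [k] may be exchanged in front of quantities as small as [V]. *)
  set (s := al * n). assert (s0 : 0 < s) by (unfold s; apply Rmult_lt_0_compat; lra).
  set (q := rho * L) in *. assert (q1 : 1 <= q) by (unfold q; clear - Hrho HL; nra).
  assert (k0 : 0 < k) by lra.
  assert (tk : Rabs t * k <= K1 * q).
  { apply Rle_trans with (K1 * q / k * k); [apply Rmult_le_compat_r; lra|]. right; field; lra. }
  assert (Kq : 1000 * (K1 * q) ^ 2 <= k) by (rewrite Rpow_mult_distr; lra).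
  assert (Kq1 : 1 <= K1 * q) by (clear - HK1 q1; nra).
  assert (ta0 := Rabs_pos t).
  assert (t2 : Rabs t * (K1 * q) <= / 1000).
  { apply Rmult_le_reg_r with k; trivial. clear - tk Kq Kq1 ta0. nra. }
  assert (t1 : Rabs t <= / 1000) by (clear - t2 Kq1 ta0; nra).
  assert (es : s * exp t = k).
  { unfold s, al. rewrite <- (exp_ln k), <- (exp_ln n) by lra. rewrite <- !exp_plus. f_equal. lra. }
  assert (es' : s = k * exp (- t)).
  { rewrite <- es, exp_Ropp. field. assert (H := exp_pos t). lra. }
  set (f := exp (- t) - 1).
  assert (Hf : Rabs f <= 2 * Rabs t).
  { unfold f. rewrite <- (Rabs_Ropp t). apply exp_sub1_le. rewrite Rabs_Ropp. lra. }
  assert (sf : s = k * (1 + f)) by (rewrite es'; unfold f; ring).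
  assert (fb := Rle_abs f). assert (s2k : s <= 2 * k) by (rewrite sf; clear - fb Hf t1 k0; nra).
  (* [s] times a second-order remainder in [t], thus of order [(rho L) ^ 2 / k]. This is where the
     square of a logarithm has to be dominated by [k]. *)
  assert (T1 : Rabs (k - s - s * t) <= 1).
  { rewrite <- es. replace (s * exp t - s - s * t) with (s * (exp t - 1 - t)) by ring.
    rewrite Rabs_mult, (Rabs_pos_eq s) by lra.
    assert (B := exp_near_0 t ltac:(lra)).
    rewrite <- (pow2_abs t) in B.
    apply Rle_trans with (2 * k * (2 * Rabs t ^ 2)); [apply Rmult_le_compat; try lra; apply Rabs_pos|].
    clear - tk t2 ta0 k0 Kq1. replace (2 * k * (2 * Rabs t ^ 2)) with (4 * (Rabs t * k * Rabs t)) by ring.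
    assert (Rabs t * k * Rabs t <= K1 * q * Rabs t) by (apply Rmult_le_compat_r; lra). lra. }
  assert (T2 : Cmod (RtoC s * V - RtoC k * V) <= 1).
  { replace (RtoC s * V - RtoC k * V)%C with (RtoC f * (RtoC k * V))%C by (rewrite sf, RtoC_mult, RtoC_plus; ring).
    rewrite !Cmod_mult, Cmod_R, Cmod_RtoC_pos by lra. rewrite <- HN.
    assert (rho <= q) by (unfold q; clear - Hrho HL; nra).
    assert (K1 * rho <= K1 * q) by (apply Rmult_le_compat_l; lra).
    apply Rle_trans with (2 * Rabs t * (K1 * q)).
    - apply Rmult_le_compat; try lra; [apply Rabs_pos|]. rewrite HN. apply Rmult_le_pos; [lra|apply Cmod_ge_0].
    - lra. }
  assert (T3 : Cmod (RtoC s * Xm - RtoC al * Zm) <= al).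
  { replace (RtoC s * Xm - RtoC al * Zm)%C with (RtoC al * (RtoC n * Xm - Zm))%C by (unfold s; rewrite RtoC_mult; ring).
    rewrite Cmod_mult, Cmod_RtoC_pos by lra. clear - HX al0. nra. }
  assert (lk : 0 <= ln k) by (apply ln_nonneg; trivial).
  (* Origin of the logarithm in the time law: [s ln k / k] is nearly [ln k = ln n + P + t], whereas
     [s ln n / n] is exactly [al ln n]. The difference is [(1 - al) ln n] up to a bounded term. *)
  assert (T4 : Rabs (s * (ln k / k - ln n / n) - (1 - al) * ln n) <= P + 2).
  { replace (s * (ln k / k - ln n / n) - (1 - al) * ln n) with (P + t + f * ln k).
    2:{ replace (s * (ln k / k - ln n / n)) with (s * / k * ln k - al * ln n) by (unfold s; field; lra).
        rewrite sf. replace (k * (1 + f) * / k) with (1 + f) by (field; lra). lra. }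
    assert (Rabs (f * ln k) <= 1).
    { rewrite Rabs_mult, (Rabs_pos_eq (ln k)) by trivial.
      assert (L <= q) by (unfold q; clear - Hrho HL; nra).
      assert (q <= K1 * q) by (clear - HK1 q1; nra).
      apply Rle_trans with (2 * Rabs t * (K1 * q)); [apply Rmult_le_compat; try lra; apply Rabs_pos|]. lra. }
    eapply Rle_trans; [apply Rabs_triang|]. assert (Rabs (P + t) <= P + 1); [|lra].
    eapply Rle_trans; [apply Rabs_triang|]. rewrite (Rabs_pos_eq P) by lra. lra. }
  assert (T5 : Cmod (d * RtoC (s * (/ k - / n) - (1 - al))) <= 1).
  { replace (s * (/ k - / n) - (1 - al)) with f.
    2:{ replace (s * (/ k - / n)) with (s * / k - al) by (unfold s; field; lra). rewrite sf. field. lra. }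
    rewrite Cmod_mult, Cmod_R.
    assert (rho <= q) by (unfold q; clear - Hrho HL; nra).
    assert (q <= K1 * q) by (clear - HK1 q1; nra).
    apply Rle_trans with ((K1 * q) * (2 * Rabs t)); [apply Rmult_le_compat; try lra; [apply Cmod_ge_0|apply Rabs_pos]|]. lra. }
  assert (T6 : Cmod (RtoC s * R) <= al * T).
  { rewrite Cmod_mult, Cmod_RtoC_pos by lra.
    apply Rle_trans with (s * (T / n)); [apply Rmult_le_compat_l; lra|]. right. unfold s. field. lra. }
  replace (Ze - d - RtoC al * (Zm - d) - RtoC (k - s - th * (1 - al) * ln n))%C with
    ((Ze + RtoC k * V) + (RtoC s * V - RtoC k * V) + (RtoC s * Xm - RtoC al * Zm)
     - RtoC (k - s - s * t) - RtoC th * RtoC (s * (ln k / k - ln n / n) - (1 - al) * ln n)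
     + d * RtoC (s * (/ k - / n) - (1 - al)) + RtoC s * R)%C.
  2:{ rewrite <- E, Hln. fold s. generalize (ln k / k - ln n / n) (/ k - / n). intros D1 D2.
      repeat first [rewrite RtoC_minus | rewrite RtoC_plus | rewrite RtoC_mult]. ring. }
  eapply Rle_trans.
  { eapply Cadd_le; [|exact T6]. eapply Cadd_le; [|exact T5].
    eapply Csub_le; [|eapply Cmul_le; [rewrite Cmod_R; apply Rle_refl|rewrite Cmod_R; exact T4]].
    eapply Csub_le; [|rewrite Cmod_R; exact T1]. eapply Cadd_le; [|exact T3]. eapply Cadd_le; [exact HZ|exact T2]. }
  lra.
Qed.

(** * From entrance to exit in the coordinate -1/w *)

(** At an end of the gate the product of [z] and [gate_log] is [- ln k / k] up to [O(1 + Lv) / k]: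
    the logarithm comes from the singularity, and replacing [z] by [1 / k] costs only a squared
    logarithm over [k ^ 2]. *)
Lemma weighted_gate_log_le (C1 Kz rho k Lv : R) (zk G : C) :
  1 <= k -> 0 <= Lv + C1 -> Cmod zk <= 11 / 10 / k ->
  Cmod (zk - RtoC (/ k)) <= Kz * rho * (1 + ln k) / k ^ 2 -> Kz * rho * (1 + ln k) ^ 2 <= k ->
  0 <= Kz * rho -> Cmod (G + RtoC (ln k)) <= C1 + Lv ->
  Cmod (zk * G + RtoC (ln k / k)) <= (11 / 10 * (C1 + Lv) + 1) / k.
Proof.
  intros Hk H0 Hz Hz' Hb HK HG.
  assert (lk := ln_nonneg k Hk).
  replace (zk * G + RtoC (ln k / k))%C with (zk * (G + RtoC (ln k)) - (zk - RtoC (/ k)) * RtoC (ln k))%C.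
  2:{ unfold Rdiv. rewrite RtoC_mult. ring. }
  eapply Rle_trans.
  { eapply Csub_le; (eapply Cmul_le; [eassumption|]); [exact HG|].
    rewrite Cmod_RtoC_pos by trivial. apply Rle_refl. }
  assert (Kz * rho * (1 + ln k) / k ^ 2 * ln k <= 1 / k).
  { apply Rmult_le_reg_r with (k ^ 2); [apply pow_lt; lra|].
    replace (Kz * rho * (1 + ln k) / k ^ 2 * ln k * k ^ 2) with (Kz * rho * ((1 + ln k) * ln k)) by (field; lra).
    replace (1 / k * k ^ 2) with k by (field; lra).
    apply Rle_trans with (2 := Hb). apply Rmult_le_compat_l; trivial. clear - lk. nra. }
  unfold Rdiv in *. lra.
Qed.

(** The terms [(1 - a) ln n / n] of [drift] and [(1 - b03) ln n / n] of the two ends meet here with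
    opposite signs and leave the real factor [th]. In the error, [rho] enters only through the
    logarithm of the size of [Z] at the two ends, hence [K * (1 + ln rho)] with [K] chosen before
    [rho]. *)
Lemma transit (p : C -> C) (q : C -> C -> C) (a b03 b30 : C) (th b c M r : R) :
  0 < r -> 0 < c -> b = 1 / 4 + c ^ 2 -> a = (b03 + RtoC th)%C ->
  base_bound p a M r -> fiber_bound q b b03 b30 M r ->
  let al := exp (PI / c) in
  exists K rho0, 0 < K /\ 4 <= rho0 /\ forall rho, rho0 <= rho -> exists Q, 1 <= Q /\
  forall (d : C) (z w : nat -> C) (m : nat),
  orbit_from p q z w m -> Cmod d <= rho -> clock a d z m ->
  (forall j, (m <= j)%nat -> big Q (INR j)) -> w m <> 0 ->
  rho - 1 <= Re (- / w m)%C <= rho + 3 -> Rabs (Im (- / w m)%C) <= rho ->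
  exists e : nat, (m < e)%nat /\ w e <> 0 /\ - rho - 1 <= Re (- / w e)%C <= - rho + 3 /\
    Cmod (- / w e - d - RtoC al * (- / w m - d)
          - RtoC (INR e - al * INR m - th * (1 - al) * ln (INR m))) <= K * (1 + ln rho) /\
    (forall j, (m <= j <= e)%nat -> Cmod (w j) <= K / rho).
Proof.
  intros Hr Hc Hb Ha Hp Hq al.
  set (P := PI / c) in *.
  assert (HPI := PI_RGT_0).
  assert (P0 : 0 < P) by (apply Rdiv_lt_0_compat; trivial).
  assert (al0 : 0 < al) by apply exp_pos.
  destruct (@gate_orbit p q a b03 b30 b c M r Hr Hc Hb Hp Hq) as (Kg & rho1 & HKg & Hrho1 & Hgate).
  fold P in Hgate.
  destruct (@gate_log_end P P0) as (C1 & HC1 & Hlog).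
  destruct (@gate_end c Hc) as (Ke & dl & HKe & Hdl & Hend).
  destruct (clock_step a) as (Kz & HKz & Hclock).
  set (lam := ((- (1 / 2))%R, c) : C) in *. set (lamb := ((- (1 / 2))%R, (- c)%R) : C) in *.
  set (kap := (0, (2 * c)%R) : C) in *.
  set (g := Cmod (1 - b03)). assert (g0 : 0 <= g) by apply Cmod_ge_0.
  set (Ex := exp (5 / 4 * P)).
  assert (Ex1 : 1 <= Ex) by (unfold Ex; assert (H := exp_ineq1_le (5 / 4 * P)); lra).
  set (A := 1 + Ex * (5 + Kg + g * (22 / 10 * C1 + 7))).
  set (B := 1 + 11 / 10 * g * Ex).
  assert (gEx : 0 <= g * Ex) by (apply Rmult_le_pos; lra).
  assert (B1 : 1 <= B) by (unfold B; lra).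
  assert (gC : 0 <= g * C1) by (apply Rmult_le_pos; lra).
  assert (A1 : 1 <= A).
  { unfold A. assert (0 <= Ex * (5 + Kg + g * (22 / 10 * C1 + 7))); [|lra].
    apply Rmult_le_pos; lra. }
  assert (lB : 0 <= ln (2 * B)) by (apply ln_nonneg; lra).
  set (K2 := 2 * A + 2 * B * ln (2 * B)).
  assert (BlB : 0 <= B * ln (2 * B)) by (apply Rmult_le_pos; lra).
  assert (HK2 : 2 <= K2) by (unfold K2; lra).
  assert (lK2 : 0 <= ln K2) by (apply ln_nonneg; lra).
  set (K3 := Kg + g * (22 / 10 * C1 + 11 / 10 * ln K2 + 10)).
  assert (glK : 0 <= g * ln K2) by (apply Rmult_le_pos; lra).
  assert (HK3 : 0 <= K3) by (unfold K3; lra).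
  set (K1 := 1 + K2 + Ex * (K2 + 5 + 2 * Rabs th + K3)).
  assert (th0 := Rabs_pos th).
  assert (HK1 : 1 <= K1).
  { unfold K1. assert (0 <= Ex * (K2 + 5 + 2 * Rabs th + K3)); [|lra]. apply Rmult_le_pos; lra. }
  set (kk := Cmod (1 - a) + 1). assert (kk1 : 1 <= kk) by (unfold kk; assert (H := Cmod_ge_0 (1 - a)); lra).
  assert (alK : 0 <= al * K3) by (apply Rmult_le_pos; lra).
  assert (thP : 0 <= Rabs th * (P + 2)) by (apply Rmult_le_pos; lra).
  assert (alg : 0 <= al * g) by (apply Rmult_le_pos; lra).
  exists (Kg + al * (K3 + 3 * g) + al + 10 + Rabs th * (P + 2)), rho1.
  split; [lra|]. split; [lra|].
  intros rho Hrho.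
  destruct (Hgate rho Hrho) as (Qg & HQg & Hg).
  destruct (Hclock rho ltac:(lra)) as (Qc & HQc & Hcs).
  set (Q := Qg + Qc + 1000 * K1 ^ 2 * rho ^ 2 + Kz * rho + 8 * rho * / P + K2 * rho * / dl
            + 4 * K2 * rho * (kk + rho) + 8 * Ke * (K2 * rho) ^ 2).
  assert (q1 : 0 <= 1000 * K1 ^ 2 * rho ^ 2).
  { repeat apply Rmult_le_pos; try apply pow2_ge_0; lra. }
  assert (q2 : 0 <= Kz * rho) by (apply Rmult_le_pos; lra).
  assert (iP : 0 < / P) by (apply Rinv_0_lt_compat; trivial).
  assert (idl : 0 < / dl) by (apply Rinv_0_lt_compat; trivial).
  assert (q3 : 0 <= 8 * rho * / P) by (apply Rmult_le_pos; lra).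
  assert (K2r : 0 <= K2 * rho) by (apply Rmult_le_pos; lra).
  assert (q4 : 0 <= K2 * rho * / dl) by (apply Rmult_le_pos; lra).
  assert (q5 : 0 <= 4 * K2 * rho * (kk + rho)) by (apply Rmult_le_pos; lra).
  assert (q6 : 0 <= 8 * Ke * (K2 * rho) ^ 2) by (apply Rmult_le_pos; [lra|apply pow2_ge_0]).
  exists Q. split; [unfold Q; lra|].
  intros d z w m Horb Hd Hcl HQ Hw0 HZr HZi.
  set (Zm := (- / w m)%C) in *.
  assert (HZm : Cmod Zm <= 3 * rho).
  { eapply Rle_trans; [apply Cmod_le_Re_Im|]. rewrite (Rabs_pos_eq (Re Zm)) by lra. lra. }
  destruct (Hg d z w m Horb Hd Hcl) as (e & Xm & Xe & Hme & HXm & HXe & HXi & Hrel & Hln & Hform & Hw);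
    trivial; [|exact (proj1 HZr)|].
  { intros j Hj. apply big_mono with (2 := HQ j Hj). unfold Q; lra. }
  fold Zm in HXm.
  assert (HQc' : forall j, (m <= j)%nat -> big Qc (INR j)).
  { intros j Hj. apply big_mono with (2 := HQ j Hj). unfold Q; lra. }
  set (n := INR m) in *. set (k := INR e) in *.
  assert (Hnk : n <= k) by (apply le_INR; lia).
  assert (Bn := HQ m (le_n m)). assert (Bk := HQ e ltac:(lia)). fold n in Bn. fold k in Bk.
  assert (HQn : Q <= n) by (apply big_ge; [unfold Q; lra|trivial]).
  assert (n1 : 1 <= n) by apply Bn.
  assert (k1 : 1 <= k) by lra.
  assert (vu : / k <= / n) by (apply Rinv_le_contravar; lra).
  destruct (Hcs d z m m Hd Hcl (le_n m) (HQc' m (le_n m))) as (Zm1 & _ & _ & _ & Zm5). fold n in Zm1, Zm5.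
  destruct (Hcs d z m e Hd Hcl ltac:(lia) (HQc' e ltac:(lia))) as (Ze1 & _ & _ & _ & Ze5). fold k in Ze1, Ze5.
  set (L := 1 + ln k). assert (lk := ln_nonneg k k1). assert (ln0 := ln_nonneg n n1).
  assert (L1 : 1 <= L) by (unfold L; lra).
  assert (lnk : ln n <= ln k) by (apply ln_le; lra).
  assert (kE : k <= Ex * n).
  { unfold Ex. rewrite <- (exp_ln k), <- (exp_ln n), <- exp_plus by lra.
    destruct (Rle_lt_or_eq_dec (ln k) (5 / 4 * P + ln n)) as [H|H]; [lra| |right; f_equal; exact H].
    left; apply exp_increasing; exact H. }
  set (V := (P - Xe)%C).
  assert (EV : Xe = (P - V)%C) by (unfold V; ring).
  assert (ReV : Re V = P - Re Xe) by (unfold V; destruct Xe; simpl; ring).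
  assert (ImV : Rabs (Im V) <= 1).
  { unfold V. replace (Im (P - Xe)%C) with (- Im Xe) by (destruct Xe; simpl; ring). rewrite Rabs_Ropp; trivial. }
  rewrite <- ReV in HXe.
  assert (kV : rho - 2 <= k * Re V <= rho).
  { split.
    - apply Rle_trans with (k * ((rho - 2) / k)); [right; field; lra|]. apply Rmult_le_compat_l; lra.
    - apply Rle_trans with (k * (rho / k)); [|right; field; lra]. apply Rmult_le_compat_l; lra. }
  assert (ReV2 : Re V <= P / 2).
  { apply Rle_trans with (1 := proj2 HXe). apply Rmult_le_reg_r with (k * (2 * / P)); [apply Rmult_lt_0_compat; lra|].
    replace (rho / k * (k * (2 * / P))) with (2 * rho * / P) by (field; lra).
    replace (P / 2 * (k * (2 * / P))) with k by (field; lra). unfold Q in HQn. lra. }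
  assert (ReV0 : 0 < Re V).
  { apply Rlt_le_trans with (2 := proj1 HXe). apply Rdiv_lt_0_compat; lra. }
  assert (MV : Cmod V <= P + 2).
  { eapply Rle_trans; [apply Cmod_le_Re_Im|]. rewrite (Rabs_pos_eq (Re V)) by lra. lra. }
  set (N := k * Cmod V).
  assert (RVM : Re V <= Cmod V) by (apply Rle_trans with (2 := re_le_Cmod V), Rle_abs).
  assert (N2 : 2 <= N).
  { unfold N. assert (k * Re V <= k * Cmod V) by (apply Rmult_le_compat_l; lra). lra. }
  assert (lN : 0 <= ln N) by (apply ln_nonneg; lra).
  assert (Ge := Hlog k V k1 (conj ReV0 ReV2) MV ltac:(fold N; lra)). fold N in Ge.
  unfold V in Ge. rewrite gate_log_sym in Ge.
  assert (nX : n * Cmod Xm <= 4 * rho).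
  { rewrite <- (Cmod_RtoC_pos n), <- Cmod_mult by lra.
    replace (RtoC n * Xm)%C with ((RtoC n * Xm - Zm) + Zm)%C by ring.
    eapply Rle_trans; [eapply Cadd_le; eassumption|]. lra. }
  assert (nXr : rho - 2 <= n * Re Xm <= rho + 4).
  { assert (H := Re_ge_of_dist _ _ _ HXm). apply Rabs_le_between in H.
    replace (Re (RtoC n * Xm)%C) with (n * Re Xm) in H by (destruct Xm; simpl; ring). lra. }
  assert (RXM : Re Xm <= Cmod Xm) by (apply Rle_trans with (2 := re_le_Cmod Xm), Rle_abs).
  assert (nX1 : 1 <= n * Cmod Xm).
  { assert (n * Re Xm <= n * Cmod Xm) by (apply Rmult_le_compat_l; lra). lra. }
  assert (Xm2 : Cmod Xm <= 4 * rho / n).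
  { apply Rmult_le_reg_l with n; [lra|]. replace (n * (4 * rho / n)) with (4 * rho) by (field; lra). trivial. }
  assert (rn : 4 * rho / n <= P / 2).
  { apply Rmult_le_reg_r with (n * (2 * / P)); [apply Rmult_lt_0_compat; lra|].
    replace (4 * rho / n * (n * (2 * / P))) with (8 * rho * / P) by (field; lra).
    replace (P / 2 * (n * (2 * / P))) with n by (field; lra). unfold Q in HQn. lra. }
  assert (ReX0 : 0 < Re Xm) by (apply Rmult_lt_reg_l with n; lra).
  assert (Gm := Hlog n Xm n1 ltac:(lra) ltac:(lra) nX1).
  assert (lrho : 0 <= ln rho) by (apply ln_nonneg; lra).
  assert (lrr : ln rho <= rho) by (assert (H := exp_ineq1_le (ln rho)); rewrite exp_ln in H; lra).
  assert (l4 : ln 4 <= 3) by (assert (H := exp_ineq1_le (ln 4)); rewrite exp_ln in H; lra).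
  assert (lnX : 0 <= ln (n * Cmod Xm) <= 3 + ln rho).
  { split; [apply ln_nonneg; trivial|].
    apply Rle_trans with (ln (4 * rho)); [apply ln_le; lra|]. rewrite ln_mult by lra. lra. }
  assert (QL : forall x y, 0 <= x -> x <= Q -> big Q y -> x * (1 + ln y) ^ 2 <= y).
  { intros x y _ Hx [_ By]. apply Rle_trans with (2 := By). apply Rmult_le_compat_r; trivial. apply pow2_ge_0. }
  assert (We := @weighted_gate_log_le C1 Kz rho k (ln N) (z e) (gate_log P Xe) k1 ltac:(lra) Ze1 Ze5
     (QL _ _ q2 ltac:(unfold Q; lra) Bk) q2 Ge).
  assert (Wm := @weighted_gate_log_le C1 Kz rho n (ln (n * Cmod Xm)) (z m) (gate_log P Xm) n1 ltac:(lra) Zm1 Zm5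
     (QL _ _ q2 ltac:(unfold Q; lra) Bn) q2 Gm).
  set (ee := (z e * gate_log P Xe + RtoC (ln k / k))%C) in *.
  set (em := (z m * gate_log P Xm + RtoC (ln n / n))%C) in *.
  set (T := Kg + g * (22 / 10 * C1 + 6 + 11 / 10 * ln N + 11 / 10 * ln rho)).
  set (R' := (P - V - Xm - RtoC (ln k - ln n) + RtoC th * RtoC (ln k / k - ln n / n) - d * RtoC (/ k - / n))%C).
  assert (HR' : Cmod R' <= T / n).
  { replace R' with ((Xe - Xm - (1 - b03) * (z e * gate_log P Xe - z m * gate_log P Xm) -
                       (drift a d k - drift a d n)) + (1 - b03) * (ee - em))%C.
    2:{ unfold R', ee, em, drift. rewrite EV, Ha, !RtoC_minus. ring. }
    eapply Rle_trans.
    { eapply Cadd_le; [exact Hform|]. eapply Cmul_le; [apply Rle_refl|]. eapply Csub_le; [exact We|exact Wm]. }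
    fold g.
    assert ((11 / 10 * (C1 + ln N) + 1) / k <= (11 / 10 * (C1 + ln N) + 1) / n) by (apply Rmult_le_compat_l; lra).
    assert ((11 / 10 * (C1 + ln (n * Cmod Xm)) + 1) / n <= (11 / 10 * (C1 + 3 + ln rho) + 1) / n).
    { apply Rmult_le_compat_r; lra. }
    apply Rle_trans with (Kg / n + g * ((11 / 10 * (C1 + ln N) + 1) / n + (11 / 10 * (C1 + 3 + ln rho) + 1) / n)).
    - apply Rplus_le_compat_l. apply Rmult_le_compat_l; lra.
    - unfold T, Rdiv. assert (0 <= g * / n) by (apply Rmult_le_pos; lra).
      replace (Kg * / n + g * ((11 * / 10 * (C1 + ln N) + 1) * / n + (11 * / 10 * (C1 + 3 + ln rho) + 1) * / n)) with
        ((Kg + g * (22 / 10 * C1 + (2 + 33 / 10) + 11 / 10 * ln N + 11 / 10 * ln rho)) * / n) by (field; lra).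
      apply Rmult_le_compat_r; [lra|]. apply Rplus_le_compat_l. apply Rmult_le_compat_l; lra. }
  assert (dkn : Rabs (/ k - / n) <= / n) by (apply Rabs_le; lra).
  assert (HImV : Rabs (Im V) <= (4 * rho + rho + T) / n).
  { assert (EI : Im V = - Im Xm - Im (d * RtoC (/ k - / n))%C - Im R').
    { unfold R'. generalize (ln k - ln n) (ln k / k - ln n / n) (/ k - / n).
      intros; unfold Im, Cplus, Cminus, Copp, Cmult; simpl; ring. }
    rewrite EI.
    assert (J1 := Im_le_Cmod Xm). assert (J2 := Im_le_Cmod (d * RtoC (/ k - / n))). assert (J3 := Im_le_Cmod R').
    rewrite Cmod_mult, Cmod_R in J2.
    assert (J4 : Cmod d * Rabs (/ k - / n) <= rho * / n).
    { apply Rmult_le_compat; trivial; [apply Cmod_ge_0|apply Rabs_pos]. }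
    unfold Rdiv in *.
    apply Rabs_le_between in J1. apply Rabs_le_between in J2. apply Rabs_le_between in J3. apply Rabs_le; lra. }
  assert (T0 : 0 <= T).
  { unfold T. assert (0 <= g * (22 / 10 * C1 + 6 + 11 / 10 * ln N + 11 / 10 * ln rho)); [|lra]. apply Rmult_le_pos; lra. }
  (* The height at the exit is not known beforehand. The equation bounds [N = k |V|] by a multiple
     of [rho] plus a multiple of [ln N], the latter coming from [gate_log] at the exit itself;
     [log_absorb] closes the loop. *)
  assert (NN : N <= A * rho + B * ln N).
  { assert (H1 : N <= rho + Ex * (4 * rho + rho + T)).
    { unfold N. apply Rle_trans with (k * (Rabs (Re V) + Rabs (Im V))).
      - apply Rmult_le_compat_l; [lra|apply Cmod_le_Re_Im].
      - rewrite (Rabs_pos_eq (Re V)) by lra. rewrite Rmult_plus_distr_l. apply Rplus_le_compat; [lra|].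
        apply Rle_trans with (k * ((4 * rho + rho + T) / n)); [apply Rmult_le_compat_l; lra|].
        apply Rle_trans with ((Ex * n) * ((4 * rho + rho + T) / n)); [|right; field; lra].
        apply Rmult_le_compat_r; trivial. apply Rmult_le_pos; lra. }
    apply Rle_trans with (1 := H1). unfold T, A, B.
    assert (g * (6 + 11 / 10 * ln rho) <= g * (7 * rho + 1 * 0)).
    { apply Rmult_le_compat_l; lra. }
    assert (Ex * (g * (6 + 11 / 10 * ln rho)) <= Ex * (g * (7 * rho + 1 * 0))) by (apply Rmult_le_compat_l; lra).
    assert (Ex * Kg * 1 <= Ex * Kg * rho) by (apply Rmult_le_compat_l; [apply Rmult_le_pos|]; lra).
    assert (Ex * (g * C1) * 1 <= Ex * (g * C1) * rho) by (apply Rmult_le_compat_l; [apply Rmult_le_pos|]; lra).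
    lra. }
  assert (NK : N <= K2 * rho).
  { assert (H := @log_absorb N (A * rho) B B1 ltac:(lra) NN). unfold K2.
    assert (B * ln (2 * B) * 1 <= B * ln (2 * B) * rho) by (apply Rmult_le_compat_l; lra). lra. }
  assert (lNK : ln N <= ln K2 + ln rho).
  { rewrite <- ln_mult by lra. apply ln_le; lra. }
  assert (TK : T <= K3 + 3 * g * ln rho).
  { unfold T, K3.
    assert (g * ln N <= g * (ln K2 + ln rho)) by (apply Rmult_le_compat_l; lra).
    assert (0 <= g * ln rho) by (apply Rmult_le_pos; lra). lra. }
  set (t := ln k - ln n - P).
  assert (inu : / n <= Ex * / k).
  { apply Rmult_le_reg_r with (n * k); [apply Rmult_lt_0_compat; lra|].
    replace (/ n * (n * k)) with k by (field; lra).
    replace (Ex * / k * (n * k)) with (Ex * n) by (field; lra). exact kE. }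
  assert (rL : rho <= rho * L) by (clear - L1 Hrho Hrho1; nra).
  assert (LrL : L <= rho * L) by (clear - L1 Hrho Hrho1; nra).
  assert (TK3 : T <= K3 * rho).
  { unfold T, K3. assert (g * ln N <= g * (ln K2 + ln rho)) by (apply Rmult_le_compat_l; lra).
    assert (g * ln rho <= g * rho) by (apply Rmult_le_compat_l; lra).
    assert (Kg * 1 <= Kg * rho) by (apply Rmult_le_compat_l; lra).
    assert (g * C1 * 1 <= g * C1 * rho) by (apply Rmult_le_compat_l; lra).
    assert (g * ln K2 * 1 <= g * ln K2 * rho) by (apply Rmult_le_compat_l; lra).
    assert (g * 1 <= g * rho) by (apply Rmult_le_compat_l; lra). lra. }
  (* The real part of the equation shows that [ln k - ln n] is [P] up to [O(rho L / k)], the a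
     priori bound required by [gate_affine]. *)
  assert (Ht : Rabs t <= K1 * (rho * L) / k).
  { set (D := ln k / k - ln n / n).
    assert (HD : Rabs D <= 2 * L * / n).
    { unfold D, Rdiv. assert (0 <= ln k * / k) by (apply Rmult_le_pos; lra).
      assert (0 <= ln n * / n) by (apply Rmult_le_pos; lra).
      assert (ln k * / k <= L * / n) by (apply Rmult_le_compat; unfold L; lra).
      assert (ln n * / n <= L * / n) by (apply Rmult_le_compat_r; unfold L; lra).
      apply Rabs_le; lra. }
    assert (ER : t = - Re V - Re Xm + th * D - Re (d * RtoC (/ k - / n))%C - Re R').
    { unfold R', t. fold D. generalize D (ln k - ln n) (/ k - / n).
      intros; unfold Re, Cplus, Cminus, Copp, Cmult; simpl; ring. }
    assert (J1 := re_le_Cmod Xm). assert (J2 := re_le_Cmod (d * RtoC (/ k - / n))). assert (J3 := re_le_Cmod R').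
    rewrite Cmod_mult, Cmod_R in J2.
    assert (J4 : Cmod d * Rabs (/ k - / n) <= rho * / n).
    { apply Rmult_le_compat; trivial; [apply Cmod_ge_0|apply Rabs_pos]. }
    assert (J5 : Rabs (th * D) <= Rabs th * (2 * L * / n)).
    { rewrite Rabs_mult. apply Rmult_le_compat_l; lra. }
    assert (J6 : Re V <= K2 * rho * / n).
    { apply Rle_trans with (K2 * rho * / k); [|apply Rmult_le_compat_l; lra].
      apply Rmult_le_reg_l with k; [lra|]. replace (k * (K2 * rho * / k)) with (K2 * rho) by (field; lra).
      assert (k * Re V <= N) by (unfold N; apply Rmult_le_compat_l; lra). lra. }
    assert (J7 : T / n <= K3 * rho * / n) by (unfold Rdiv; apply Rmult_le_compat_r; lra).
    assert (F1 : Rabs t <= (K2 + 5 + 2 * Rabs th + K3) * (rho * L) * / n).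
    { apply Rle_trans with (K2 * rho * / n + 4 * rho * / n + Rabs th * (2 * L * / n) + rho * / n + K3 * rho * / n).
      - rewrite ER. unfold Rdiv in *.
        apply Rabs_le_between in J1. apply Rabs_le_between in J2. apply Rabs_le_between in J3.
        apply Rabs_le_between in J5. apply Rabs_le; lra.
      - replace (K2 * rho * / n + 4 * rho * / n + Rabs th * (2 * L * / n) + rho * / n + K3 * rho * / n) with
          (((K2 + 5 + K3) * rho + 2 * Rabs th * L) * / n) by ring.
        apply Rmult_le_compat_r; [lra|].
        assert ((K2 + 5 + K3) * rho <= (K2 + 5 + K3) * (rho * L)) by (apply Rmult_le_compat_l; lra).
        assert (2 * Rabs th * L <= 2 * Rabs th * (rho * L)) by (apply Rmult_le_compat_l; lra). lra. }
    apply Rle_trans with (1 := F1).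
    assert (W0 : 0 <= (K2 + 5 + 2 * Rabs th + K3) * (rho * L)) by (apply Rmult_le_pos; lra).
    apply Rle_trans with ((K2 + 5 + 2 * Rabs th + K3) * (rho * L) * (Ex * / k)); [apply Rmult_le_compat_l; lra|].
    unfold K1, Rdiv. replace ((K2 + 5 + 2 * Rabs th + K3) * (rho * L) * (Ex * / k)) with
      (Ex * (K2 + 5 + 2 * Rabs th + K3) * (rho * L) * / k) by ring.
    apply Rmult_le_compat_r; [lra|]. apply Rmult_le_compat_r; lra. }
  assert (V0 : V <> 0) by (apply Cmod_gt_0; lra).
  assert (kQ : Q <= k) by lra.
  assert (VN : Cmod V = N / k) by (unfold N; field; lra).
  destruct (Hend (- V)%C (z e) (w e)) as [We0 HZe].
  { intros E. apply V0. replace V with (- - V)%C by ring. rewrite E. ring. }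
  { rewrite Cmod_opp. apply Rmult_le_reg_r with (k * / dl); [apply Rmult_lt_0_compat; lra|].
    replace (Cmod V * (k * / dl)) with (N * / dl) by (unfold N; ring).
    replace (dl * (k * / dl)) with k by (field; lra).
    apply Rle_trans with (K2 * rho * / dl); [apply Rmult_le_compat_r; lra|]. unfold Q in kQ. lra. }
  { apply Hcl; lia. }
  (* [kap * P] is [2 PI i], so [Xe - P = - V] satisfies the relation of [gate_end] as well. *)
  { rewrite Hrel. f_equal. rewrite EV. replace (kap * (P - V))%C with (kap * (- V) + (0, (2 * PI)%R))%C.
    - apply cexp_2PI.
    - assert (PC : c * P = PI) by (unfold P; field; lra).
      unfold kap. destruct V as [x y]. apply injective_projections; simpl; [ring|]. rewrite <- PC. ring. }
  set (Ze := (- / w e)%C) in *.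
  (* [gate_end] gives [Ze] as [- V / z e] up to a small error; replacing [/ z e] by [k] costs a
     logarithm times [|V| = O(rho / k)]. *)
  assert (HZV : Cmod (Ze + RtoC k * V) <= 1).
  { rewrite Cmod_opp in HZe.
    destruct (Hcl e ltac:(lia)) as [ze0 Hze]. fold k in Hze.
    assert (D1 : Cmod (/ z e - RtoC k) <= (kk + rho) * L).
    { replace (/ z e - RtoC k)%C with ((/ z e - (RtoC k + (1 - a) * RtoC (ln k) + d)) + (1 - a) * RtoC (ln k) + d)%C by ring.
      eapply Rle_trans.
      { eapply Cadd_le; [eapply Cadd_le; [exact Hze|]|exact Hd].
        eapply Cmul_le; [apply Rle_refl|rewrite Cmod_RtoC_pos by trivial; apply Rle_refl]. }
      unfold kk, L. assert (0 <= Cmod (1 - a)) by apply Cmod_ge_0.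
      assert (0 <= rho * ln k) by (apply Rmult_le_pos; lra). lra. }
    assert (D2 : 4 * K2 * rho * ((kk + rho) * L) <= k).
    { apply Rle_trans with (4 * K2 * rho * (kk + rho) * L ^ 2).
      - replace (4 * K2 * rho * ((kk + rho) * L)) with (4 * K2 * rho * (kk + rho) * L) by ring.
        apply Rmult_le_compat_l; trivial. clear - L1; nra.
      - apply QL; trivial. unfold Q; lra. }
    assert (kkr : 0 <= (kk + rho) * L) by (apply Rmult_le_pos; lra).
    assert (K2r8 : 8 <= K2 * rho) by (clear - HK2 Hrho Hrho1; nra).
    assert (D3 : Cmod (/ z e) <= 2 * k).
    { replace (/ z e)%C with ((/ z e - RtoC k) + RtoC k)%C by ring.
      eapply Rle_trans; [eapply Cadd_le; [exact D1|rewrite Cmod_RtoC_pos by lra; apply Rle_refl]|].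
      clear - D2 kkr K2r8. nra. }
    replace (Ze + RtoC k * V)%C with ((Ze - - V / z e) - (/ z e - RtoC k) * V)%C by (field; trivial).
    eapply Rle_trans; [eapply Csub_le; [exact HZe|eapply Cmul_le; [exact D1|apply Rle_refl]]|].
    rewrite Cmod_inv in D3 by trivial.
    assert (E1 : Ke * Cmod V ^ 2 / Cmod (z e) <= 1 / 2).
    { rewrite VN. unfold Rdiv at 1.
      apply Rle_trans with (Ke * (K2 * rho / k) ^ 2 * (2 * k)).
      - apply Rmult_le_compat; trivial.
        + apply Rmult_le_pos; [lra|apply pow2_ge_0].
        + left; apply Rinv_0_lt_compat, Cmod_gt_0; trivial.
        + apply Rmult_le_compat_l; [lra|]. apply pow_incr. unfold Rdiv. split; [apply Rmult_le_pos; lra|].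
          apply Rmult_le_compat_r; lra.
      - apply Rmult_le_reg_r with k; [lra|].
        replace (Ke * (K2 * rho / k) ^ 2 * (2 * k) * k) with (8 * Ke * (K2 * rho) ^ 2 / 4) by (field; lra).
        unfold Q in kQ. lra. }
    assert (E2 : (kk + rho) * L * Cmod V <= 1 / 4).
    { rewrite VN. apply Rmult_le_reg_r with k; [lra|].
      replace ((kk + rho) * L * (N / k) * k) with (N * ((kk + rho) * L)) by (field; lra).
      assert (N * ((kk + rho) * L) <= K2 * rho * ((kk + rho) * L)) by (apply Rmult_le_compat_r; lra). lra. }
    lra. }
  exists e. fold Ze k n. split; trivial. split; trivial. split; [|split].
  - assert (H := Re_ge_of_dist Ze (- (RtoC k * V)) 1).
    replace (Ze - - (RtoC k * V))%C with (Ze + RtoC k * V)%C in H by ring. specialize (H HZV).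
    replace (Re (- (RtoC k * V))%C) with (- (k * Re V)) in H by (destruct V; simpl; ring).
    apply Rabs_le_between in H. lra.
  - apply Rle_trans with (al * T + al + 10 + Rabs th * (P + 2)).
    + apply (@gate_affine P th n k t T N rho L K1 d V Xm Ze Zm R'); trivial; try lra.
      * unfold t; ring.
      * unfold L; lra.
      * apply Rle_trans with (1 := NK). apply Rmult_le_compat_r; [lra|].
        unfold K1. assert (0 <= Ex * (K2 + 5 + 2 * Rabs th + K3)); [|lra]. apply Rmult_le_pos; lra.
      * rewrite Rpow_mult_distr. unfold L. rewrite <- Rmult_assoc. apply QL; trivial. unfold Q; lra.
    + assert (al * T <= al * (K3 + 3 * g * ln rho)) by (apply Rmult_le_compat_l; lra).
      assert (0 <= al * K3 * ln rho) by (apply Rmult_le_pos; lra).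
      assert (0 <= al * g * ln rho) by (apply Rmult_le_pos; lra).
      assert (0 <= Kg * ln rho) by (apply Rmult_le_pos; lra).
      assert (0 <= al * ln rho) by (apply Rmult_le_pos; lra).
      assert (0 <= Rabs th * (P + 2) * ln rho) by (apply Rmult_le_pos; lra). lra.
  - intros j Hj. apply Rle_trans with (1 := Hw j Hj). unfold Rdiv.
    apply Rmult_le_compat_r; [left; apply Rinv_0_lt_compat; lra|lra].
Qed.

(** * Dynamics outside the gate *)

(** In the coordinate [- 1 / w] the term [w ^ 2] becomes the translation by 1, the cubic term in [w]
    contributes [O(w)], and the perturbation [b z ^ 2] appears divided by [w ^ 2]. *)
Lemma crossing_step (q : C -> C -> C) (b : R) (b03 b30 : C) (M r : R) :
  0 < r -> fiber_bound q b b03 b30 M r ->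
  exists K r1, 0 < K /\ 0 < r1 <= r /\ forall z w : C, w <> 0 -> Cmod w < r1 -> Cmod z <= Cmod w ->
    q z w <> 0 /\ Cmod (- / q z w - - / w - 1) <= K * (Cmod w + Cmod z ^ 2 / Cmod w ^ 2).
Proof.
  intros Hr Hq.
  set (k := Rabs b + Cmod b03 + Cmod b30 + 16 * Rabs M + 1).
  assert (n1 := Rabs_pos b). assert (n2 := Cmod_ge_0 b03). assert (n3 := Cmod_ge_0 b30).
  assert (n4 := Rabs_pos M). assert (n5 := Rle_abs M).
  assert (k1 : 1 <= k) by (unfold k; lra).
  exists (6 * k), (Rmin r (/ (6 * k))). split; [lra|].
  assert (ik : 0 < / (6 * k)) by (apply Rinv_0_lt_compat; lra).
  split. { split; [apply Rmin_glb_lt; lra|apply Rmin_l]. }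
  intros z w Hw Hwr Hzw.
  set (x := Cmod w) in *. set (y := Cmod z) in *.
  assert (x0 : 0 < x) by (apply Cmod_gt_0; trivial).
  assert (y0 : 0 <= y) by apply Cmod_ge_0.
  assert (xr : x < r) by (apply Rlt_le_trans with (1 := Hwr), Rmin_l).
  assert (xk : 6 * k * x <= 1).
  { apply Rmult_le_reg_l with (/ (6 * k)); trivial. rewrite <- Rmult_assoc, Rinv_l by lra.
    assert (H := Rmin_r r (/ (6 * k))). lra. }
  assert (x1 : x <= 1) by (clear - xk k1 x0; nra).
  set (rho := (q z w - (w + w ^ 2))%C).
  assert (y2 : 0 <= y ^ 2) by apply pow2_ge_0. assert (x2 : 0 < x ^ 2) by (apply pow_lt; trivial).
  assert (x3 : 0 < x ^ 3) by (apply pow_lt; trivial).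
  assert (Hrho : Cmod rho <= k * (x ^ 3 + y ^ 2)).
  { replace rho with ((q z w - (w + w ^ 2 + RtoC b * z ^ 2 + b03 * w ^ 3 + b30 * z ^ 3)) +
       (RtoC b * z ^ 2 + b03 * w ^ 3 + b30 * z ^ 3))%C by (unfold rho; ring).
    eapply Rle_trans.
    { eapply Cadd_le; [apply Hq; fold x y; lra|].
      eapply Cadd_le; [eapply Cadd_le|]; (eapply Cmul_le; [apply Rle_refl|rewrite Cmod_pow; apply Rle_refl]). }
    fold x y. rewrite Cmod_R.
    assert (E1 : M * (y + x) ^ 4 <= 16 * Rabs M * x ^ 3).
    { assert ((y + x) ^ 4 <= (2 * x) ^ 4) by (apply pow_incr; lra).
      assert (0 <= (y + x) ^ 4) by (apply pow_le; lra).
      apply Rle_trans with (Rabs M * (y + x) ^ 4); [apply Rmult_le_compat_r; trivial|].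
      apply Rle_trans with (Rabs M * (2 * x) ^ 4); [apply Rmult_le_compat_l; trivial|].
      replace (Rabs M * (2 * x) ^ 4) with (16 * Rabs M * (x ^ 3 * x)) by ring.
      apply Rmult_le_compat_l; [lra|]. clear - x3 x1. nra. }
    assert (E2 : y ^ 3 <= y ^ 2).
    { replace (y ^ 3) with (y ^ 2 * y) by ring. assert (y <= 1) by lra. clear - y2 H. nra. }
    assert (E3 : Cmod b30 * y ^ 3 <= Cmod b30 * y ^ 2) by (apply Rmult_le_compat_l; trivial).
    unfold k.
    assert (0 <= Rabs b * x ^ 3) by (apply Rmult_le_pos; lra).
    assert (0 <= Cmod b30 * x ^ 3) by (apply Rmult_le_pos; lra).
    assert (0 <= Cmod b03 * y ^ 2) by (apply Rmult_le_pos; lra).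
    assert (0 <= Rabs M * y ^ 2) by (apply Rmult_le_pos; lra). lra. }
  assert (Eq : q z w = (w + (w ^ 2 + rho))%C) by (unfold rho; ring).
  assert (yx : y ^ 2 <= x ^ 2) by (apply pow_incr; lra).
  assert (Hsm : Cmod (w ^ 2 + rho) <= x / 2).
  { eapply Rle_trans; [eapply Cadd_le; [rewrite Cmod_pow; apply Rle_refl|exact Hrho]|]. fold x.
    assert (x ^ 3 <= x ^ 2) by (replace (x ^ 3) with (x ^ 2 * x) by ring; clear - x2 x1; nra).
    assert (k * (x ^ 3 + y ^ 2) <= k * (2 * x ^ 2)) by (apply Rmult_le_compat_l; lra).
    clear - H0 xk k1 x0. nra. }
  assert (Hq' : x / 2 <= Cmod (q z w)).
  { rewrite Eq. eapply Rle_trans; [|apply Cmod_plus_ge]. fold x. lra. }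
  assert (Q0 : q z w <> 0) by (apply Cmod_gt_0; lra).
  split; trivial.
  replace (- / q z w - - / w - 1)%C with ((rho - w ^ 3 - w * rho) / (w * q z w))%C.
  2:{ replace (rho - w ^ 3 - w * rho)%C with (q z w - w - w * q z w)%C by (rewrite Eq; ring). field. split; trivial. }
  eapply Rle_trans.
  { apply Cdiv_le with (X := 3 * k * (x ^ 3 + y ^ 2)) (Y := x * (x / 2)).
    - eapply Rle_trans.
      { eapply Csub_le; [eapply Csub_le; [exact Hrho|rewrite Cmod_pow; apply Rle_refl]|].
        eapply Cmul_le; [apply Rle_refl|exact Hrho]. }
      fold x. assert (0 <= k * (x ^ 3 + y ^ 2)) by (apply Rmult_le_pos; lra).
      assert (x * (k * (x ^ 3 + y ^ 2)) <= 1 * (k * (x ^ 3 + y ^ 2))) by (apply Rmult_le_compat_r; trivial).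
      assert (1 * x ^ 3 <= k * x ^ 3) by (apply Rmult_le_compat_r; lra).
      assert (0 <= k * y ^ 2) by (apply Rmult_le_pos; lra). lra.
    - clear - x0; nra.
    - rewrite Cmod_mult. fold x. apply Rmult_le_compat_l; lra. }
  right. field. lra.
Qed.

(** The inverse of [z - z ^ 2 + a z ^ 3] expands as [1 / z + 1 + (1 - a) z + O(z ^ 2)]. Summing
    [(1 - a) z_j] with [z_j] close to [1 / j] is what produces the logarithm in [clock]. *)
Lemma base_step (p : C -> C) (a : C) (M r : R) : 0 < r -> base_bound p a M r ->
  exists K r1, 0 < K /\ 0 < r1 <= r /\ forall z : C, z <> 0 -> Cmod z < r1 ->
    p z <> 0 /\ Cmod (/ p z - / z - 1 - (1 - a) * z) <= K * Cmod z ^ 2.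
Proof.
  intros Hr Hp.
  set (k := Cmod a + Rabs M + 1).
  assert (n1 := Cmod_ge_0 a). assert (n4 := Rabs_pos M). assert (n5 := Rle_abs M).
  assert (k1 : 1 <= k) by (unfold k; lra).
  exists (12 * k ^ 2), (Rmin r (/ (4 * k))).
  assert (k2 : 1 <= k ^ 2) by (clear - k1; nra).
  split; [lra|].
  assert (ik : 0 < / (4 * k)) by (apply Rinv_0_lt_compat; lra).
  split. { split; [apply Rmin_glb_lt; lra|apply Rmin_l]. }
  intros z Hz Hzr. set (x := Cmod z) in *.
  assert (x0 : 0 < x) by (apply Cmod_gt_0; trivial).
  assert (xr : x < r) by (apply Rlt_le_trans with (1 := Hzr), Rmin_l).
  assert (xk : 4 * k * x <= 1).
  { apply Rmult_le_reg_l with (/ (4 * k)); trivial. rewrite <- Rmult_assoc, Rinv_l by lra.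
    assert (H := Rmin_r r (/ (4 * k))). lra. }
  assert (x1 : x <= 1) by (clear - xk k1 x0; nra).
  set (e := (p z - (z - z ^ 2 + a * z ^ 3))%C).
  assert (x2 : 0 < x ^ 2) by (apply pow_lt; trivial). assert (x4 : 0 < x ^ 4) by (apply pow_lt; trivial).
  assert (He : Cmod e <= k * x ^ 4).
  { apply Rle_trans with (1 := Hp z xr). fold x. apply Rmult_le_compat_r; unfold k; lra. }
  set (h := (- z ^ 2 + a * z ^ 3 + e)%C).
  assert (Ep : p z = (z + h)%C) by (unfold h, e; ring).
  assert (ka : Cmod a <= k) by (unfold k; lra).
  assert (Hh : Cmod h <= 2 * k * x ^ 2).
  { unfold h. eapply Rle_trans.
    { eapply Cadd_le; [eapply Cadd_le; [eapply Copp_le; rewrite Cmod_pow; apply Rle_refl|]|exact He].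
      eapply Cmul_le; [apply Rle_refl|rewrite Cmod_pow; apply Rle_refl]. }
    fold x. assert (x ^ 3 <= x ^ 2) by (replace (x ^ 3) with (x ^ 2 * x) by ring; clear - x2 x1; nra).
    assert (x ^ 4 <= x ^ 2).
    { replace (x ^ 4) with (x ^ 2 * (x * x)) by ring. assert (x * x <= 1) by (clear - x1 x0; nra). clear - x2 H0. nra. }
    assert (Cmod a * x ^ 3 <= Cmod a * x ^ 2) by (apply Rmult_le_compat_l; lra).
    assert (k * x ^ 4 <= k * x ^ 2) by (apply Rmult_le_compat_l; lra).
    assert (0 <= Rabs M * x ^ 2) by (apply Rmult_le_pos; lra).
    assert (k * x ^ 2 = Cmod a * x ^ 2 + Rabs M * x ^ 2 + x ^ 2) by (unfold k; ring). lra. }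
  assert (Hp' : x / 2 <= Cmod (p z)).
  { rewrite Ep. eapply Rle_trans; [|apply Cmod_plus_ge]. fold x. clear - Hh xk k1 x0. nra. }
  assert (P0 : p z <> 0) by (apply Cmod_gt_0; lra).
  split; trivial.
  set (g := (a * z ^ 3 + e)%C).
  assert (x3 : 0 < x ^ 3) by (apply pow_lt; trivial).
  assert (x43 : x ^ 4 <= x ^ 3) by (replace (x ^ 4) with (x ^ 3 * x) by ring; clear - x3 x1; nra).
  assert (Hg : Cmod g <= 2 * k * x ^ 3).
  { unfold g. eapply Rle_trans.
    { eapply Cadd_le; [|exact He]. eapply Cmul_le; [exact ka|rewrite Cmod_pow; apply Rle_refl]. }
    fold x. assert (k * x ^ 4 <= k * x ^ 3) by (apply Rmult_le_compat_l; lra). lra. }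
  assert (k1a : Cmod (1 - a) <= k) by (eapply Rle_trans; [apply Cmod_minus_le|]; rewrite Cmod_1; unfold k; lra).
  replace (/ p z - / z - 1 - (1 - a) * z)%C with ((- e - z * g - (1 - a) * z ^ 2 * h) / (z * p z))%C.
  2:{ replace (- e - z * g - (1 - a) * z ^ 2 * h)%C with (z - p z - z * p z - (1 - a) * z ^ 2 * p z)%C
        by (rewrite Ep; unfold g, h; ring). field. split; trivial. }
  eapply Rle_trans.
  { apply Cdiv_le with (X := 5 * k ^ 2 * x ^ 4) (Y := x * (x / 2)).
    - eapply Rle_trans.
      { eapply Csub_le; [eapply Csub_le; [eapply Copp_le; exact He|eapply Cmul_le; [apply Rle_refl|exact Hg]]|].
        eapply Cmul_le; [eapply Cmul_le; [exact k1a|rewrite Cmod_pow; apply Rle_refl]|exact Hh]. }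
      fold x. replace (x * (2 * k * x ^ 3)) with (2 * (k * x ^ 4)) by ring.
      replace (k * x ^ 2 * (2 * k * x ^ 2)) with (2 * (k ^ 2 * x ^ 4)) by ring.
      assert (k * x ^ 4 <= k ^ 2 * x ^ 4) by (apply Rmult_le_compat_r; [lra|clear - k1; nra]). lra.
    - clear - x0; nra.
    - rewrite Cmod_mult. fold x. apply Rmult_le_compat_l; lra. }
  apply Rle_trans with (10 * k ^ 2 * x ^ 2); [right; field; lra|].
  assert (0 <= k ^ 2 * x ^ 2) by (apply Rmult_le_pos; lra). lra.
Qed.

Lemma inv_sqrt_telescope n : 1 <= n -> / (n * sqrt n) <= 4 * (/ sqrt n - / sqrt (n + 1)).
Proof.
  intros Hn. assert (s0 : 0 < sqrt n) by (apply sqrt_lt_R0; lra).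
  assert (s1 : 0 < sqrt (n + 1)) by (apply sqrt_lt_R0; lra).
  assert (E0 : sqrt n * sqrt n = n) by (apply sqrt_sqrt; lra).
  assert (E1 : sqrt (n + 1) * sqrt (n + 1) = n + 1) by (apply sqrt_sqrt; lra).
  assert (le : sqrt n <= sqrt (n + 1)) by (apply sqrt_le_1_alt; lra).
  apply Rmult_le_reg_r with (n * sqrt n * sqrt (n + 1)).
  { apply Rmult_lt_0_compat; trivial. apply Rmult_lt_0_compat; lra. }
  replace (/ (n * sqrt n) * (n * sqrt n * sqrt (n + 1))) with (sqrt (n + 1)) by (field; lra).
  replace (4 * (/ sqrt n - / sqrt (n + 1)) * (n * sqrt n * sqrt (n + 1))) with
    (4 * n * (sqrt (n + 1) - sqrt n)) by (field; lra).
  assert (G : 1 <= (sqrt (n + 1) - sqrt n) * (2 * sqrt (n + 1))).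
  { apply Rle_trans with ((sqrt (n + 1) - sqrt n) * (sqrt (n + 1) + sqrt n)); [lra|].
    apply Rmult_le_compat_l; lra. }
  assert (W : sqrt (n + 1) <= 2 * (n + 1) * (sqrt (n + 1) - sqrt n)).
  { set (s := sqrt (n + 1)) in *. clear - G s1 E1. nra. }
  apply Rle_trans with (1 := W). apply Rmult_le_compat_r; lra.
Qed.

(** The value of [d] read off at time [j]. It settles down along an orbit, and a single late value
    can serve as [d], since [clock] tolerates an error of 1. *)
Definition clock_defect (a : C) (z : nat -> C) (j : nat) : C :=
  (/ z j - (RtoC (INR j) + (1 - a) * RtoC (ln (INR j))))%C.

(** The weak control [/ z = n + O(sqrt n)] already gives [z - 1 / n = O(n ^ (- 3 / 2))], which is
    summable. The true deviation is only logarithmic, so this hypothesis can be maintained by a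
    bootstrap. *)
Lemma clock_defect_step (p : C -> C) (a : C) (M r : R) : 0 < r -> base_bound p a M r ->
  exists K, 0 < K /\ forall (z : nat -> C) (j : nat), K <= INR j -> z (S j) = p (z j) -> z j <> 0 ->
    Cmod (/ z j - RtoC (INR j)) <= sqrt (INR j) ->
    z (S j) <> 0 /\
    Cmod (clock_defect a z (S j) - clock_defect a z j) <= K * (/ sqrt (INR j) - / sqrt (INR (S j))).
Proof.
  intros Hr Hp. destruct (@base_step p a M r Hr Hp) as (Kb & r1 & HKb & Hr1 & Hb).
  set (k := Cmod (1 - a)). assert (k0 : 0 <= k) by apply Cmod_ge_0.
  assert (i1 : 0 < / r1) by (apply Rinv_0_lt_compat; lra).
  exists (4 + 4 * (6 * k + 4 * Kb) + 4 / r1). split; [unfold Rdiv; lra|].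
  intros z j Hj Ez Hz Hc. set (n := INR j) in *.
  assert (n4 : 4 <= n) by (unfold Rdiv in *; lra).
  assert (s2 : 2 <= sqrt n).
  { replace 2 with (sqrt 4); [apply sqrt_le_1_alt; lra|]. replace 4 with (2 * 2) by ring. apply sqrt_square; lra. }
  assert (E0 : sqrt n * sqrt n = n) by (apply sqrt_sqrt; lra).
  set (y := (/ z j)%C) in *.
  assert (Ezj : z j = (/ y)%C) by (unfold y; field; trivial).
  assert (My : n / 2 <= Cmod y).
  { replace y with (RtoC n + (y - RtoC n))%C by ring. eapply Rle_trans; [|apply Cmod_plus_ge].
    rewrite Cmod_RtoC_pos by lra. assert (2 * sqrt n <= sqrt n * sqrt n) by (apply Rmult_le_compat_r; lra). lra. }
  assert (y0 : y <> 0) by (apply Cmod_gt_0; lra).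
  assert (Mz : Cmod (z j) <= 2 / n).
  { rewrite Ezj, Cmod_inv by trivial. replace (2 / n) with (/ (n / 2)) by (field; lra).
    apply Rinv_le_contravar; lra. }
  assert (Mzr : Cmod (z j) < r1).
  { apply Rle_lt_trans with (1 := Mz). apply Rmult_lt_reg_r with (n * / r1); [apply Rmult_lt_0_compat; lra|].
    replace (2 / n * (n * / r1)) with (2 * / r1) by (field; lra).
    replace (r1 * (n * / r1)) with n by (field; lra). unfold Rdiv in *. lra. }
  destruct (Hb (z j) Hz Mzr) as [Hp0 Hb1]. rewrite <- Ez in Hp0, Hb1. split; trivial.
  unfold clock_defect. rewrite S_INR. fold n y.
  set (D := ln (n + 1) - ln n).
  assert (HD := ln_succ_bounds n ltac:(lra)). fold D in HD.
  replace (/ z (S j) - (RtoC (n + 1) + (1 - a) * RtoC (ln (n + 1))) - (y - (RtoC n + (1 - a) * RtoC (ln n))))%C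
    with ((/ z (S j) - y - 1 - (1 - a) * z j) + (1 - a) * ((z j - RtoC (/ n)) - RtoC (D - / n)))%C.
  2:{ unfold D. rewrite !RtoC_minus, RtoC_plus. ring. }
  assert (v0 : 0 < / (n * sqrt n)) by (apply Rinv_0_lt_compat, Rmult_lt_0_compat; lra).
  assert (n2v : / n ^ 2 <= / (n * sqrt n)).
  { apply Rinv_le_contravar; [apply Rmult_lt_0_compat; lra|]. replace (n ^ 2) with (n * n) by ring.
    apply Rmult_le_compat_l; [lra|]. clear - s2 E0. nra. }
  assert (B1 : Kb * Cmod (z j) ^ 2 <= 4 * Kb * / (n * sqrt n)).
  { assert (Cmod (z j) ^ 2 <= (2 / n) ^ 2) by (apply pow_incr; split; trivial; apply Cmod_ge_0).
    replace ((2 / n) ^ 2) with (4 * / n ^ 2) in H by (field; lra).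
    apply Rle_trans with (Kb * (4 * / (n * sqrt n))); [apply Rmult_le_compat_l; lra|lra]. }
  assert (B2 : Cmod (z j - RtoC (/ n)) <= 2 * / (n * sqrt n)).
  { rewrite Ezj, RtoC_inv by lra.
    assert (n0 : RtoC n <> 0) by (intros E; apply RtoC_inj in E; lra).
    replace (/ y - / RtoC n)%C with (- (y - RtoC n) / (y * RtoC n))%C by (field; split; trivial).
    eapply Rle_trans.
    { apply Cdiv_le with (X := sqrt n) (Y := n / 2 * n).
      - rewrite Cmod_opp; trivial.
      - clear - n4; nra.
      - rewrite Cmod_mult, Cmod_RtoC_pos by lra. apply Rmult_le_compat_r; lra. }
    replace (sqrt n / (n / 2 * n)) with (2 * (sqrt n * sqrt n) * / (n * n * sqrt n)) by (field; lra).
    rewrite E0. right. field. lra. }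
  assert (B3 : Cmod (RtoC (D - / n)) <= 4 * / (n * sqrt n)).
  { rewrite Cmod_R. apply Rle_trans with (1 := HD). unfold Rdiv. lra. }
  eapply Rle_trans.
  { eapply Cadd_le; [exact (Rle_trans _ _ _ Hb1 B1)|]. eapply Cmul_le; [apply Rle_refl|].
    eapply Csub_le; [exact B2|exact B3]. }
  fold k.
  assert (T := inv_sqrt_telescope n ltac:(lra)).
  apply Rle_trans with ((6 * k + 4 * Kb) * / (n * sqrt n)); [lra|].
  apply Rle_trans with ((6 * k + 4 * Kb) * (4 * (/ sqrt n - / sqrt (n + 1)))); [apply Rmult_le_compat_l; lra|].
  assert (0 <= 4 / r1 * (/ sqrt n - / sqrt (n + 1))) by (apply Rmult_le_pos; unfold Rdiv; lra). lra.
Qed.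

Lemma sqrt_ge_of_big A n : 0 <= A -> big (A ^ 2) n -> A * (1 + ln n) <= sqrt n.
Proof.
  intros HA [H1 H2]. assert (L := ln_nonneg n H1).
  rewrite <- (sqrt_pow2 (A * (1 + ln n))) by (apply Rmult_le_pos; lra).
  apply sqrt_le_1_alt. rewrite Rpow_mult_distr. exact H2.
Qed.

Lemma INR_ge_ev (B : R) : exists N : nat, forall j, (N <= j)%nat -> B <= INR j.
Proof.
  destruct (nfloor_ex (Rmax 0 B)) as [N HN]; [apply Rmax_l|].
  exists (S N). intros j Hj. apply le_INR in Hj. rewrite S_INR in Hj. assert (H := Rmax_r 0 B). lra.
Qed.

(** Bootstrap: a defect within 1 of its initial value gives a deviation [O(ln j)], below [sqrt j],
    and the increments after [N] then sum to at most [K / sqrt N <= 1]. The threshold depends only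
    on the bound for the defect, so an initial point can be placed to realize a prescribed [d]. *)
Lemma clock_of_defect (p : C -> C) (a : C) (M r : R) : 0 < r -> base_bound p a M r ->
  forall rho, exists N0, forall (N : nat) (z : nat -> C), (N0 <= N)%nat ->
    (forall j, (N <= j)%nat -> z (S j) = p (z j)) -> z N <> 0 ->
    Cmod (clock_defect a z N) <= rho -> clock a (clock_defect a z N) z N.
Proof.
  intros Hr Hp rho0. destruct (@clock_defect_step p a M r Hr Hp) as (K & HK & Hst).
  set (rho := Rmax 0 rho0). assert (rp : 0 <= rho) by apply Rmax_l.
  set (k := Cmod (1 - a)). assert (k0 : 0 <= k) by apply Cmod_ge_0.
  destruct (big_ev_INR ((k + rho + 1) ^ 2)) as [N1 HN1].
  destruct (INR_ge_ev (K + K ^ 2 + 1)) as [N2 HN2].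
  exists (N1 + N2)%nat. intros N z HN Ez Hz0 Hd'.
  assert (Hd : Cmod (clock_defect a z N) <= rho) by (apply Rle_trans with (1 := Hd'), Rmax_r).
  set (d := clock_defect a z N) in *.
  assert (K2 : 0 <= K ^ 2) by apply pow2_ge_0.
  assert (HKN : K / sqrt (INR N) <= 1).
  { assert (H := HN2 N ltac:(lia)).
    assert (K <= sqrt (INR N)).
    { rewrite <- (sqrt_pow2 K) by lra. apply sqrt_le_1_alt. lra. }
    apply Rmult_le_reg_r with (sqrt (INR N)); [lra|]. unfold Rdiv. rewrite Rmult_assoc, Rinv_l by lra. lra. }
  assert (All : forall i, z (N + i)%nat <> 0 /\
     Cmod (clock_defect a z (N + i) - d) <= K * (/ sqrt (INR N) - / sqrt (INR (N + i)))).
  { induction i as [|i [IH1 IH2]].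
    - rewrite Nat.add_0_r. split; trivial. fold d.
      replace (d - d)%C with (RtoC 0) by ring. rewrite Cmod_0. lra.
    - set (j := (N + i)%nat) in *. replace (N + S i)%nat with (S j) by (unfold j; lia).
      assert (Hj : K + K ^ 2 + 1 <= INR j) by (apply HN2; unfold j; lia).
      assert (js : 0 < / sqrt (INR j)) by (apply Rinv_0_lt_compat, sqrt_lt_R0; lra).
      destruct (Hst z j ltac:(lra) (Ez j ltac:(unfold j; lia)) IH1) as [H1 H2].
      + replace (/ z j - RtoC (INR j))%C with ((1 - a) * RtoC (ln (INR j)) + d + (clock_defect a z j - d))%C
          by (unfold clock_defect; ring).
        assert (L := ln_nonneg (INR j) ltac:(lra)).
        assert (B := HN1 j ltac:(unfold j; lia)).
        apply Rle_trans with (2 := @sqrt_ge_of_big (k + rho + 1) (INR j) ltac:(lra) B).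
        eapply Rle_trans.
        { eapply Cadd_le; [eapply Cadd_le; [|exact Hd]|exact IH2].
          eapply Cmul_le; [apply Rle_refl|rewrite Cmod_RtoC_pos by trivial; apply Rle_refl]. }
        fold k. assert (0 <= rho * ln (INR j)) by (apply Rmult_le_pos; trivial).
        assert (0 <= K * / sqrt (INR j)) by (apply Rmult_le_pos; lra).
        unfold Rdiv in HKN. lra.
      + split; trivial. eapply Rle_trans; [apply (Cmod_dist_trans _ (clock_defect a z j))|]. lra. }
  intros j Hj. destruct (All (j - N)%nat) as [H1 H2]. replace (N + (j - N))%nat with j in * by lia.
  split; trivial.
  replace (/ z j - (RtoC (INR j) + (1 - a) * RtoC (ln (INR j)) + d))%C with (clock_defect a z j - d)%C
    by (unfold clock_defect; ring).
  apply Rle_trans with (1 := H2).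
  assert (Hj2 : K + K ^ 2 + 1 <= INR j) by (apply HN2; lia).
  assert (js : 0 < / sqrt (INR j)) by (apply Rinv_0_lt_compat, sqrt_lt_R0; lra).
  assert (0 <= K * / sqrt (INR j)) by (apply Rmult_le_pos; lra).
  unfold Rdiv in HKN. lra.
Qed.

(** Successive passes over one recurrence: [Re (/ z j)] grows at least like [9 / 10] of [j], hence
    [z j = O(1 / j)], hence [/ z j - j] is at most logarithmic, and from then on [clock_defect_step]
    applies. *)
Lemma clock_exists (p : C -> C) (a : C) (M r : R) : 0 < r -> base_bound p a M r ->
  exists r2, 0 < r2 /\ forall z : nat -> C, (forall j, z (S j) = p (z j)) ->
    (forall j, Cmod (z j) < r2) -> z 0%nat <> 0 -> exists d N, clock a d z N.
Proof.
  intros Hr Hp. destruct (@base_step p a M r Hr Hp) as (Kb & r1 & HKb & Hr1 & Hb).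
  destruct (@clock_defect_step p a M r Hr Hp) as (K & HK & Hst).
  set (k := Cmod (1 - a)). assert (k0 : 0 <= k) by apply Cmod_ge_0.
  assert (kb : 0 < / (10 * (k + Kb + 1))) by (apply Rinv_0_lt_compat; lra).
  exists (Rmin 1 (Rmin r1 (/ (10 * (k + Kb + 1))))).
  split; [repeat apply Rmin_glb_lt; lra|].
  intros z Ez Hz Hz0.
  assert (Hz1 : forall j, Cmod (z j) < 1) by (intros j; apply Rlt_le_trans with (1 := Hz j), Rmin_l).
  assert (Hzr : forall j, Cmod (z j) < r1).
  { intros j; apply Rlt_le_trans with (1 := Hz j), Rle_trans with (1 := Rmin_r _ _), Rmin_l. }
  assert (Hzk : forall j, 10 * ((k + Kb) * Cmod (z j)) <= 1).
  { intros j. assert (H : Cmod (z j) <= / (10 * (k + Kb + 1))).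
    { apply Rlt_le, Rlt_le_trans with (1 := Hz j), Rle_trans with (1 := Rmin_r _ _), Rmin_r. }
    assert (10 * (k + Kb + 1) * Cmod (z j) <= 1).
    { apply Rmult_le_reg_l with (/ (10 * (k + Kb + 1))); trivial. rewrite <- Rmult_assoc, Rinv_l by lra. lra. }
    assert (0 <= Cmod (z j)) by apply Cmod_ge_0. lra. }
  assert (Hn0 : forall j, z j <> 0).
  { induction j as [|j IH]; trivial. rewrite Ez. apply (Hb (z j) IH (Hzr j)). }
  assert (Hs : forall j, Cmod (/ z (S j) - / z j - 1) <= (k + Kb) * Cmod (z j)).
  { intros j. rewrite Ez. destruct (Hb (z j) (Hn0 j) (Hzr j)) as [_ H].
    replace (/ p (z j) - / z j - 1)%C with ((/ p (z j) - / z j - 1 - (1 - a) * z j) + (1 - a) * z j)%C by ring.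
    eapply Rle_trans; [eapply Cadd_le; [exact H|eapply Cmul_le; apply Rle_refl]|]. fold k.
    assert (Kb * Cmod (z j) ^ 2 <= Kb * Cmod (z j)).
    { apply Rmult_le_compat_l; [lra|]. specialize (Hz1 j). assert (0 <= Cmod (z j)) by apply Cmod_ge_0. nra. }
    lra. }
  set (y := fun j => (/ z j)%C) in *.
  assert (Hre : forall j, Re (y 0%nat) + 9 / 10 * INR j <= Re (y j)).
  { induction j as [|j IH]; [simpl; lra|]. rewrite S_INR.
    assert (H := Hs j). specialize (Hzk j).
    assert (H2 : Cmod (y (S j) - (y j + 1)) <= / 10).
    { replace (y (S j) - (y j + 1))%C with (/ z (S j) - / z j - 1)%C by (unfold y; ring). lra. }
    apply Re_ge_of_dist in H2. apply Rabs_le_between in H2.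
    replace (Re (y j + 1)%C) with (Re (y j) + 1) in H2 by (simpl; ring). lra. }
  destruct (INR_ge_ev (3 * Rabs (Re (y 0%nat)) + 8)) as [J HJ].
  assert (HzJ : forall j, (J <= j)%nat -> Cmod (z j) <= 2 / INR j).
  { intros j Hj. specialize (HJ j Hj). assert (A0 := Rabs_pos (Re (y 0%nat))).
    assert (A1 := Rle_abs (- Re (y 0%nat))). rewrite Rabs_Ropp in A1.
    assert (A2 := Hre j).
    assert (B : INR j / 2 <= Cmod (y j)).
    { apply Rle_trans with (2 := re_le_Cmod (y j)), Rle_trans with (2 := Rle_abs _). lra. }
    replace (z j) with (/ y j)%C by (unfold y; field; apply Hn0).
    rewrite Cmod_inv by (apply Cmod_gt_0; lra).
    replace (2 / INR j) with (/ (INR j / 2)) by (field; lra). apply Rinv_le_contravar; lra. }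
  set (c4 := 4 * (k + Kb)).
  assert (c40 : 0 < c4) by (unfold c4; lra).
  assert (Hlin : forall i, Cmod (y (J + i)%nat - RtoC (INR (J + i)) - (y J - RtoC (INR J))) <= c4 * (ln (INR (J + i)) - ln (INR J))).
  { induction i as [|i IH].
    - rewrite Nat.add_0_r. replace (_ - _ - _)%C with (RtoC 0) by ring. rewrite Cmod_0. lra.
    - set (j := (J + i)%nat) in *. replace (J + S i)%nat with (S j) by (unfold j; lia).
      replace (y (S j) - RtoC (INR (S j)) - (y J - RtoC (INR J)))%C with
        ((y (S j) - y j - 1) + (y j - RtoC (INR j) - (y J - RtoC (INR J))))%C.
      2:{ rewrite S_INR, RtoC_plus. ring. }
      eapply Rle_trans; [eapply Cadd_le; [exact (Hs j)|exact IH]|].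
      assert (Hj8 := HJ j ltac:(unfold j; lia)). assert (A0 := Rabs_pos (Re (y 0%nat))).
      set (n := INR j) in *. rewrite S_INR. fold n.
      assert (B := ln_succ_bounds n ltac:(lra)). apply Rabs_le_between in B.
      assert (B2 : 4 / n ^ 2 <= / n / 2).
      { apply Rmult_le_reg_r with (2 * n ^ 2); [apply Rmult_lt_0_compat; [lra|apply pow_lt; lra]|].
        replace (4 / n ^ 2 * (2 * n ^ 2)) with 8 by (field; lra).
        replace (/ n / 2 * (2 * n ^ 2)) with n by (field; lra). lra. }
      assert (B3 : (k + Kb) * Cmod (z j) <= (k + Kb) * (2 / n)) by (apply Rmult_le_compat_l; [lra|apply HzJ; unfold j; lia]).
      assert (B5 : (k + Kb) * / n <= (k + Kb) * (2 * (ln (n + 1) - ln n))) by (apply Rmult_le_compat_l; lra).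
      unfold c4, Rdiv in *. lra. }
  set (A := c4 + Cmod (y J - RtoC (INR J))).
  assert (A0 : 0 <= A) by (unfold A; assert (H := Cmod_ge_0 (y J - RtoC (INR J))); lra).
  destruct (big_ev_INR (A ^ 2)) as [N1 HN1].
  destruct (INR_ge_ev (K + 1)) as [N2 HN2].
  set (N3 := (J + N1 + N2)%nat).
  assert (Hsq : forall j, (N3 <= j)%nat -> Cmod (/ z j - RtoC (INR j)) <= sqrt (INR j)).
  { intros j Hj. apply Rle_trans with (2 := @sqrt_ge_of_big A (INR j) A0 (HN1 j ltac:(unfold N3 in *; lia))).
    assert (Hl := Hlin (j - J)%nat). replace (J + (j - J))%nat with j in Hl by (unfold N3 in *; lia).
    assert (J1 : 1 <= INR J) by (specialize (HJ J (le_n J)); assert (H := Rabs_pos (Re (y 0%nat))); lra).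
    assert (L1 := ln_nonneg (INR J) J1).
    assert (L2 : ln (INR J) <= ln (INR j)) by (apply ln_le; [lra|apply le_INR; unfold N3 in *; lia]).
    replace (/ z j - RtoC (INR j))%C with ((y j - RtoC (INR j) - (y J - RtoC (INR J))) + (y J - RtoC (INR J)))%C
      by (unfold y; ring).
    eapply Rle_trans; [eapply Cadd_le; [exact Hl|apply Rle_refl]|]. unfold A.
    assert (H := Cmod_ge_0 (y J - RtoC (INR J))).
    assert (0 <= c4 * ln (INR J)) by (apply Rmult_le_pos; lra).
    assert (0 <= Cmod (y J - RtoC (INR J)) * ln (INR j)) by (apply Rmult_le_pos; lra). lra. }
  set (rho := Cmod (clock_defect a z N3) + K).
  assert (Hdef : forall i, Cmod (clock_defect a z (N3 + i) - clock_defect a z N3) <=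
     K * (/ sqrt (INR N3) - / sqrt (INR (N3 + i)))).
  { induction i as [|i IH].
    - rewrite Nat.add_0_r. replace (_ - _)%C with (RtoC 0) by ring. rewrite Cmod_0. lra.
    - set (j := (N3 + i)%nat) in *. replace (N3 + S i)%nat with (S j) by (unfold j; lia).
      destruct (Hst z j) as [_ H]; trivial.
      + specialize (HN2 j ltac:(unfold j, N3; lia)). lra.
      + apply Hsq. unfold j; lia.
      + eapply Rle_trans; [apply (Cmod_dist_trans _ (clock_defect a z j))|]. lra. }
  destruct (@clock_of_defect p a M r Hr Hp rho) as [N0 HN0].
  exists (clock_defect a z (N3 + N0)), (N3 + N0)%nat.
  apply HN0; [lia|intros; apply Ez|apply Hn0|].
  assert (H := Hdef N0). unfold rho.
  replace (clock_defect a z (N3 + N0)) with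
    (clock_defect a z N3 + (clock_defect a z (N3 + N0) - clock_defect a z N3))%C by ring.
  eapply Rle_trans; [eapply Cadd_le; [apply Rle_refl|exact H]|].
  apply Rplus_le_compat_l.
  assert (n3 : 1 <= INR N3) by (specialize (HN2 N3 ltac:(unfold N3; lia)); lra).
  assert (n4 : 1 <= INR (N3 + N0)) by (specialize (HN2 (N3 + N0)%nat ltac:(unfold N3; lia)); lra).
  assert (s3 : 1 <= sqrt (INR N3)) by (rewrite <- sqrt_1; apply sqrt_le_1_alt; trivial).
  assert (/ sqrt (INR N3) <= 1) by (rewrite <- Rinv_1; apply Rinv_le_contravar; lra).
  assert (0 < / sqrt (INR (N3 + N0))) by (apply Rinv_0_lt_compat, sqrt_lt_R0; lra).
  rewrite <- (Rmult_1_r K) at 2. apply Rmult_le_compat_l; lra.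
Qed.

(** While [|1 / w| <= Y], the ratio [z / w] is at most [2 Y / n] and becomes negligible for late
    times; only the size [om] of [w] remains in the error. *)
Lemma crossing_step_late (q : C -> C -> C) (b : R) (b03 b30 : C) (M r : R) :
  0 < r -> fiber_bound q b b03 b30 M r ->
  exists K r1, 0 < K /\ 0 < r1 <= r /\ forall om Y, 0 < om <= r1 -> 0 < Y -> exists Q, 1 <= Q /\
  forall n (z w : C), Q <= n -> Cmod z <= 2 / n -> w <> 0 -> Cmod w <= om -> Cmod (- / w) <= Y ->
    q z w <> 0 /\ Cmod (- / q z w - - / w - 1) <= K * om.
Proof.
  intros Hr Hq. destruct (@crossing_step q b b03 b30 M r Hr Hq) as (K & r1 & HK & Hr1 & Hst).
  exists (2 * K), (r1 / 2). split; [lra|]. split; [lra|].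
  intros om Y Hom HY.
  assert (io : 0 < / om) by (apply Rinv_0_lt_compat; lra).
  assert (q1 : 0 <= 4 * Y ^ 2 * / om) by (apply Rmult_le_pos; [assert (H := pow2_ge_0 Y); lra|lra]).
  exists (1 + 2 * Y + 4 * Y ^ 2 * / om). split; [lra|].
  intros n z w Hn Hz Hw Hwo HwY.
  assert (w0 : 0 < Cmod w) by (apply Cmod_gt_0; trivial).
  rewrite Cmod_opp, Cmod_inv in HwY by trivial.
  assert (z0 := Cmod_ge_0 z).
  assert (HzY : Cmod z * / Cmod w <= 2 * Y / n).
  { replace (2 * Y / n) with (2 / n * Y) by (field; lra). apply Rmult_le_compat; trivial.
    left; apply Rinv_0_lt_compat; trivial. }
  assert (Hy1 : 2 * Y / n <= 1).
  { apply Rmult_le_reg_r with n; [lra|]. replace (2 * Y / n * n) with (2 * Y) by (field; lra). lra. }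
  destruct (Hst z w Hw) as [H1 H2]; [lra| |].
  { apply Rmult_le_reg_r with (/ Cmod w); [apply Rinv_0_lt_compat; trivial|]. rewrite Rinv_r by lra. lra. }
  split; trivial. apply Rle_trans with (1 := H2).
  assert (Cmod z ^ 2 / Cmod w ^ 2 <= om).
  { replace (Cmod z ^ 2 / Cmod w ^ 2) with ((Cmod z * / Cmod w) ^ 2) by (field; lra).
    apply Rle_trans with ((2 * Y / n) ^ 2).
    - apply pow_incr; split; trivial. apply Rmult_le_pos; trivial. left; apply Rinv_0_lt_compat; trivial.
    - apply Rmult_le_reg_r with (n * / om); [apply Rmult_lt_0_compat; lra|].
      replace (om * (n * / om)) with n by (field; lra).
      replace ((2 * Y / n) ^ 2 * (n * / om)) with (4 * Y ^ 2 * / om * / n) by (field; lra).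
      assert (/ n <= 1) by (rewrite <- Rinv_1; apply Rinv_le_contravar; lra).
      assert (4 * Y ^ 2 * / om * / n <= 4 * Y ^ 2 * / om * 1) by (apply Rmult_le_compat_l; lra). lra. }
  replace (2 * K * om) with (K * (om + om)) by ring. apply Rmult_le_compat_l; lra.
Qed.

(** * Successive visible times *)

Lemma clock_bound (a : C) : forall rho, exists N0 : nat, forall d z m j,
  Cmod d <= rho -> clock a d z m -> (m <= j)%nat -> (N0 <= j)%nat -> Cmod (z j) <= 2 / INR j.
Proof.
  intros rho0. set (rho := Rmax 1 rho0). assert (H1 : 1 <= rho) by apply Rmax_l.
  destruct (clock_step a) as (Kz & HKz & Hcl). destruct (Hcl rho H1) as (Q & HQ & Hs).
  destruct (big_ev_INR Q) as [N HN]. exists N. intros d z m j Hd Hc Hj HNj.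
  destruct (Hs d z m j) as [H _]; trivial.
  - apply Rle_trans with (1 := Hd), Rmax_r.
  - apply HN; trivial.
  - apply Rle_trans with (1 := H). assert (B : 1 <= INR j) by apply (HN j HNj).
    unfold Rdiv. apply Rmult_le_compat_r; [left; apply Rinv_0_lt_compat; lra|lra].
Qed.

(** Discrete intermediate values: the first index at which [f] reaches [x] overshoots by at most one
    step. *)
Lemma sample_exists (f : nat -> R) (T : nat) (x : R) :
  f 0%nat <= x -> x <= f T -> (forall i, (i < T)%nat -> f (S i) <= f i + 3 / 2) ->
  exists t, (t <= T)%nat /\ x <= f t <= x + 3 / 2.
Proof.
  intros H0 HT Hs.
  destruct (@least_after (fun i => x <= f i) 0) as (t & _ & Ht & Hmin).
  { exists T. split; [lia|trivial]. }
  assert (HtT : (t <= T)%nat).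
  { destruct (Nat.le_gt_cases t T) as [H|H]; trivial. exfalso. apply (Hmin T); [lia|trivial]. }
  exists t. split; trivial. split; trivial.
  destruct t as [|t]; [lra|].
  assert (Hl := Hmin t ltac:(lia)). specialize (Hs t ltac:(lia)). apply Rnot_le_lt in Hl. lra.
Qed.

Lemma Cmod_inv_le_of (w : C) (B : R) : w <> 0 -> 0 < B -> B <= Cmod (- / w) -> Cmod w <= / B.
Proof.
  intros Hw HB H. rewrite Cmod_opp, Cmod_inv in H by trivial.
  assert (0 < Cmod w) by (apply Cmod_gt_0; trivial).
  rewrite <- (Rinv_inv (Cmod w)). apply Rinv_le_contravar; trivial.
Qed.

(* In the coordinate [Z = -1/w] the fiber map is close to [Z + 1] away from [w = 0]; the hypothesis
   [Hsz] keeps the orbit in that region. *)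
Lemma crossing_run (q : C -> C -> C) (z w : nat -> C) (m T : nat) (om dl Y Q K : R) :
  (forall j, (m <= j)%nat -> w (S j) = q (z j) (w j)) ->
  (forall j, (m <= j)%nat -> Q <= INR j /\ Cmod (z j) <= 2 / INR j) ->
  (forall n (u v : C), Q <= n -> Cmod u <= 2 / n -> v <> 0 -> Cmod v <= om -> Cmod (- / v) <= Y ->
    q u v <> 0 /\ Cmod (- / q u v - - / v - 1) <= K * om) ->
  K * om <= dl -> w m <> 0 ->
  (forall i, (i < T)%nat -> w (m + i)%nat <> 0 ->
     Cmod (- / w (m + i)%nat - - / w m - RtoC (INR i)) <= INR i * dl ->
     Cmod (w (m + i)%nat) <= om /\ Cmod (- / w (m + i)%nat) <= Y) ->
  forall i, (i <= T)%nat -> w (m + i)%nat <> 0 /\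
    Cmod (- / w (m + i)%nat - - / w m - RtoC (INR i)) <= INR i * dl /\
    ((i < T)%nat -> Cmod (- / w (S (m + i)) - - / w (m + i)%nat - 1) <= dl).
Proof.
  intros Horb Hz Hst Hdl Hw0 Hsz.
  assert (Hmain : forall i, (i <= T)%nat -> w (m + i)%nat <> 0 /\
    Cmod (- / w (m + i)%nat - - / w m - RtoC (INR i)) <= INR i * dl).
  { induction i as [|i IH]; intros Hi.
    - rewrite Nat.add_0_r. split; trivial. simpl INR.
      replace (_ - _ - _)%C with (RtoC 0) by ring. rewrite Cmod_0. lra.
    - destruct (IH ltac:(lia)) as [W0 HZ]. replace (m + S i)%nat with (S (m + i)) by lia.
      destruct (Hsz i ltac:(lia) W0 HZ) as [S1 S2]. destruct (Hz (m + i)%nat ltac:(lia)) as [Z1 Z2].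
      destruct (Hst _ _ _ Z1 Z2 W0 S1 S2) as [H1 H2].
      rewrite <- Horb in H1, H2 by lia. split; trivial. rewrite S_INR.
      replace (- / w (S (m + i)) - - / w m - RtoC (INR i + 1))%C with
        ((- / w (S (m + i)) - - / w (m + i)%nat - 1) + (- / w (m + i)%nat - - / w m - RtoC (INR i)))%C
        by (rewrite RtoC_plus; ring).
      eapply Rle_trans; [eapply Cadd_le; [exact H2|exact HZ]|]. lra. }
  intros i Hi. destruct (Hmain i Hi) as [W0 HZ]. split; trivial. split; trivial. intros HiT.
  destruct (Hsz i HiT W0 HZ) as [S1 S2]. destruct (Hz (m + i)%nat ltac:(lia)) as [Z1 Z2].
  destruct (Hst _ _ _ Z1 Z2 W0 S1 S2) as [H1 H2]. rewrite <- Horb in H2 by lia. lra.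
Qed.

Lemma Re_Im_of_run (u v : C) (x e : R) : Cmod (u - v - RtoC x) <= e ->
  Rabs (Re u - Re v - x) <= e /\ Rabs (Im u - Im v) <= e.
Proof.
  intros H.
  assert (A1 := re_le_Cmod (u - v - RtoC x)). assert (A2 := Im_le_Cmod (u - v - RtoC x)).
  replace (Re (u - v - RtoC x)%C) with (Re u - Re v - x) in A1
    by (unfold Re, Cminus, Cplus, Copp; simpl; ring).
  replace (Im (u - v - RtoC x)%C) with (Im u - Im v) in A2
    by (unfold Im, Cminus, Cplus, Copp; simpl; ring). split; lra.
Qed.

(** From a visible time, [Z] drifts to the right and within bounded time reaches the entrance of the
    gate at [Re Z] about [rho]; [transit] takes it to [Re Z] about [- rho], where it is visible at a
    smaller scale. As [rho] is fixed once [eps] and [d] are known, whatever depends on it may go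
    into [D] and [eps']. *)
Lemma passage (p : C -> C) (q : C -> C -> C) (a b03 b30 : C) (th b c M r : R) :
  0 < r -> 0 < c -> b = 1 / 4 + c ^ 2 -> a = (b03 + RtoC th)%C ->
  base_bound p a M r -> fiber_bound q b b03 b30 M r ->
  let al := exp (PI / c) in
  exists r0, 0 < r0 /\ forall z w : nat -> C, orbit_from p q z w 0 ->
    (forall j, Cmod (z j) < r0 /\ Cmod (w j) < r0) -> z 0%nat <> 0 ->
    forall eps, 0 < eps -> exists eps' D (N0 : nat), 0 < eps' /\ forall n, (N0 <= n)%nat -> eps <= Cmod (w n) ->
      (exists n', eps' <= Cmod (w n') /\
         Rabs (INR n' - al * INR n - th * (1 - al) * ln (INR n)) <= D) /\
      (forall n', INR n + D <= INR n' -> eps <= Cmod (w n') ->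
         al * INR n + th * (1 - al) * ln (INR n) - D <= INR n').
Proof.
  intros Hr Hc Hb Ha Hp Hq al.
  assert (al0 : 0 < al) by apply exp_pos.
  destruct (@crossing_step_late q b b03 b30 M r Hr Hq) as (K & r1 & HK & Hr1 & Hcross).
  destruct (@transit p q a b03 b30 th b c M r Hr Hc Hb Ha Hp Hq) as (Kt & rho0 & HKt & Hrho0 & Htr).
  destruct (@clock_exists p a M r Hr Hp) as (r2 & Hr2 & Hclk).
  fold al in Htr.
  set (r0 := Rmin r1 (Rmin r2 (/ (4 * K)))).
  assert (i4 : 0 < / (4 * K)) by (apply Rinv_0_lt_compat; lra).
  assert (r00 : 0 < r0) by (repeat apply Rmin_glb_lt; lra).
  assert (r01 : r0 <= r1) by apply Rmin_l.
  assert (r02 : r0 <= r2) by (apply Rle_trans with (1 := Rmin_r _ _), Rmin_l).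
  assert (r0K : K * r0 <= 1 / 4).
  { apply Rle_trans with (K * / (4 * K)); [|right; field; lra]. apply Rmult_le_compat_l; [lra|].
    apply Rle_trans with (1 := Rmin_r _ _), Rmin_r. }
  exists r0. split; trivial. intros z w Horb Hsmall Hz0 eps Heps.
  destruct (Hclk z) as (d & N & Hcl); trivial.
  { intros j. apply (Horb j). lia. }
  { intros j. destruct (Hsmall j). lra. }
  (* The summand [2 * Kt / eps] makes [|w| < eps] throughout the gate, so no visible time falls
     there; [20 / eps] puts the visible points deep inside the radius [rho]. *)
  set (rho := rho0 + Cmod d + 20 / eps + 20 + 2 * Kt / eps).
  assert (ie : 0 < / eps) by (apply Rinv_0_lt_compat; trivial).
  assert (d0 := Cmod_ge_0 d).
  assert (Kte : 0 <= 2 * Kt / eps) by (unfold Rdiv; apply Rmult_le_pos; lra).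
  assert (Hrho : rho0 <= rho) by (unfold rho; lra).
  assert (rhoe : 20 * / eps <= rho) by (unfold rho, Rdiv in *; lra).
  assert (Hdr : Cmod d <= rho) by (unfold rho; lra).
  assert (Ktr : Kt / rho < eps).
  { apply Rmult_lt_reg_r with (rho * / eps); [apply Rmult_lt_0_compat; lra|].
    replace (Kt / rho * (rho * / eps)) with (Kt / eps) by (field; lra).
    replace (eps * (rho * / eps)) with rho by (field; lra). unfold rho, Rdiv in *.
    assert (0 < Kt * / eps) by (apply Rmult_lt_0_compat; lra). lra. }
  destruct (Htr rho Hrho) as (Qt & HQt & Htrans).
  destruct (Hcross r0 (6 * rho) ltac:(lra) ltac:(lra)) as (Qc & HQc & Hcst).
  destruct (@clock_bound a rho) as [Nb HNb].
  destruct (big_ev_INR (Qt + Qc)) as [Nq HNq].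
  set (KL := Kt * (1 + ln rho)).
  assert (lr : 0 <= ln rho) by (apply ln_nonneg; lra).
  assert (KL0 : 0 <= KL) by (unfold KL; apply Rmult_le_pos; lra).
  set (Cz := rho + al * (rho + rho) + KL).
  assert (alr : 0 <= al * rho) by (apply Rmult_le_pos; lra).
  set (D := (rho + 1) + rho + al * (3 * rho + rho) + KL + (3 * rho) * al + Rabs (th * (1 - al)) * (3 * rho) + 4 * rho).
  assert (t0 := Rabs_pos (th * (1 - al))).
  assert (tr0 : 0 <= Rabs (th * (1 - al)) * (3 * rho)) by (apply Rmult_le_pos; lra).
  exists (/ (rho + 1 + Cz)), D, (N + Nb + Nq)%nat.
  split; [apply Rinv_0_lt_compat; unfold Cz; lra|].
  intros n Hn Hvis.
  set (Z := fun j => (- / w j)%C).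
  assert (w0 : w n <> 0) by (apply Cmod_gt_0; lra).
  assert (HZn : Cmod (Z n) <= / eps).
  { unfold Z. rewrite Cmod_opp, Cmod_inv by trivial. apply Rinv_le_contravar; trivial. }
  (* [Re Z] starts above [- rho / 20] and gains at least [3 / 4] per step, so about [3 * rho] steps
     are enough to reach [rho]. *)
  destruct (nfloor_ex (3 * rho)) as [T HT]; [lra|].
  assert (Hrun : forall i, (i <= T)%nat -> w (n + i)%nat <> 0 /\
     Cmod (Z (n + i)%nat - Z n - RtoC (INR i)) <= INR i * (1 / 4) /\
     ((i < T)%nat -> Cmod (Z (S (n + i)) - Z (n + i)%nat - 1) <= 1 / 4)).
  { apply (@crossing_run q z w n T r0 (1 / 4) (6 * rho) Qc K); trivial.
    - intros j Hj. apply (Horb j). lia.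
    - intros j Hj. split; [|apply (HNb d z N j); trivial; lia].
      assert (B := HNq j ltac:(lia)). apply big_ge in B; lra.
    - intros i Hi W0 HZ. split; [left; apply (Hsmall (n + i)%nat)|].
      assert (iT : INR i <= INR T) by (apply le_INR; lia).
      change (Cmod (Z (n + i)%nat) <= 6 * rho). change (Cmod (Z (n + i)%nat - Z n - RtoC (INR i)) <= INR i * (1 / 4)) in HZ.
      replace (Z (n + i)%nat) with ((Z (n + i)%nat - Z n - RtoC (INR i)) + Z n + RtoC (INR i))%C by ring.
      eapply Rle_trans; [eapply Cadd_le; [eapply Cadd_le; [exact HZ|exact HZn]|rewrite Cmod_RtoC_pos by apply pos_INR; apply Rle_refl]|].
      lra. }
  assert (Rn := re_le_Cmod (Z n)). assert (In := Im_le_Cmod (Z n)).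
  apply Rabs_le_between in Rn. apply Rabs_le_between in In.
  destruct (@sample_exists (fun i => Re (Z (n + i)%nat)) T rho) as (i & HiT & HiR).
  { rewrite Nat.add_0_r. lra. }
  { destruct (Hrun T (le_n T)) as (_ & H & _). apply Re_Im_of_run in H. destruct H as [H _].
    apply Rabs_le_between in H. lra. }
  { intros i Hi. destruct (Hrun i ltac:(lia)) as (_ & _ & H). specialize (H Hi).
    apply (Re_Im_of_run _ _ 1) in H. destruct H as [H _]. apply Rabs_le_between in H.
    replace (n + S i)%nat with (S (n + i)) by lia. lra. }
  set (m := (n + i)%nat) in *.
  destruct (Hrun i HiT) as (Wm & HIm & _). apply Re_Im_of_run in HIm. destruct HIm as [_ HIm]. fold m in HIm, Wm.
  assert (iT : INR i <= INR T) by (apply le_INR; lia). assert (i0 := pos_INR i).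
  apply Rabs_le_between in HIm.
  assert (HIm2 : Rabs (Im (Z m)) <= rho) by (apply Rabs_le; lra).
  destruct (Htrans d z w m) as (e & Hme & We & HRe2 & Hform & Hinv); trivial.
  { intros j Hj. apply Horb. lia. }
  { intros j Hj. apply Hcl. unfold m in Hj; lia. }
  { intros j Hj. apply big_mono with (Qt + Qc); [lra|]. apply HNq. unfold m in Hj; lia. }
  { change (rho - 1 <= Re (Z m) <= rho + 3). lra. }
  change (- / w e)%C with (Z e) in *. change (- / w m)%C with (Z m) in *.
  fold KL in Hform.
  set (x := INR e - al * INR m - th * (1 - al) * ln (INR m)) in *.
  assert (Dd := re_le_Cmod d). assert (Di := Im_le_Cmod d). apply Rabs_le_between in Dd. apply Rabs_le_between in Di.
  assert (F1 := re_le_Cmod (Z e - d - RtoC al * (Z m - d) - RtoC x)).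
  assert (F2 := Im_le_Cmod (Z e - d - RtoC al * (Z m - d) - RtoC x)).
  replace (Re (Z e - d - RtoC al * (Z m - d) - RtoC x)%C) with (Re (Z e) - Re d - al * (Re (Z m) - Re d) - x) in F1
    by (unfold Re, Cminus, Cplus, Copp, Cmult; simpl; ring).
  replace (Im (Z e - d - RtoC al * (Z m - d) - RtoC x)%C) with (Im (Z e) - Im d - al * (Im (Z m) - Im d)) in F2
    by (unfold Im, Cminus, Cplus, Copp, Cmult; simpl; ring).
  apply Rabs_le_between in F1. apply Rabs_le_between in F2.
  assert (G1 : Rabs (al * (Re (Z m) - Re d)) <= al * (3 * rho + rho)).
  { rewrite Rabs_mult, (Rabs_pos_eq al) by lra. apply Rmult_le_compat_l; [lra|]. apply Rabs_le; lra. }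
  assert (G2 : Rabs (al * (Im (Z m) - Im d)) <= al * (rho + rho)).
  { rewrite Rabs_mult, (Rabs_pos_eq al) by lra. apply Rmult_le_compat_l; [lra|].
    apply Rabs_le_between in HIm2. apply Rabs_le; lra. }
  apply Rabs_le_between in G1. apply Rabs_le_between in G2.
  assert (n1 : 1 <= INR n).
  { assert (B := HNq n ltac:(lia)). apply B. }
  assert (Em : INR m = INR n + INR i) by (unfold m; apply plus_INR).
  assert (Hln : 0 <= ln (INR m) - ln (INR n) <= 3 * rho).
  { split.
    - assert (ln (INR n) <= ln (INR m)) by (apply ln_le; lra). lra.
    - assert (E := exp_ineq1_le (INR i)).
      assert (ln (INR m) <= ln (INR n * exp (INR i))).
      { apply ln_le; [lra|]. rewrite Em. clear - n1 E i0. nra. }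
      rewrite ln_mult, ln_exp in H by (try apply exp_pos; lra). lra. }
  assert (Hx : Rabs (INR e - al * INR n - th * (1 - al) * ln (INR n)) <= D - 4 * rho).
  { replace (INR e - al * INR n - th * (1 - al) * ln (INR n)) with
      (x + al * INR i + th * (1 - al) * (ln (INR m) - ln (INR n))) by (unfold x; rewrite Em; ring).
    assert (A1 : Rabs (th * (1 - al) * (ln (INR m) - ln (INR n))) <= Rabs (th * (1 - al)) * (3 * rho)).
    { rewrite Rabs_mult. apply Rmult_le_compat_l; trivial. apply Rabs_le; lra. }
    assert (A2 : 0 <= al * INR i <= (3 * rho) * al).
    { split; [apply Rmult_le_pos; lra|]. rewrite (Rmult_comm (3 * rho)). apply Rmult_le_compat_l; lra. }
    apply Rabs_le_between in A1. unfold D. apply Rabs_le; lra. }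
  split.
  - exists e. split.
    + assert (B : Cmod (Z e) <= rho + 1 + Cz).
      { eapply Rle_trans; [apply Cmod_le_Re_Im|].
        apply Rplus_le_compat; [apply Rabs_le; lra|unfold Cz; apply Rabs_le; lra]. }
      unfold Z in B. rewrite Cmod_opp, Cmod_inv in B by trivial.
      assert (we0 : 0 < Cmod (w e)) by (apply Cmod_gt_0; trivial).
      rewrite <- (Rinv_inv (Cmod (w e))). apply Rinv_le_contravar; trivial. apply Rinv_0_lt_compat; trivial.
    + apply Rle_trans with (1 := Hx). lra.
  - intros n' Hn' Hvis'. apply Rabs_le_between in Hx.
    destruct (Nat.le_gt_cases n' e) as [Hle|Hgt].
    (* [D] exceeds the time needed to enter the gate, and the orbit is invisible between [m] and
       [e]. *)
    + exfalso. assert (Hmn : (m <= n')%nat).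
      { apply INR_le. rewrite Em. unfold D in Hn'. lra. }
      specialize (Hinv n' (conj Hmn Hle)). lra.
    + apply lt_INR in Hgt. lra.
Qed.

(** * Shooting *)

(* An orbit whose height leaves the strip [|h| <= th] on the side [sg]. *)
Inductive fate (st : nat -> Prop) (h : nat -> R) (link : nat -> nat -> Prop) (th sg : R) : nat -> Prop :=
| fate_now j : st j -> th < sg * h j -> fate st h link th sg j
| fate_later j j1 : st j -> Rabs (h j) < th + 2 -> link j j1 -> fate st h link th sg j1 ->
    fate st h link th sg j.

Lemma fate_st st h link th sg j : fate st h link th sg j -> st j.
Proof. intros [? H _|? ? H]; exact H. Qed.

Lemma interval_connected (l u : R) (A B : R -> Prop) :
  l <= u -> A l -> B u ->
  (forall y, A y -> exists d, 0 < d /\ forall y', Rabs (y' - y) < d -> A y') ->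
  (forall y, B y -> exists d, 0 < d /\ forall y', Rabs (y' - y) < d -> B y') ->
  (forall y, A y -> B y -> False) ->
  exists y, l <= y <= u /\ ~ A y /\ ~ B y.
Proof.
  intros Hlu HA HB OA OB Hd.
  destruct (completeness (fun y => l <= y <= u /\ A y)) as [s [Hub Hlub]].
  - exists u. intros y [Hy _]. lra.
  - exists l. split; [lra|trivial].
  - assert (Hs1 : l <= s) by (apply Hub; split; [lra|trivial]).
    assert (Hs2 : s <= u) by (apply Hlub; intros y [Hy _]; lra).
    exists s. split; [lra|]. split; intros H.
    + destruct (OA s H) as (d & Hd0 & HdA).
      destruct (Rle_lt_or_eq_dec s u Hs2) as [Hlt|Heq]; [|apply (Hd u); [rewrite <- Heq; exact H|exact HB]].
      set (y := s + Rmin (d / 2) (u - s)).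
      assert (M0 : 0 < Rmin (d / 2) (u - s)) by (apply Rmin_glb_lt; lra).
      assert (M1 := Rmin_l (d / 2) (u - s)). assert (M2 := Rmin_r (d / 2) (u - s)).
      assert (y <= s); [|unfold y in *; lra].
      apply Hub. split; [unfold y; lra|]. apply HdA. unfold y. rewrite Rabs_pos_eq; lra.
    + destruct (OB s H) as (d & Hd0 & HdB).
      assert (s <= s - d); [|lra]. apply Hlub. intros y [Hy HAy].
      destruct (Rle_lt_dec y (s - d)) as [Hle|Hgt]; trivial. exfalso.
      apply (Hd y HAy). apply HdB. assert (y <= s) by (apply Hub; split; trivial).
      apply Rabs_def1; lra.
Qed.

(* Heights relative to the fixed one are multiplied by [al > 1] at each passage, up to bounded
   errors: an orbit leaving the strip on one side never comes back to the other, so the initial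
   heights whose orbits leave upwards and downwards form disjoint open sets. *)
Lemma shooting (st : R -> nat -> Prop) (h : R -> nat -> R) (link near : nat -> nat -> Prop)
    (nx : R -> nat -> nat -> Prop) (al th E : R) (N : nat) :
  1 < th -> 1 < al -> th + 4 + E <= al * (th - 1) ->
  (forall y j e, st y j -> 0 < e -> exists d, 0 < d /\
     forall y', Rabs (y' - y) < d -> st y' j /\ Rabs (h y' j - h y j) < e) ->
  (forall y j, st y j -> Rabs (h y j) <= th + 2 -> exists j', nx y j j') ->
  (forall y j j', nx y j j' -> (j < j')%nat /\ st y j' /\ link j j' /\ Rabs (h y j' - al * h y j) <= E) ->
  (forall j, near j j) ->
  (forall y j j', st y j -> st y j' -> near j j' -> Rabs (h y j - h y j') <= 1) ->
  (forall y j j' j1 j1', near j j' -> link j j1 -> link j' j1' -> st y j1 -> st y j1' -> near j1 j1') ->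
  (forall y, - th - 1 <= y <= th + 1 -> st y N /\ h y N = y) ->
  exists y, - th - 1 <= y <= th + 1 /\ forall Q : nat -> Prop,
    Q N -> (forall j j', Q j -> nx y j j' -> Q j') ->
    forall k, exists j, (N + k <= j)%nat /\ Q j /\ st y j /\ Rabs (h y j) <= th.
Proof.
  intros Hth Hal HE Hopen Hnext Hnx Hrefl Hclose Hnear Hinit.
  set (F := fun sg y j => fate (st y) (h y) link th sg j).
  (* A fate is witnessed by finitely many samples subject to strict inequalities, and [link] does
     not depend on the parameter [y]. Hence openness, by induction on the witness. *)
  assert (Fopen : forall sg y j, Rabs sg = 1 -> F sg y j -> exists d, 0 < d /\
     forall y', Rabs (y' - y) < d -> F sg y' j).
  { intros sg y j Hsg HF. induction HF as [j Hst Hj|j j1 Hst Hj Hl HF IH].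
    - destruct (Hopen y j (sg * h y j - th) Hst ltac:(lra)) as (d & Hd & H).
      exists d. split; trivial. intros y' Hy'. destruct (H y' Hy') as [H1 H2].
      apply fate_now; trivial.
      assert (Rabs (sg * (h y' j - h y j)) < sg * h y j - th) by (rewrite Rabs_mult, Hsg; lra).
      apply Rabs_def2 in H0. lra.
    - destruct IH as (d1 & Hd1 & H1).
      destruct (Hopen y j (th + 2 - Rabs (h y j)) Hst ltac:(lra)) as (d & Hd & H).
      exists (Rmin d d1). split; [apply Rmin_glb_lt; trivial|]. intros y' Hy'.
      destruct (H y') as [A1 A2]; [apply Rlt_le_trans with (1 := Hy'), Rmin_l|].
      apply fate_later with j1; trivial.
      + replace (h y' j) with (h y j + (h y' j - h y j)) by ring.
        eapply Rle_lt_trans; [apply Rabs_triang|]. lra.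
      + apply H1. apply Rlt_le_trans with (1 := Hy'), Rmin_r. }
  (* Samples are not unique, so opposite escapes are compared through [near] ones. A sample near one
     beyond [th] has height at least [th - 1] on that side; one more passage sends it to at least
     [th + 3], where neither constructor of the opposite fate applies. *)
  assert (Fesc : forall sg y j j', Rabs sg = 1 -> st y j -> th < sg * h y j -> near j j' -> F (- sg) y j' -> False).
  { intros sg y j j' Hsg Hst Hj Hn HF.
    assert (Hst' := fate_st _ _ _ _ _ _ HF).
    assert (Hc := Hclose y j j' Hst Hst' Hn).
    assert (Hc2 : Rabs (sg * (h y j - h y j')) <= 1) by (rewrite Rabs_mult, Hsg; lra).
    apply Rabs_le_between in Hc2.
    destruct HF as [j' _ Hj'|j' j1 _ Hj' Hl HF]; [lra|].
    destruct (Hnext y j' Hst' ltac:(lra)) as [j2 Hj2].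
    destruct (Hnx y j' j2 Hj2) as (_ & Hst2 & Hl2 & HE2).
    assert (Hst1 := fate_st _ _ _ _ _ _ HF).
    assert (Hc3 := Hclose y j1 j2 Hst1 Hst2 (Hnear y j' j' j1 j2 (Hrefl j') Hl Hl2 Hst1 Hst2)).
    assert (Hc4 : Rabs (sg * (h y j1 - h y j2)) <= 1) by (rewrite Rabs_mult, Hsg; lra).
    assert (HE3 : Rabs (sg * (h y j2 - al * h y j')) <= E) by (rewrite Rabs_mult, Hsg; lra).
    apply Rabs_le_between in Hc4. apply Rabs_le_between in HE3.
    assert (G : al * (th - 1) <= al * (sg * h y j')) by (apply Rmult_le_compat_l; lra).
    destruct HF as [j1 _ H1|j1 j3 _ H1 _ _]; [lra|].
    assert (Rabs (sg * h y j1) < th + 2) by (rewrite Rabs_mult, Hsg; lra).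
    apply Rabs_def2 in H. lra. }
  (* Both witnesses are followed in parallel: [link] keeps their samples [near] until one of them
     escapes. *)
  assert (Fdisj : forall y j, F 1 y j -> forall j', near j' j -> near j j' -> F (-1) y j' -> False).
  { intros y j HF. induction HF as [j Hst Hj|j j1 Hst Hj Hl HF IH]; intros j' Hn' Hn HF'.
    - apply (Fesc 1 y j j'); trivial. rewrite Rabs_R1; trivial.
    - destruct HF' as [j' Hst' Hj'|j' j1' Hst' Hj' Hl' HF'].
      + apply (Fesc (-1) y j' j); trivial.
        * rewrite Rabs_left; lra.
        * replace (- -1) with 1 by lra. apply fate_later with j1; trivial.
      + assert (H1 := fate_st _ _ _ _ _ _ HF). assert (H1' := fate_st _ _ _ _ _ _ HF').
        exact (IH j1' (Hnear y j' j j1' j1 Hn' Hl' Hl H1' H1) (Hnear y j j' j1 j1' Hn Hl Hl' H1 H1') HF'). }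
  destruct (@interval_connected (- th - 1) (th + 1) (fun y => F (-1) y N) (fun y => F 1 y N))
    as (y & Hy & HnA & HnB).
  - lra.
  - destruct (Hinit (- th - 1) ltac:(lra)) as [H1 H2]. apply fate_now; trivial. rewrite H2. lra.
  - destruct (Hinit (th + 1) ltac:(lra)) as [H1 H2]. apply fate_now; trivial. rewrite H2. lra.
  - intros y. apply Fopen. rewrite Rabs_left; lra.
  - intros y. apply Fopen. rewrite Rabs_R1; trivial.
  - intros y HA HB. apply (Fdisj y N HB N); trivial.
  - exists y. split; trivial. intros Q HQ0 HQs.
    (* For a parameter in neither set, each sample lies in the strip by [fate_now], and the next
       sample has no fate either, since [fate_later] would hand it back. *)
    assert (inv : forall k, exists j, (N + k <= j)%nat /\ Q j /\ st y j /\ ~ F 1 y j /\ ~ F (-1) y j).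
    { assert (small : forall j, st y j -> ~ F 1 y j -> ~ F (-1) y j -> Rabs (h y j) <= th).
      { intros j Hst H1 H2. apply Rabs_le. split.
        - apply Rnot_lt_le. intros H. apply H2. apply fate_now; trivial. lra.
        - apply Rnot_lt_le. intros H. apply H1. apply fate_now; trivial. lra. }
      induction k as [|k (j & Hj & HQ & Hst & H1 & H2)].
      - exists N. split; [lia|]. split; trivial. split; [apply Hinit; trivial|]. split; trivial.
      - assert (Hs := small j Hst H1 H2).
        destruct (Hnext y j Hst ltac:(lra)) as [j' Hj'].
        destruct (Hnx y j j' Hj') as (Hlt & Hst' & Hl & _).
        exists j'. split; [lia|]. split; [apply (HQs j j'); trivial|]. split; trivial.
        split; intros HF; [apply H1|apply H2]; apply fate_later with j'; trivial; lra. }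
    intros k. destruct (inv k) as (j & Hj & HQ & Hst & H1 & H2).
    exists j. split; [trivial|]. split; [trivial|]. split; [trivial|].
    apply Rabs_le. split.
    + apply Rnot_lt_le. intros H. apply H2. apply fate_now; trivial. lra.
    + apply Rnot_lt_le. intros H. apply H1. apply fate_now; trivial. lra.
Qed.

(** * An orbit that returns infinitely often *)

(** [Z] moves right by 1 per step up to [1 / 10] and the window has width 4, which leaves room for
    fewer than 5 steps and a change of height below 1. The bound [E3] on the elapsed time keeps [Z]
    in the range where the translation estimate holds. *)
Lemma sample_unique (p : C -> C) (q : C -> C -> C) (a b03 b30 : C) (b M r : R) :
  0 < r -> base_bound p a M r -> fiber_bound q b b03 b30 M r ->
  exists H0, forall H E3, H0 <= H -> exists N0 : nat, forall z w m,
    orbit_from p q z w m -> clock a (0, H)%R z m -> (N0 <= m)%nat ->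
    forall j1 j2, (m <= j1)%nat -> (j1 <= j2)%nat -> w j1 <> 0 ->
      4 * H - 1 <= Re (- / w j1)%C <= 4 * H + 3 -> Rabs (Im (- / w j1)%C - H) <= H / 2 ->
      Re (- / w j2)%C <= 4 * H + 3 -> INR j2 <= INR j1 + E3 ->
      (j2 <= j1 + 5)%nat /\ Rabs (Im (- / w j1)%C - Im (- / w j2)%C) <= 1.
Proof.
  intros Hr Hp Hq.
  destruct (@crossing_step_late q b b03 b30 M r Hr Hq) as (K & r1 & HK & Hr1 & Hcross).
  assert (i1 : 0 < / r1) by (apply Rinv_0_lt_compat; lra).
  exists (1 + / r1 + 10 * K). intros H E3 HH.
  assert (iH : 0 < / H) by (apply Rinv_0_lt_compat; lra).
  set (Y := 10 * H + 10 + 3 * Rabs E3).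
  assert (E30 := Rabs_pos E3). assert (E31 := Rle_abs E3).
  destruct (Hcross (/ H) Y) as (Q & HQ & Hst).
  { split; trivial. rewrite <- (Rinv_inv r1). apply Rinv_le_contravar; lra. }
  { unfold Y; lra. }
  destruct (@clock_bound a H) as [Nb HNb]. destruct (INR_ge_ev Q) as [Nq HNq].
  exists (Nb + Nq)%nat. intros z w m Horb Hcl HN j1 j2 Hj1 Hj12 Hw HR HI HR2 HE.
  assert (MH : Cmod (0, H)%R <= H).
  { eapply Rle_trans; [apply Cmod_le_Re_Im|]. simpl. rewrite Rabs_R0, Rabs_pos_eq; lra. }
  assert (KH : K * / H <= 1 / 10).
  { apply Rmult_le_reg_r with H; [lra|]. rewrite Rmult_assoc, Rinv_l by lra. lra. }
  set (T := (j2 - j1)%nat).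
  assert (ET : INR T = INR j2 - INR j1) by (apply minus_INR; trivial).
  apply Rabs_le_between in HI.
  assert (Hrun := @crossing_run q z w j1 T (/ H) (1 / 10) Y Q K).
  destruct (Hrun) with (i := T) as (_ & HT & _); trivial.
  - intros j Hj. apply Horb. lia.
  - intros j Hj. split; [apply HNq; lia|]. apply (HNb (0, H)%R z m j); trivial; lia.
  - intros i Hi W0 HZ.
    destruct (Re_Im_of_run _ _ _ _ HZ) as [A1 A2]. apply Rabs_le_between in A1. apply Rabs_le_between in A2.
    assert (iT : INR i <= INR T) by (apply le_INR; lia).
    split.
    + apply Cmod_inv_le_of; trivial; [lra|].
      apply Rle_trans with (2 := re_le_Cmod _), Rle_trans with (2 := Rle_abs _). lra.
    + eapply Rle_trans; [apply Cmod_le_Re_Im|]. rewrite Rabs_pos_eq by lra.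
      assert (Rabs (Im (- / w (j1 + i)%nat)%C) <= 2 * H + INR i) by (apply Rabs_le; lra). unfold Y. lra.
  - replace (j1 + T)%nat with j2 in HT by (unfold T; lia).
    destruct (Re_Im_of_run _ _ _ _ HT) as [A1 A2]. apply Rabs_le_between in A1. apply Rabs_le_between in A2.
    split.
    + assert (T < 5)%nat by (apply INR_lt; simpl; lra). unfold T in *; lia.
    + apply Rabs_le; lra.
Qed.

(** [transit] is used with [rho = 4 H]. The orbit leaves the gate at [Re Z] near [- 4 H] and at a
    height within [3 H / 8] of [H], so on its way to [Re Z = 4 H] it passes over the origin with
    [Im Z >= H / 2] and [w] stays small. The height error of the whole round is [O(1 + ln H)]. *)
Lemma next_sample (p : C -> C) (q : C -> C -> C) (a b03 b30 : C) (th b c M r : R) :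
  0 < r -> 0 < c -> b = 1 / 4 + c ^ 2 -> a = (b03 + RtoC th)%C ->
  base_bound p a M r -> fiber_bound q b b03 b30 M r ->
  let al := exp (PI / c) in
  exists E0 H0, 1 <= E0 /\ 1 <= H0 /\ forall H, H0 <= H -> exists E2 (N0 : nat), 0 <= E2 /\ forall z w m,
    orbit_from p q z w m -> clock a (0, H)%R z m -> (N0 <= m)%nat ->
    forall j, (m <= j)%nat -> w j <> 0 -> 4 * H - 1 <= Re (- / w j)%C <= 4 * H + 3 ->
      Rabs (Im (- / w j)%C - H) <= H / (4 * (al + 1)) ->
      exists j', (j < j')%nat /\ w j' <> 0 /\ 4 * H <= Re (- / w j')%C <= 4 * H + 2 /\
        Rabs ((Im (- / w j')%C - H) - al * (Im (- / w j)%C - H)) <= E0 * (1 + ln H) /\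
        Rabs (INR j' - al * INR j - th * (1 - al) * ln (INR j)) <= E2 /\
        (forall i, (j <= i <= j')%nat -> Cmod (w i) <= E0 / H).
Proof.
  intros Hr Hc Hb Ha Hp Hq al.
  assert (al0 : 0 < al) by apply exp_pos.
  destruct (@crossing_step_late q b b03 b30 M r Hr Hq) as (K & r1 & HK & Hr1 & Hcross).
  destruct (@transit p q a b03 b30 th b c M r Hr Hc Hb Ha Hp Hq) as (Kt & rho0 & HKt & Hrho0 & Htr).
  fold al in Htr.
  assert (i1 : 0 < / r1) by (apply Rinv_0_lt_compat; lra).
  destruct (big_ev (24 * Kt)) as [Hb0 HHb].
  exists (3 * Kt + 24 * K + 2), (Rmax Hb0 (1 + rho0 + 2 / r1 + 400 * K)).
  split; [lra|]. split; [apply Rle_trans with (2 := Rmax_r _ _); lra|].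
  intros H HH.
  assert (HHb' : big (24 * Kt) H) by (apply HHb, Rle_trans with (2 := HH), Rmax_l).
  assert (HH' : 1 + rho0 + 2 / r1 + 400 * K <= H) by (apply Rle_trans with (2 := HH), Rmax_r).
  assert (H1 : 1 <= H) by lra.
  assert (lH := ln_nonneg H H1).
  assert (HKt' := @big_lin (24 * Kt) H ltac:(lra) HHb').
  assert (l4 : ln (4 * H) <= 2 + ln H).
  { rewrite ln_mult by lra. assert (E := exp_ineq1_le 1).
    assert (ln 4 <= 2); [|lra]. rewrite <- (ln_exp 2). apply ln_le; [lra|].
    replace 2 with (1 + 1) by ring. rewrite exp_plus. assert (X := exp_ineq1_le 1). nra. }
  set (KL := Kt * (1 + ln (4 * H))).
  assert (KL0 : 0 <= KL) by (unfold KL; apply Rmult_le_pos; [lra|]; assert (0 <= ln (4 * H)) by (apply ln_nonneg; lra); lra).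
  assert (HKL : KL <= 3 * Kt * (1 + ln H)).
  { unfold KL. replace (3 * Kt * (1 + ln H)) with (Kt * (3 * (1 + ln H))) by ring.
    apply Rmult_le_compat_l; lra. }
  destruct (Htr (4 * H) ltac:(lra)) as (Qt & HQt & Htrans).
  assert (i2 : 0 < 2 / H) by (apply Rdiv_lt_0_compat; lra).
  (* During the return [|w| <= 2 / H], so a step errs by at most [2 K / H]; the at most [12 H] steps
     lose no more than [24 K], a constant independent of [H]. *)
  destruct (Hcross (2 / H) (30 * H)) as (Q & HQ & Hst).
  { split; trivial. apply Rmult_le_reg_r with (H * / r1); [apply Rmult_lt_0_compat; lra|].
    replace (2 / H * (H * / r1)) with (2 / r1) by (field; lra).
    replace (r1 * (H * / r1)) with H by (field; lra). lra. }
  { lra. }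
  destruct (@clock_bound a H) as [Nb HNb].
  destruct (big_ev_INR (Qt + Q)) as [Nq HNq].
  exists (4 * H + 1 + al * (4 * H + 3) + KL + 12 * H), (Nb + Nq)%nat.
  split; [assert (0 <= al * (4 * H + 3)) by (apply Rmult_le_pos; lra); lra|].
  intros z w m Horb Hcl HN j Hj Hw HR HI.
  assert (MH : Cmod (0, H)%R <= H).
  { eapply Rle_trans; [apply Cmod_le_Re_Im|]. simpl. rewrite Rabs_R0, Rabs_pos_eq; lra. }
  assert (HI2 : al * Rabs (Im (- / w j)%C - H) <= H / 4).
  { apply Rle_trans with (al * (H / (4 * (al + 1)))); [apply Rmult_le_compat_l; lra|].
    apply Rmult_le_reg_r with (4 * (al + 1)); [lra|].
    replace (al * (H / (4 * (al + 1))) * (4 * (al + 1))) with (al * H) by (field; lra).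
    replace (H / 4 * (4 * (al + 1))) with (al * H + H) by field. lra. }
  assert (HI3 : Rabs (Im (- / w j)%C - H) <= H / 4).
  { apply Rle_trans with (1 := HI). unfold Rdiv. apply Rmult_le_compat_l; [lra|]. apply Rinv_le_contravar; lra. }
  apply Rabs_le_between in HI3.
  destruct (Htrans (0, H)%R z w j) as (e & Hje & We & HRe & Hform & Hinv); trivial.
  { intros i Hi. apply Horb. lia. }
  { lra. }
  { intros i Hi. apply Hcl. lia. }
  { intros i Hi. apply big_mono with (Qt + Q); [lra|]. apply HNq. lia. }
  { apply Rabs_le; lra. }
  fold KL in Hform.
  set (x := INR e - al * INR j - th * (1 - al) * ln (INR j)) in *.
  set (Ze := (- / w e)%C) in *. set (Zj := (- / w j)%C) in *.
  assert (F1 := re_le_Cmod (Ze - (0, H)%R - RtoC al * (Zj - (0, H)%R) - RtoC x)).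
  assert (F2 := Im_le_Cmod (Ze - (0, H)%R - RtoC al * (Zj - (0, H)%R) - RtoC x)).
  replace (Re (Ze - (0, H)%R - RtoC al * (Zj - (0, H)%R) - RtoC x)%C) with (Re Ze - al * Re Zj - x) in F1
    by (unfold Re, Cminus, Cplus, Copp, Cmult; simpl; ring).
  replace (Im (Ze - (0, H)%R - RtoC al * (Zj - (0, H)%R) - RtoC x)%C) with ((Im Ze - H) - al * (Im Zj - H)) in F2
    by (unfold Im, Cminus, Cplus, Copp, Cmult; simpl; ring).
  assert (HIe : Rabs (Im Ze - H) <= 3 * H / 8).
  { replace (Im Ze - H) with ((Im Ze - H - al * (Im Zj - H)) + al * (Im Zj - H)) by ring.
    eapply Rle_trans; [apply Rabs_triang|]. rewrite Rabs_mult, (Rabs_pos_eq al) by lra. lra. }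
  apply Rabs_le_between in HIe.
  destruct (nfloor_ex (12 * H)) as [T HT]; [lra|].
  assert (Hrun := @crossing_run q z w e T (2 / H) (2 * K / H) (30 * H) Q K).
  assert (TK : INR T * (2 * K / H) <= 24 * K).
  { apply Rle_trans with (12 * H * (2 * K / H)); [|right; field; lra].
    apply Rmult_le_compat_r; [|lra]. unfold Rdiv in *. apply Rmult_le_pos; [lra|]. left; apply Rinv_0_lt_compat; lra. }
  assert (kH : 0 <= 2 * K / H <= 1 / 10).
  { split; [unfold Rdiv; apply Rmult_le_pos; [lra|left; apply Rinv_0_lt_compat; lra]|].
    apply Rmult_le_reg_r with H; [lra|]. replace (2 * K / H * H) with (2 * K) by (field; lra). lra. }
  assert (Hszz : forall i, (i <= T)%nat -> w (e + i)%nat <> 0 ->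
     Cmod (- / w (e + i)%nat - - / w e - RtoC (INR i)) <= INR i * (2 * K / H) ->
     Cmod (w (e + i)%nat) <= 2 / H /\ Cmod (- / w (e + i)%nat) <= 30 * H).
  { intros i Hi W0 HZ. fold Ze in HZ.
    assert (i0 := pos_INR i). assert (iT : INR i <= INR T) by (apply le_INR; lia).
    assert (HZ' : Cmod (- / w (e + i)%nat - Ze - RtoC (INR i)) <= 24 * K).
    { apply Rle_trans with (1 := HZ), Rle_trans with (2 := TK). apply Rmult_le_compat_r; lra. }
    destruct (Re_Im_of_run _ _ _ _ HZ') as [A1 A2]. apply Rabs_le_between in A1. apply Rabs_le_between in A2.
    split.
    - replace (2 / H) with (/ (H / 2)) by (field; lra). apply Cmod_inv_le_of; trivial; [lra|].
      apply Rle_trans with (2 := Im_le_Cmod _), Rle_trans with (2 := Rle_abs _). lra.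
    - eapply Rle_trans; [apply Cmod_le_Re_Im|].
      assert (Rabs (Im (- / w (e + i)%nat)%C) <= 2 * H) by (apply Rabs_le; lra).
      assert (Rabs (Re (- / w (e + i)%nat)%C) <= 20 * H) by (apply Rabs_le; lra). lra. }
  assert (Hrun' : forall i, (i <= T)%nat -> w (e + i)%nat <> 0 /\
    Cmod (- / w (e + i)%nat - - / w e - RtoC (INR i)) <= INR i * (2 * K / H) /\
    ((i < T)%nat -> Cmod (- / w (S (e + i)) - - / w (e + i)%nat - 1) <= 2 * K / H)).
  { apply Hrun; trivial.
    - intros i Hi. apply Horb. lia.
    - intros i Hi. split; [|apply (HNb (0, H)%R z m i); trivial; lia].
      assert (B := HNq i ltac:(lia)). apply big_ge in B; lra.
    - right; field; lra.
    - intros i Hi. apply Hszz. lia. }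
  clear Hrun.
  assert (HRI : forall i, (i <= T)%nat -> Rabs (Re (- / w (e + i)%nat)%C - Re Ze - INR i) <= 24 * K /\
     Rabs (Im (- / w (e + i)%nat)%C - Im Ze) <= 24 * K).
  { intros i Hi. destruct (Hrun' i Hi) as (_ & HZ & _). fold Ze in HZ. apply Re_Im_of_run.
    apply Rle_trans with (1 := HZ), Rle_trans with (2 := TK). apply Rmult_le_compat_r; [lra|]. apply le_INR; trivial. }
  destruct (@sample_exists (fun i => Re (- / w (e + i)%nat)%C) T (4 * H)) as (t & HtT & HtR).
  { rewrite Nat.add_0_r. fold Ze. lra. }
  { destruct (HRI T (le_n T)) as [A1 _]. apply Rabs_le_between in A1. lra. }
  { intros i Hi. destruct (Hrun' i ltac:(lia)) as (_ & _ & Hinc). specialize (Hinc Hi).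
    replace (e + S i)%nat with (S (e + i)) by lia.
    assert (A1 := re_le_Cmod (- / w (S (e + i)) - - / w (e + i)%nat - 1)).
    replace (Re (- / w (S (e + i)) - - / w (e + i)%nat - 1)%C) with
      (Re (- / w (S (e + i)))%C - Re (- / w (e + i)%nat)%C - 1) in A1
      by (unfold Re, Cminus, Cplus, Copp; simpl; ring).
    apply Rabs_le_between in A1. lra. }
  destruct (HRI t HtT) as [_ A2]. destruct (Hrun' t HtT) as (Wt & _ & _).
  assert (t0 := pos_INR t). assert (tT : INR t <= INR T) by (apply le_INR; trivial).
  exists (e + t)%nat. split; [lia|]. split; [trivial|]. split; [lra|]. split; [|split].
  - apply Rabs_le_between in A2. apply Rabs_le_between in F2.
    assert (0 <= K * ln H) by (apply Rmult_le_pos; lra).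
    apply Rabs_le; lra.
  - rewrite plus_INR. replace (INR e + INR t - al * INR j - th * (1 - al) * ln (INR j)) with (x + INR t) by (unfold x; ring).
    assert (G1 : 0 <= al * Re Zj <= al * (4 * H + 3)).
    { split; [apply Rmult_le_pos; lra|apply Rmult_le_compat_l; lra]. }
    apply Rabs_le_between in F1. apply Rabs_le; lra.
  - intros i Hi. destruct (Nat.le_gt_cases i e) as [Hie|Hie].
    + apply Rle_trans with (1 := Hinv i ltac:(lia)).
      apply Rle_trans with (Kt / H).
      * unfold Rdiv. apply Rmult_le_compat_l; [lra|]. apply Rinv_le_contravar; lra.
      * unfold Rdiv. apply Rmult_le_compat_r; [left; apply Rinv_0_lt_compat; lra|lra].
    + replace i with (e + (i - e))%nat by lia.
      destruct (Hrun' (i - e)%nat ltac:(lia)) as (W0 & HZ & _).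
      destruct (Hszz (i - e)%nat ltac:(lia) W0 HZ) as [S1 _].
      apply Rle_trans with (1 := S1). unfold Rdiv. apply Rmult_le_compat_r; [left; apply Rinv_0_lt_compat; lra|lra].
Qed.

Fixpoint base_orbit (p : C -> C) (z0 : C) (k : nat) : C :=
  match k with O => z0 | S k' => p (base_orbit p z0 k') end.

Fixpoint fiber_orbit (p : C -> C) (q : C -> C -> C) (z0 w0 : C) (k : nat) : C :=
  match k with O => w0 | S k' => q (base_orbit p z0 k') (fiber_orbit p q z0 w0 k') end.

Lemma opp_inv_involutive (v : C) : v <> 0 -> (- / - / v)%C = v.
Proof.
  intros Hv. assert (Hv' : (- v)%C <> 0).
  { intros E. apply Hv. replace v with (- - v)%C by ring. rewrite E. ring. }
  replace (- / v)%C with (/ - v)%C by (field; auto). field; auto.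
Qed.

Lemma opp_inv_continuous (v : C) e : v <> 0 -> 0 < e ->
  exists d, 0 < d /\ forall v' : C, Cmod (v' - v) < d -> v' <> 0 /\ Cmod (- / v' - - / v) < e.
Proof.
  intros Hv He. assert (V0 : 0 < Cmod v) by (apply Cmod_gt_0; trivial).
  set (x := Cmod v) in *.
  exists (Rmin (x / 2) (e * x ^ 2 / 4)).
  assert (x2 : 0 < x ^ 2) by (apply pow_lt; trivial).
  assert (ex : 0 < e * x ^ 2 / 4) by (assert (0 < e * x ^ 2) by (apply Rmult_lt_0_compat; trivial); lra).
  split; [apply Rmin_glb_lt; lra|].
  intros v' H.
  assert (H1 := Rmin_l (x / 2) (e * x ^ 2 / 4)). assert (H2 := Rmin_r (x / 2) (e * x ^ 2 / 4)).
  assert (V' : x / 2 <= Cmod v').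
  { replace v' with (v + (v' - v))%C by ring. eapply Rle_trans; [|apply Cmod_plus_ge]. fold x. lra. }
  assert (v'0 : v' <> 0) by (apply Cmod_gt_0; lra).
  split; trivial.
  replace (- / v' - - / v)%C with ((v' - v) / (v' * v))%C by (field; split; trivial).
  apply Rle_lt_trans with ((e * x ^ 2 / 4) / (x / 2 * x)).
  - apply Cdiv_le; [lra| |].
    + apply Rmult_lt_0_compat; lra.
    + rewrite Cmod_mult. fold x. apply Rmult_le_compat_r; lra.
  - replace (e * x ^ 2 / 4 / (x / 2 * x)) with (e / 2) by (field; lra). lra.
Qed.

(** Continuity along a single fiber: in the shooting all orbits share the base orbit and only [w]
    varies. *)
Definition continuous_second (q : C -> C -> C) : Prop :=
  forall z w e, 0 < e -> exists d, 0 < d /\ forall w', Cmod (w' - w) < d -> Cmod (q z w' - q z w) < e.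

(** The base point is [/ zeta], placed so that its defect at time [N] is exactly [i H]. Heights
    relative to [H] are then multiplied by [al] up to [O(1 + ln H)], and the initial height of
    [- 1 / w] is the shooting parameter. Time [N] of the construction becomes time 0 of the
    resulting orbit. *)
Lemma recurrent_orbit (p : C -> C) (q : C -> C -> C) (a b03 b30 : C) (th b c M r : R) :
  0 < r -> 0 < c -> b = 1 / 4 + c ^ 2 -> a = (b03 + RtoC th)%C ->
  base_bound p a M r -> fiber_bound q b b03 b30 M r -> continuous_second q ->
  forall rs, 0 < rs -> exists (z w : nat -> C) (eps : R), orbit_from p q z w 0 /\
    (forall j, Cmod (z j) < rs /\ Cmod (w j) < rs) /\ z 0%nat <> 0 /\ 0 < eps /\
    (forall J : nat, exists n, (J <= n)%nat /\ eps <= Cmod (w n)).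
Proof.
  intros Hr Hc Hb Ha Hp Hq Hcont rs Hrs.
  set (al := exp (PI / c)).
  assert (al1 : 1 < al).
  { unfold al. rewrite <- exp_0. apply exp_increasing. apply Rdiv_lt_0_compat; trivial. apply PI_RGT_0. }
  destruct (@next_sample p q a b03 b30 th b c M r Hr Hc Hb Ha Hp Hq) as (E0 & H1 & HE0 & HH1 & Hnext0).
  fold al in Hnext0.
  destruct (@sample_unique p q a b03 b30 b M r Hr Hp Hq) as (H2 & Huniq0).
  (* [big Q H] makes [H] so large compared with [1 + ln H] that a strip of half-width
     [H / (8 (al + 1))] beats the passage error, in the form [theta + 4 + E <= al * (theta - 1)]. *)
  set (Q := 8 * (al + 1) * (al + 4 + E0) / (al - 1) + 16 * (al + 1) + 8 * E0 + 8).
  destruct (big_ev Q) as [H3 HH3].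
  assert (irs : 0 < / rs) by (apply Rinv_0_lt_compat; trivial).
  set (H := Rmax H3 (Rmax H2 (H1 + 2 * E0 * / rs))).
  assert (Hbig : big Q H) by (apply HH3, Rmax_l).
  assert (HH2 : H2 <= H) by (apply Rle_trans with (2 := Rmax_r _ _), Rmax_l).
  assert (HH4 : H1 + 2 * E0 * / rs <= H) by (apply Rle_trans with (2 := Rmax_r _ _), Rmax_r).
  assert (Ers : 0 < E0 * / rs) by (apply Rmult_lt_0_compat; lra).
  assert (Q1 : 0 < 8 * (al + 1) * (al + 4 + E0) / (al - 1)).
  { apply Rdiv_lt_0_compat; [|lra]. repeat apply Rmult_lt_0_compat; lra. }
  assert (HQH := @big_lin Q H ltac:(unfold Q; lra) Hbig).
  assert (Hge1 : 1 <= H) by lra.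
  assert (lH := ln_nonneg H Hge1).
  set (L := 1 + ln H) in *. assert (L1 : 1 <= L) by (unfold L; lra).
  destruct (Hnext0 H ltac:(lra)) as (E2 & N1 & HE2 & Hnext).
  set (be := Rabs (th * (1 - al))). assert (be0 : 0 <= be) by apply Rabs_pos.
  (* Two samples at most 5 steps apart have successors whose times differ by at most [5 al + 5 be]
     plus twice the error [E2] of the time law. *)
  set (E3 := 2 * E2 + 5 * al + 5 * be + 5).
  assert (HE3 : 5 <= E3) by (unfold E3; lra).
  destruct (Huniq0 H E3 HH2) as (N2 & Huniq).
  destruct (@clock_of_defect p a M r Hr Hp H) as (N3 & Hclk).
  destruct (@clock_bound a H) as [N4 HN4].
  set (k := Cmod (1 - a)). assert (k0 : 0 <= k) by apply Cmod_ge_0.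
  destruct (big_ev_INR (k + H + 2 + 4 / rs)) as [N5 HN5].
  set (N := (N1 + N2 + N3 + N4 + N5)%nat).
  assert (BN := HN5 N ltac:(unfold N; lia)).
  (* Small enough that a sample of relative height up to [theta + 2] is sent to a relative height
     below [H / 2], hence into the window again. *)
  set (theta := H / (8 * (al + 1))).
  assert (Eth : 8 * (al + 1) * theta = H) by (unfold theta; field; lra).
  set (E := E0 * L).
  assert (QL : Q * 1 <= Q * L) by (apply Rmult_le_compat_l; [unfold Q; lra|trivial]).
  assert (th2 : 2 <= theta).
  { apply Rmult_le_reg_l with (8 * (al + 1)); [lra|]. rewrite Eth. unfold Q in *; lra. }
  assert (E8 : E <= H / 8).
  { unfold E. assert (8 * E0 * L <= Q * L) by (apply Rmult_le_compat_r; [lra|unfold Q; lra]). lra. }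
  assert (Hexp : theta + 4 + E <= al * (theta - 1)).
  { assert (S1 : 8 * (al + 1) * (al + 4 + E0) / (al - 1) * L <= H).
    { apply Rle_trans with (2 := HQH). apply Rmult_le_compat_r; [lra|]. unfold Q; lra. }
    assert (S2 : 8 * (al + 1) * ((al + 4 + E0) * L) <= (al - 1) * H).
    { apply Rle_trans with ((al - 1) * (8 * (al + 1) * (al + 4 + E0) / (al - 1) * L)); [right; field; lra|].
      apply Rmult_le_compat_l; lra. }
    assert (S3 : (al + 4 + E0) * L <= (al - 1) * theta).
    { apply Rmult_le_reg_l with (8 * (al + 1)); [lra|].
      replace (8 * (al + 1) * ((al - 1) * theta)) with ((al - 1) * (8 * (al + 1) * theta)) by ring. rewrite Eth. lra. }
    assert (al + 4 <= (al + 4) * L) by (rewrite <- (Rmult_1_r (al + 4)) at 1; apply Rmult_le_compat_l; lra).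
    unfold E. lra. }
  set (d := (0, H)%R : C).
  assert (Hd : Cmod d <= H).
  { eapply Rle_trans; [apply Cmod_le_Re_Im|]. simpl. rewrite Rabs_R0, Rabs_pos_eq; lra. }
  set (nN := INR N) in *.
  set (zeta := (RtoC nN + (1 - a) * RtoC (ln nN) + d)%C).
  assert (n1 : 1 <= nN) by apply BN.
  assert (lN := ln_nonneg nN n1).
  assert (zeta0 : zeta <> 0).
  { apply Cmod_gt_0. unfold zeta. rewrite <- Cplus_assoc.
    eapply Rlt_le_trans; [|apply Cmod_plus_ge]. rewrite Cmod_RtoC_pos by lra.
    assert (Cmod ((1 - a) * RtoC (ln nN) + d) <= k * ln nN + H).
    { eapply Cadd_le; [|exact Hd]. rewrite Cmod_mult, Cmod_RtoC_pos by lra. apply Rle_refl. }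
    assert (B := @big_lin (k + H + 2 + 4 / rs) nN ltac:(lra) BN).
    assert (0 <= H * ln nN) by (apply Rmult_le_pos; lra).
    assert (0 <= 4 / rs * ln nN) by (apply Rmult_le_pos; lra). lra. }
  set (zz := base_orbit p (/ zeta)). set (z := fun j => zz (j - N)%nat).
  set (ww := fun y => fiber_orbit p q (/ zeta) (- / ((4 * H + 1)%R, (H + y)%R))).
  set (w := fun y j => ww y (j - N)%nat).
  assert (zN : z N = (/ zeta)%C) by (unfold z; rewrite Nat.sub_diag; trivial).
  assert (Horb : forall y, orbit_from p q z (w y) N).
  { intros y j Hj. unfold z, w. replace (S j - N)%nat with (S (j - N)) by lia. split; trivial. }
  assert (iz : (/ / zeta = zeta)%C) by (field; trivial).
  assert (zN0 : z N <> 0).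
  { rewrite zN. apply Cmod_gt_0. rewrite Cmod_inv by trivial. apply Rinv_0_lt_compat, Cmod_gt_0; trivial. }
  assert (Hdef : clock_defect a z N = d).
  { unfold clock_defect. rewrite zN, iz. unfold zeta. fold nN. ring. }
  assert (Hcl : clock a d z N).
  { rewrite <- Hdef. apply Hclk; [unfold N; lia| |trivial|rewrite Hdef; trivial].
    intros j Hj. apply (Horb 0 j Hj). }
  (* Strict inequalities make the window open. It is wider than the range
     [4 * H <= Re Z <= 4 * H + 2] in which [next_sample] lands, so a new sample is an interior
     point. *)
  set (st := fun y j => (N <= j)%nat /\ w y j <> 0 /\ 4 * H - 1 < Re (- / w y j)%C < 4 * H + 3 /\
     Rabs (Im (- / w y j)%C - H) < H / 2).
  set (h := fun y j => Im (- / w y j)%C - H).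
  set (link := fun j j' => (N <= j)%nat /\ Rabs (INR j' - al * INR j - th * (1 - al) * ln (INR j)) <= E2).
  set (near := fun j j' => (j <= j' + 5)%nat /\ (j' <= j + 5)%nat).
  set (nx := fun y j j' => (j < j')%nat /\ st y j' /\ link j j' /\ Rabs (h y j' - al * h y j) <= E /\
     forall i, (j <= i <= j')%nat -> Cmod (w y i) <= E0 / H).
  (* At each fixed time the orbit depends continuously on the initial height, as a composition of
     finitely many fiber maps. *)
  assert (Hwc : forall kk y e, 0 < e -> exists dd, 0 < dd /\ forall y', Rabs (y' - y) < dd ->
     Cmod (ww y' kk - ww y kk) < e).
  { induction kk as [|kk IH]; intros y e He.
    - set (X := fun y => ((4 * H + 1)%R, (H + y)%R) : C).
      assert (X0 : forall y, X y <> 0).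
      { intros y0 E0'. apply (f_equal Re) in E0'. simpl in E0'. lra. }
      destruct (opp_inv_continuous (X y) e (X0 y) He) as (dd & Hdd & Hc').
      exists dd. split; trivial. intros y' Hy'. simpl. apply (Hc' (X y')).
      replace (X y' - X y)%C with (Ci * RtoC (y' - y))%C.
      + rewrite Cmod_mult, Cmod_Ci, Cmod_R. lra.
      + unfold X. apply injective_projections; simpl; ring.
    - simpl. destruct (Hcont (zz kk) (ww y kk) e He) as (d1 & Hd1 & Hc1).
      destruct (IH y d1 Hd1) as (d2 & Hd2 & Hc2). exists d2. split; trivial.
      intros y' Hy'. apply (Hc1 (ww y' kk)). apply Hc2; trivial. }
  destruct (@shooting st h link near nx al theta E N) as (y & Hy & Hrec); trivial.
  - lra.
  - intros y j e (Hj & W0 & HR & HI) He.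
    set (Z := (- / w y j)%C) in *.
    set (e1 := Rmin e (Rmin (Re Z - (4 * H - 1)) (Rmin (4 * H + 3 - Re Z) (H / 2 - Rabs (Im Z - H))))).
    assert (e10 : 0 < e1) by (repeat apply Rmin_glb_lt; lra).
    assert (b1 : e1 <= e) by apply Rmin_l.
    assert (b2 : e1 <= Re Z - (4 * H - 1)) by (apply Rle_trans with (1 := Rmin_r _ _), Rmin_l).
    assert (b3 : e1 <= 4 * H + 3 - Re Z).
    { apply Rle_trans with (1 := Rmin_r _ _), Rle_trans with (1 := Rmin_r _ _), Rmin_l. }
    assert (b4 : e1 <= H / 2 - Rabs (Im Z - H)).
    { apply Rle_trans with (1 := Rmin_r _ _), Rle_trans with (1 := Rmin_r _ _), Rmin_r. }
    destruct (opp_inv_continuous (w y j) e1 W0 e10) as (d1 & Hd1 & Hc1).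
    destruct (Hwc (j - N)%nat y d1 Hd1) as (d2 & Hd2 & Hc2).
    exists d2. split; trivial. intros y' Hy'. destruct (Hc1 (w y' j) (Hc2 y' Hy')) as [W' HZ].
    fold Z in HZ.
    assert (A1 := re_le_Cmod (- / w y' j - Z)). assert (A2 := Im_le_Cmod (- / w y' j - Z)).
    replace (Re (- / w y' j - Z)%C) with (Re (- / w y' j)%C - Re Z) in A1 by (unfold Re, Cminus, Cplus, Copp; simpl; ring).
    replace (Im (- / w y' j - Z)%C) with (Im (- / w y' j)%C - Im Z) in A2 by (unfold Im, Cminus, Cplus, Copp; simpl; ring).
    assert (A3 : Rabs (Re (- / w y' j)%C - Re Z) < e1) by lra. apply Rabs_def2 in A3.
    split.
    + split; trivial. split; trivial. split; [lra|].
      replace (Im (- / w y' j)%C - H) with ((Im (- / w y' j)%C - Im Z) + (Im Z - H)) by ring.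
      eapply Rle_lt_trans; [apply Rabs_triang|]. lra.
    + unfold h. fold Z. replace (Im (- / w y' j)%C - H - (Im Z - H)) with (Im (- / w y' j)%C - Im Z) by ring. lra.
  - intros y j (Hj & W0 & HR & HI) Hh.
    assert (Hh2 : Rabs (Im (- / w y j)%C - H) <= H / (4 * (al + 1))).
    { unfold h in Hh. apply Rle_trans with (1 := Hh). apply Rle_trans with (2 * theta); [lra|].
      right. unfold theta. field. lra. }
    destruct (Hnext z (w y) N (Horb y) Hcl ltac:(unfold N; lia) j Hj W0 ltac:(lra) Hh2)
      as (j' & Hjj' & W' & HR' & HI' & Hl' & Hin).
    exists j'. split; trivial. split; [|split; [|split]]; trivial.
    + split; [lia|]. split; trivial. split; [lra|].
      replace (Im (- / w y j')%C - H) with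
        ((Im (- / w y j')%C - H - al * (Im (- / w y j)%C - H)) + al * (Im (- / w y j)%C - H)) by ring.
      eapply Rle_lt_trans; [apply Rabs_triang|]. rewrite (Rabs_mult al), (Rabs_pos_eq al) by lra.
      fold L E in HI'.
      assert (al * Rabs (Im (- / w y j)%C - H) <= al * (2 * theta)) by (apply Rmult_le_compat_l; unfold h in Hh; lra).
      lra.
    + split; trivial.
  - intros y j j' (G1 & G2 & G3 & G4 & _). split; [lia|]. split; [trivial|]. split; trivial.
  - intros j. split; lia.
  - intros y j j' (Hj & W0 & HR & HI) (Hj' & W0' & HR' & HI') [Hn1 Hn2]. unfold h.
    destruct (Nat.le_ge_cases j j') as [Hle|Hle].
    + destruct (Huniq z (w y) N (Horb y) Hcl ltac:(unfold N; lia) j j') as [_ B]; trivial; try lra.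
      { apply le_INR in Hn2. rewrite plus_INR in Hn2. simpl in Hn2. lra. }
      replace (Im (- / w y j)%C - H - (Im (- / w y j')%C - H)) with (Im (- / w y j)%C - Im (- / w y j')%C) by ring. trivial.
    + destruct (Huniq z (w y) N (Horb y) Hcl ltac:(unfold N; lia) j' j) as [_ B]; trivial; try lra.
      { apply le_INR in Hn1. rewrite plus_INR in Hn1. simpl in Hn1. lra. }
      replace (Im (- / w y j)%C - H - (Im (- / w y j')%C - H)) with (- (Im (- / w y j')%C - Im (- / w y j)%C)) by ring.
      rewrite Rabs_Ropp. trivial.
  - intros y j j' j1 j1' [Hn1 Hn2] [Hj Hl] [Hj' Hl'] (Hj1 & W0 & HR & HI) (Hj1' & W0' & HR' & HI').
    assert (J : Rabs (INR j - INR j') <= 5).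
    { apply le_INR in Hn1. apply le_INR in Hn2. rewrite plus_INR in Hn1, Hn2. simpl in Hn1, Hn2. apply Rabs_le; lra. }
    assert (m1 : 1 <= INR j) by (apply Rle_trans with (1 := n1), le_INR; trivial).
    assert (m2 : 1 <= INR j') by (apply Rle_trans with (1 := n1), le_INR; trivial).
    assert (lndiff : forall u v, 1 <= u -> u - v <= 5 -> 1 <= v -> ln u - ln v <= 5).
    { intros u v Hu Huv Hv. assert (X := exp_ineq1_le 5).
      assert (ln u <= ln (v * exp 5)) by (apply ln_le; [lra|apply Rle_trans with (v * (1 + 5)); [lra|apply Rmult_le_compat_l; lra]]). rewrite ln_mult, ln_exp in H0 by (try apply exp_pos; lra). lra. }
    apply Rabs_le_between in J.
    assert (JL : Rabs (ln (INR j) - ln (INR j')) <= 5).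
    { assert (X1 := lndiff (INR j) (INR j') m1 ltac:(lra) m2). assert (X2 := lndiff (INR j') (INR j) m2 ltac:(lra) m1).
      apply Rabs_le; lra. }
    assert (T1 : Rabs (th * (1 - al) * (ln (INR j) - ln (INR j'))) <= be * 5).
    { rewrite Rabs_mult. fold be. apply Rmult_le_compat_l; trivial. }
    assert (T2 : - (al * 5) <= al * (INR j - INR j') <= al * 5).
    { split; [rewrite Ropp_mult_distr_r|]; apply Rmult_le_compat_l; lra. }
    apply Rabs_le_between in Hl. apply Rabs_le_between in Hl'. apply Rabs_le_between in T1.
    destruct (Nat.le_ge_cases j1 j1') as [Hle|Hle].
    + destruct (Huniq z (w y) N (Horb y) Hcl ltac:(unfold N; lia) j1 j1') as [B _]; trivial; try lra.
      { unfold E3. lra. }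
      split; lia.
    + destruct (Huniq z (w y) N (Horb y) Hcl ltac:(unfold N; lia) j1' j1) as [B _]; trivial; try lra.
      { unfold E3. lra. }
      split; lia.
  - intros y Hy.
    assert (X0 : ((4 * H + 1)%R, (H + y)%R) <> RtoC 0).
    { intros E0'. apply (f_equal Re) in E0'. simpl in E0'. lra. }
    assert (EZ : (- / w y N)%C = ((4 * H + 1)%R, (H + y)%R)).
    { unfold w, ww. rewrite Nat.sub_diag. simpl. apply opp_inv_involutive; trivial. }
    assert (thH : theta + 1 < H / 2).
    { assert (16 * theta <= 8 * (al + 1) * theta) by (apply Rmult_le_compat_r; lra). lra. }
    unfold st, h. rewrite EZ. simpl Re. simpl Im.
    split; [|ring]. split; [lia|]. split; [|split; [lra|apply Rabs_def1; lra]].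
    unfold w, ww. rewrite Nat.sub_diag. simpl. apply Cmod_gt_0. rewrite Cmod_opp, Cmod_inv by trivial.
    apply Rinv_0_lt_compat, Cmod_gt_0; trivial.
  - assert (HE0rs : E0 / H < rs).
    { apply Rmult_lt_reg_r with (H * / rs); [apply Rmult_lt_0_compat; lra|].
      replace (E0 / H * (H * / rs)) with (E0 * / rs) by (field; lra).
      replace (rs * (H * / rs)) with H by (field; lra). lra. }
    (* Smallness up to time [j] is propagated as the predicate [Q] of [shooting]: between two
       samples it follows from the bound [E0 / H] built into [nx]. *)
    assert (Hall : forall kk, exists j, (N + kk <= j)%nat /\ (forall i, (N <= i <= j)%nat -> Cmod (w y i) < rs) /\
       st y j /\ Rabs (h y j) <= theta).
    { apply (Hrec (fun j => forall i, (N <= i <= j)%nat -> Cmod (w y i) < rs)).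
      - intros i Hi. replace i with N by lia. unfold w, ww. rewrite Nat.sub_diag. simpl.
        assert (X0 : ((4 * H + 1)%R, (H + y)%R) <> RtoC 0).
        { intros E0'. apply (f_equal Re) in E0'. simpl in E0'. lra. }
        rewrite Cmod_opp, Cmod_inv by trivial. apply Rle_lt_trans with (2 := HE0rs).
        apply Rle_trans with (/ H); [|unfold Rdiv; rewrite <- (Rmult_1_l (/ H)) at 1; apply Rmult_le_compat_r; [left; apply Rinv_0_lt_compat; lra|lra]].
        apply Rinv_le_contravar; [lra|]. apply Rle_trans with (2 := re_le_Cmod _). simpl. rewrite Rabs_pos_eq; lra.
      - intros j j' HQj (_ & _ & _ & _ & Hin) i Hi.
        destruct (Nat.le_gt_cases i j) as [Hij|Hij]; [apply HQj; lia|].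
        apply Rle_lt_trans with (2 := HE0rs). apply Hin. lia. }
    exists zz, (ww y), (/ (6 * H + 3)). split; [|split; [|split; [|split]]].
    + intros j _. split; trivial.
    + intros j. split.
      * replace (zz j) with (z (N + j)%nat) by (unfold z; f_equal; lia).
        apply Rle_lt_trans with (1 := HN4 d z N (N + j)%nat Hd Hcl ltac:(lia) ltac:(unfold N; lia)).
        assert (B := HN5 (N + j)%nat ltac:(unfold N; lia)). apply big_ge in B; [|lra].
        apply Rmult_lt_reg_r with (INR (N + j) * / rs); [apply Rmult_lt_0_compat; lra|].
        replace (2 / INR (N + j) * (INR (N + j) * / rs)) with (2 / rs) by (field; lra).
        replace (rs * (INR (N + j) * / rs)) with (INR (N + j)) by (field; lra). unfold Rdiv in *. lra.
      * destruct (Hall j) as (j' & Hj' & HQj & _). specialize (HQj (N + j)%nat ltac:(lia)).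
        unfold w in HQj. replace (N + j - N)%nat with j in HQj by lia. trivial.
    + unfold zz. simpl. rewrite <- zN. trivial.
    + apply Rinv_0_lt_compat. lra.
    + intros J. destruct (Hall J) as (j & Hj & _ & (_ & W0 & HR & HI) & _).
      exists (j - N)%nat. split; [lia|]. change (ww y (j - N)%nat) with (w y j).
      assert (HZ : Cmod (- / w y j) <= 6 * H + 3).
      { eapply Rle_trans; [apply Cmod_le_Re_Im|]. rewrite Rabs_pos_eq by lra.
        apply Rabs_def2 in HI. assert (Rabs (Im (- / w y j)%C) <= 2 * H) by (apply Rabs_le; lra). lra. }
      rewrite Cmod_opp, Cmod_inv in HZ by trivial.
      rewrite <- (Rinv_inv (Cmod (w y j))). apply Rinv_le_contravar; trivial.
      apply Rinv_0_lt_compat, Cmod_gt_0; trivial.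
Qed.

(** * Transfer by the conjugacy *)

(** Polydiscs rather than norm balls, so that the two coordinates can be tested separately when
    visibility is transferred. *)
Definition small (d : R) (x : C2) : Prop := Cmod (fst x) < d /\ Cmod (snd x) < d.

Lemma C2_norm_le (x : C2) : norm x <= Cmod (fst x) + Cmod (snd x).
Proof.
  destruct x as [z w]. change (sqrt (Cmod z ^ 2 + Cmod w ^ 2) <= Cmod z + Cmod w).
  assert (A := Cmod_ge_0 z). assert (B := Cmod_ge_0 w).
  rewrite <- (sqrt_pow2 (Cmod z + Cmod w)) by lra. apply sqrt_le_1_alt. nra.
Qed.

Lemma C2_norm_small (x : C2) d : norm x < d -> small d x.
Proof.
  destruct x as [z w]. change (sqrt (Cmod z ^ 2 + Cmod w ^ 2) < d -> Cmod z < d /\ Cmod w < d).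
  intros H. assert (A := pow2_ge_0 (Cmod z)). assert (B := pow2_ge_0 (Cmod w)).
  assert (A' := Cmod_ge_0 z). assert (B' := Cmod_ge_0 w).
  split; apply Rle_lt_trans with (2 := H);
    [rewrite <- (sqrt_pow2 (Cmod z)) at 1 by lra | rewrite <- (sqrt_pow2 (Cmod w)) at 1 by lra];
    apply sqrt_le_1_alt; lra.
Qed.

Lemma locally_C2_small (x : C2) (P : C2 -> Prop) :
  locally x P -> exists d, 0 < d /\ forall y : C2, small d (minus y x) -> P y.
Proof.
  intros H. apply locally_norm_le_locally in H. destruct H as [e He].
  exists (e / 2). assert (e0 := cond_pos e). split; [lra|].
  intros y [H1 H2]. apply He. unfold ball_norm. apply Rle_lt_trans with (1 := C2_norm_le _). lra.
Qed.

Lemma small_locally_C2 (x : C2) (d : R) : 0 < d -> locally x (fun y => small d (minus y x)).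
Proof.
  intros Hd. apply locally_le_locally_norm. exists (mkposreal d Hd). intros y Hy.
  apply C2_norm_small. exact Hy.
Qed.

Lemma minus_zero_C2 (x : C2) : minus x zero = x.
Proof. apply minus_zero_r. Qed.

Lemma locally_zero_small (P : C2 -> Prop) :
  locally (zero : C2) P -> exists d, 0 < d /\ forall y : C2, small d y -> P y.
Proof.
  intros H. destruct (locally_C2_small zero P H) as (d & Hd & H1). exists d. split; trivial.
  intros y Hy. apply H1. apply (eq_ind y (small d) Hy). symmetry. apply minus_zero_C2.
Qed.

Lemma small_le d d' x : d <= d' -> small d x -> small d' x.
Proof. intros H [H1 H2]. split; lra. Qed.

Lemma continuous_on_small (D : C2 -> Prop) (f : C2 -> C2) (e : R) :
  continuous_on D f -> D zero -> f zero = zero -> 0 < e ->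
  exists d, 0 < d /\ forall x : C2, D x -> small d x -> small e (f x).
Proof.
  intros Hf HD H0 He. specialize (Hf zero HD). rewrite H0 in Hf.
  specialize (Hf _ (small_locally_C2 zero e He)).
  destruct (locally_zero_small _ Hf) as (d & Hd & H1). exists d. split; trivial.
  intros x Hx Hs. apply (eq_ind _ (small e) (H1 x Hs Hx)). apply minus_zero_C2.
Qed.

(** What is kept of the homeomorphism: equivariance on a polydisc inside [U], and continuity at the
    origin of the map and of its inverse, the latter phrased without naming the inverse. *)
Lemma conjugacy_local (P1 P2 : C2 -> C2) : topologically_conjugated_near_0 P1 P2 ->
  exists (h : C2 -> C2) (R0 : R), 0 < R0 /\
    (forall x, small R0 x -> small R0 (P1 x) -> h (P1 x) = P2 (h x)) /\
    (forall e, 0 < e -> exists d, 0 < d /\ forall x, small R0 x -> small d x -> small e (h x)) /\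
    (forall e, 0 < e -> exists d, 0 < d /\ forall x, small R0 x -> small d (h x) -> small e x).
Proof.
  intros (U & V & h & HU & HV & U0 & V0 & (g & Hg1 & Hg2 & Hh & Hgc) & H0 & Hc).
  destruct (locally_zero_small _ (HU zero U0)) as (R0 & HR0 & HUR).
  exists h, R0. split; trivial. split; [|split].
  - intros x Hx HP. apply Hc; apply HUR; trivial.
  - intros e He. destruct (continuous_on_small U h e Hh U0 H0 He) as (d & Hd & H1).
    exists d. split; trivial. intros x Hx. apply H1, HUR. trivial.
  - intros e He. assert (Hg0 : g zero = zero) by (rewrite <- H0 at 1; apply Hg1; trivial).
    destruct (continuous_on_small V g e Hgc V0 Hg0 He) as (d & Hd & H1).
    exists d. split; trivial. intros x Hx Hs.
    destruct (Hg1 x (HUR x Hx)) as [HVx Hgx]. rewrite <- Hgx. apply H1; trivial.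
Qed.

Lemma base_expansion_bound p a : base_expansion p a -> exists M r, 0 < r /\ base_bound p a M r.
Proof.
  intros [M H]. apply (locally_norm_le_locally (V := C_NormedModule)) in H. destruct H as [e He].
  exists M, e. split; [apply cond_pos|]. intros z Hz. apply (He z). unfold ball_norm.
  apply (eq_ind z (fun u => Cmod u < e) Hz). symmetry. apply (minus_zero_r (G := C_NormedModule)).
Qed.

Lemma fiber_expansion_bound q b b03 b30 : fiber_expansion q b b03 b30 ->
  exists M r, 0 < r /\ fiber_bound q b b03 b30 M r.
Proof.
  intros [M H]. destruct (locally_zero_small _ H) as (d & Hd & H1).
  exists (Rabs M), d. split; trivial. intros z w Hz Hw.
  specialize (H1 (z, w) (conj Hz Hw)). simpl in H1. apply Rle_trans with (1 := H1).
  assert (N0 : 0 <= norm ((z, w) : C2)) by apply norm_ge_0.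
  apply Rle_trans with (Rabs M * norm ((z, w) : C2) ^ 4).
  - apply Rmult_le_compat_r; [apply pow_le; trivial|apply Rle_abs].
  - apply Rmult_le_compat_l; [apply Rabs_pos|]. apply pow_incr. split; trivial. apply (C2_norm_le (z, w)).
Qed.

Lemma holomorphic_continuous_second p q : holomorphic (skew_product p q) -> continuous_second q.
Proof.
  intros Hol z w e He. assert (H := @filterdiff_continuous _ _ _ _ _ (Hol (z, w))).
  specialize (H _ (small_locally_C2 _ e He)).
  destruct (locally_C2_small _ _ H) as (d & Hd & H1). exists d. split; trivial.
  intros w' Hw'. specialize (H1 (z, w')). apply H1. split; simpl; trivial.
  change (Cmod (z - z) < d). replace (z - z)%C with (RtoC 0) by ring. rewrite Cmod_0. trivial.
Qed.

(** As [alpha_of b - 1] is a nonzero real, reality of beta amounts to reality of [a - b03], although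
    [a] and [b03] may be complex. *)
Lemma norm_form p q a b03 b30 b :
  holomorphic (skew_product p q) -> base_expansion p a -> fiber_expansion q b b03 b30 ->
  1 / 4 < b -> Im (beta_of a b03 b) = 0 ->
  1 < alpha_of b /\ exists th M r, 0 < r /\ 0 < c_of b /\ b = 1 / 4 + c_of b ^ 2 /\ a = (b03 + RtoC th)%C /\
    base_bound p a M r /\ fiber_bound q b b03 b30 M r /\ continuous_second q /\
    beta_of a b03 b = RtoC (th * (1 - alpha_of b)).
Proof.
  intros Hol Hp Hq Hb Him.
  assert (c0 : 0 < c_of b) by (unfold c_of; assert (0 < sqrt (4 * b - 1)) by (apply sqrt_lt_R0; lra); lra).
  assert (al : 1 < alpha_of b).
  { unfold alpha_of. rewrite <- exp_0. apply exp_increasing. apply Rdiv_lt_0_compat; trivial. apply PI_RGT_0. }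
  split; trivial.
  destruct (base_expansion_bound _ _ Hp) as (M1 & r1 & Hr1 & B1).
  destruct (fiber_expansion_bound _ _ _ _ Hq) as (M2 & r2 & Hr2 & B2).
  assert (Eth : a = (b03 + RtoC (Re (a - b03)))%C).
  { unfold beta_of in Him. destruct a as [a1 a2]. destruct b03 as [c1 c2].
    unfold Im, Re, Cmult, Cminus, Cplus, Copp, RtoC in *. simpl in *.
    assert (c2 - a2 = 0) by (apply Rmult_eq_reg_r with (alpha_of b - 1); lra).
    apply injective_projections; simpl; lra. }
  set (th := Re (a - b03)) in *.
  exists th, (Rmax M1 M2), (Rmin r1 r2).
  split; [apply Rmin_glb_lt; trivial|]. split; trivial. split; [|split; [trivial|split; [|split; [|split]]]].
  - unfold c_of. assert (S := pow2_sqrt (4 * b - 1) ltac:(lra)).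
    replace ((sqrt (4 * b - 1) / 2) ^ 2) with (sqrt (4 * b - 1) ^ 2 / 4) by field. rewrite S. field.
  - intros z Hz. assert (Cmod z < r1) by (apply Rlt_le_trans with (1 := Hz), Rmin_l).
    apply Rle_trans with (1 := B1 z H). apply Rmult_le_compat_r; [apply pow_le, Cmod_ge_0|apply Rmax_l].
  - intros z w Hz Hw. assert (Cmod z < r2) by (apply Rlt_le_trans with (1 := Hz), Rmin_r).
    assert (Cmod w < r2) by (apply Rlt_le_trans with (1 := Hw), Rmin_r).
    apply Rle_trans with (1 := B2 z w H H0).
    apply Rmult_le_compat_r; [|apply Rmax_r]. apply pow_le. apply Rplus_le_le_0_compat; apply Cmod_ge_0.
  - apply (holomorphic_continuous_second p q Hol).
  - unfold beta_of. rewrite Eth. apply injective_projections; simpl; ring.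
Qed.

(** On the fiber [z = 0] a small orbit either hits 0 and stays there, or [Re (- 1 / w)] gains at
    least [3 / 4] per step. A recurrent orbit therefore cannot live on that fiber. *)
Lemma invariant_fiber_tends_0 (q : C -> C -> C) (b : R) (b03 b30 : C) (M r : R) :
  0 < r -> fiber_bound q b b03 b30 M r -> exists r0, 0 < r0 /\ forall w : nat -> C,
    (forall j, w (S j) = q 0 (w j)) -> (forall j, Cmod (w j) < r0) ->
    forall eps, 0 < eps -> exists N, forall n, (N <= n)%nat -> Cmod (w n) < eps.
Proof.
  intros Hr Hq. destruct (crossing_step q b b03 b30 M r Hr Hq) as (K & r1 & HK & Hr1 & Hst).
  assert (q0 : q 0 0 = 0).
  { assert (B := Hq 0 0). rewrite Cmod_0 in B. specialize (B Hr Hr).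
    apply Cmod_eq_0. apply Rle_antisym; [|apply Cmod_ge_0].
    replace (q 0 0) with (q 0 0 - (0 + 0 ^ 2 + RtoC b * 0 ^ 2 + b03 * 0 ^ 3 + b30 * 0 ^ 3))%C by ring.
    apply Rle_trans with (1 := B). simpl. lra. }
  exists (Rmin r1 (/ (4 * K))). assert (K4 : 0 < / (4 * K)) by (apply Rinv_0_lt_compat; lra).
  split; [apply Rmin_glb_lt; lra|]. intros w Hw Hs eps Heps.
  destruct (classic (exists m, w m = 0)) as [[m Hm]|Hn].
  - exists m. intros n Hn. replace (w n) with (RtoC 0); [rewrite Cmod_0; trivial|].
    induction Hn as [|n Hn IH]; [auto|]. rewrite Hw, <- IH. auto.
  - assert (Hre : forall j, Re (- / w 0%nat)%C + 3 / 4 * INR j <= Re (- / w j)%C).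
    { induction j as [|j IH]; [simpl; lra|]. rewrite S_INR.
      assert (W0 : w j <> 0) by (intros E0; apply Hn; exists j; trivial).
      destruct (Hst 0 (w j) W0) as [_ H].
      - apply Rlt_le_trans with (1 := Hs j), Rmin_l.
      - rewrite Cmod_0. apply Cmod_ge_0.
      - rewrite <- Hw, Cmod_0 in H.
        assert (Hj : Cmod (w j) <= / (4 * K)) by (left; apply Rlt_le_trans with (1 := Hs j), Rmin_r).
        assert (H4 : Cmod (- / w (S j) - - / w j - 1) <= 1 / 4).
        { apply Rle_trans with (1 := H). apply Rle_trans with (K * / (4 * K)); [|right; field; lra].
          apply Rmult_le_compat_l; [lra|]. unfold Rdiv. rewrite (pow_ne_zero 2), Rmult_0_l by lia. lra. }
        assert (A := re_le_Cmod (- / w (S j) - - / w j - 1)).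
        assert (Rabs (Re (- / w (S j) - - / w j - 1)%C) <= 1 / 4) by lra. apply Rabs_le_between in H0.
        replace (Re (- / w (S j) - - / w j - 1)%C) with (Re (- / w (S j))%C - Re (- / w j)%C - 1) in H0
          by (unfold Re, Cminus, Cplus, Copp, RtoC; simpl; ring).
        lra. }
    destruct (INR_ge_ev (2 * (2 / eps - Re (- / w 0%nat)%C) + 2 / eps)) as [N HN].
    assert (e2 : 0 < 2 / eps) by (apply Rdiv_lt_0_compat; lra).
    destruct (INR_ge_ev (2 * (2 / eps - Re (- / w 0%nat)%C))) as [N' HN'].
    exists (N + N')%nat. intros n HnN.
    assert (B2 := HN' n ltac:(lia)). assert (B3 := Hre n).
    assert (W0 : w n <> 0) by (intros E0; apply Hn; exists n; trivial).
    assert (n0 := pos_INR n).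
    assert (X := re_le_Cmod (- / w n)). assert (Y := Rle_abs (Re (- / w n)%C)).
    apply Rle_lt_trans with (/ (2 / eps)).
    + apply Cmod_inv_le_of; trivial. lra.
    + replace (/ (2 / eps)) with (eps / 2) by (field; lra). lra.
Qed.

(** Recurrence is phrased with [small], which a conjugacy transports, so that the lemma applies to
    the image of an orbit whose coordinates are otherwise unknown. Recurrence forces [z 0] to be
    nonzero, and then the clock makes [z] tend to 0. *)
Lemma recurrent_orbit_facts (p : C -> C) (q : C -> C -> C) (a b03 b30 : C) (th b c M r : R) :
  0 < r -> 0 < c -> b = 1 / 4 + c ^ 2 -> a = (b03 + RtoC th)%C ->
  base_bound p a M r -> fiber_bound q b b03 b30 M r ->
  let al := exp (PI / c) in
  exists r0, 0 < r0 /\ forall z w : nat -> C, orbit_from p q z w 0 ->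
    (forall j, small r0 (z j, w j)) ->
    (exists eps, 0 < eps /\ forall J, exists n, (J <= n)%nat /\ ~ small eps (z n, w n)) ->
    (forall eps, 0 < eps -> exists N, forall n, (N <= n)%nat -> Cmod (z n) < eps) /\
    forall eps, 0 < eps -> exists eps' D (N0 : nat), 0 < eps' /\ forall n, (N0 <= n)%nat -> eps <= Cmod (w n) ->
    (exists n', eps' <= Cmod (w n') /\
       Rabs (INR n' - al * INR n - th * (1 - al) * ln (INR n)) <= D) /\
    (forall n', INR n + D <= INR n' -> eps <= Cmod (w n') ->
       al * INR n + th * (1 - al) * ln (INR n) - D <= INR n').
Proof.
  intros Hr Hc Hb Ha Hp Hq al.
  destruct (@passage p q a b03 b30 th b c M r Hr Hc Hb Ha Hp Hq) as (r1 & Hr1 & Hpass). fold al in Hpass.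
  destruct (@clock_exists p a M r Hr Hp) as (r2 & Hr2 & Hclk).
  destruct (invariant_fiber_tends_0 q b b03 b30 M r Hr Hq) as (r3 & Hr3 & Hinv).
  assert (p0 : p 0 = 0).
  { assert (B := Hp 0). rewrite Cmod_0 in B. specialize (B Hr).
    apply Cmod_eq_0. apply Rle_antisym; [|apply Cmod_ge_0].
    replace (p 0) with (p 0 - (0 - 0 ^ 2 + a * 0 ^ 3))%C by ring.
    apply Rle_trans with (1 := B). simpl. lra. }
  exists (Rmin r1 (Rmin r2 r3)). split; [repeat apply Rmin_glb_lt; trivial|].
  intros z w Horb Hs (eps0 & He0 & Hrec).
  assert (S1 : forall j, small r1 (z j, w j)) by (intros j; apply small_le with (2 := Hs j), Rmin_l).
  assert (S2 : forall j, small r2 (z j, w j)).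
  { intros j; apply small_le with (2 := Hs j), Rle_trans with (1 := Rmin_r _ _), Rmin_l. }
  assert (S3 : forall j, small r3 (z j, w j)).
  { intros j; apply small_le with (2 := Hs j), Rle_trans with (1 := Rmin_r _ _), Rmin_r. }
  assert (Hz : forall j, z (S j) = p (z j)) by (intros j; apply (Horb j); lia).
  assert (Hw : forall j, w (S j) = q (z j) (w j)) by (intros j; apply (Horb j); lia).
  assert (z0 : z 0%nat <> 0).
  { intros E0. assert (Z : forall j, z j = 0) by (induction j as [|j IH]; [trivial|rewrite Hz, IH; trivial]).
    destruct (Hinv w) with (eps := eps0) as [N HN]; trivial.
    - intros j. rewrite Hw, Z. trivial.
    - intros j. apply S3.
    - destruct (Hrec N) as (n & Hn & Hn'). apply Hn'. split; simpl; [rewrite Z, Cmod_0|apply HN]; trivial. }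
  split.
  - intros eps Heps. destruct (Hclk z Hz) as (d & m & Hcl); [intros j; apply S2|trivial|].
    destruct (@clock_bound a (Cmod d)) as [N HN]. destruct (INR_ge_ev (4 / eps)) as [N' HN'].
    assert (e4 : 0 < 4 / eps) by (apply Rdiv_lt_0_compat; lra).
    exists (m + N + N')%nat. intros n Hn.
    apply Rle_lt_trans with (1 := HN d z m n (Rle_refl _) Hcl ltac:(lia) ltac:(lia)).
    specialize (HN' n ltac:(lia)).
    apply Rle_lt_trans with (2 / (4 / eps)).
    + apply Rmult_le_compat_l; [lra|]. apply Rinv_le_contravar; lra.
    + replace (2 / (4 / eps)) with (eps / 2) by (field; lra). lra.
  - apply (Hpass z w); trivial.
Qed.

Lemma linear_log_large (A B D : R) : 0 < A -> exists N : nat, forall n, (N <= n)%nat -> D < A * INR n + B * ln (INR n).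
Proof.
  intros HA. set (Q := (Rabs B + Rabs D + 1) / A).
  assert (b0 := Rabs_pos B). assert (d0 := Rabs_pos D). assert (d1 := Rle_abs D).
  assert (Q0 : 0 <= Q) by (left; unfold Q; apply Rdiv_lt_0_compat; lra).
  destruct (big_ev_INR Q) as [N HN]. exists N. intros n Hn. assert (H := HN n Hn).
  assert (L := ln_nonneg (INR n) (proj1 H)). apply big_lin in H; trivial.
  apply Rmult_le_compat_l with (r := A) in H; [|lra].
  replace (A * (Q * (1 + ln (INR n)))) with ((Rabs B + Rabs D + 1) * (1 + ln (INR n))) in H by (unfold Q; field; lra).
  assert (Rabs (B * ln (INR n)) <= Rabs B * ln (INR n)) by (rewrite Rabs_mult, (Rabs_pos_eq (ln _)); lra).
  apply Rabs_le_between in H0.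
  assert (0 <= Rabs D * ln (INR n)) by (apply Rmult_le_pos; trivial). lra.
Qed.

(** After a visible time [n] the first sequence is visible again near [al1 n + be1 ln n]. Both times
    are visible for the second sequence, which apart from a bounded shift is invisible until
    [al2 n + be2 ln n]. Large [n] compares the linear coefficients first, then the logarithmic ones.
    The opposite inequality comes from exchanging the roles. *)
Lemma passage_comparison (w1 w2 : nat -> C) (al1 be1 al2 be2 : R) :
  1 < al1 ->
  (forall eps, 0 < eps -> exists eps' D (N0 : nat), 0 < eps' /\ forall n, (N0 <= n)%nat -> eps <= Cmod (w1 n) ->
    exists n', eps' <= Cmod (w1 n') /\ Rabs (INR n' - al1 * INR n - be1 * ln (INR n)) <= D) ->
  (forall eps, 0 < eps -> exists D (N0 : nat), forall n, (N0 <= n)%nat -> eps <= Cmod (w2 n) ->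
    forall n', INR n + D <= INR n' -> eps <= Cmod (w2 n') -> al2 * INR n + be2 * ln (INR n) - D <= INR n') ->
  (forall eps, 0 < eps -> exists eps' (N : nat), 0 < eps' /\
    forall n, (N <= n)%nat -> eps <= Cmod (w1 n) -> eps' <= Cmod (w2 n)) ->
  (exists eps, 0 < eps /\ forall J, exists n, (J <= n)%nat /\ eps <= Cmod (w1 n)) ->
  al2 < al1 \/ (al2 = al1 /\ be2 <= be1).
Proof.
  intros Hal H1 H2 Htr (e1 & He1 & Hrec).
  destruct (H1 e1 He1) as (e1' & D1 & N1 & He1' & HD1).
  destruct (Htr e1 He1) as (f & N2 & Hf & Hf1). destruct (Htr e1' He1') as (f' & N3 & Hf' & Hf1').
  destruct (H2 (Rmin f f')) as (D2 & N4 & HD2); [apply Rmin_glb_lt; trivial|].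
  set (D2' := Rmax 0 D2). assert (D20 : 0 <= D2') by apply Rmax_l. assert (D21 : D2 <= D2') by apply Rmax_r.
  (* [al1 > 1] puts the new time beyond [n + D2], so it does not belong to the cluster of visible
     times around [n] that the second law leaves out. *)
  destruct (@linear_log_large (al1 - 1) be1 (D1 + D2')) as [N5 HN5]; [lra|].
  assert (Hfreq : forall J, exists n, (J <= n)%nat /\
     (al2 - al1) * INR n + (be2 - be1) * ln (INR n) <= D1 + D2).
  { intros J. destruct (Hrec (J + N1 + N2 + N3 + N4 + N5)%nat) as (n & Hn & Hv). exists n. split; [lia|].
    destruct (HD1 n ltac:(lia) Hv) as (n' & Hv' & HR). apply Rabs_le_between in HR.
    assert (B := HN5 n ltac:(lia)).
    assert (n <= n')%nat by (apply INR_le; lra).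
    assert (X := HD2 n ltac:(lia)).
    specialize (X ltac:(apply Rle_trans with (1 := Rmin_l _ _), Hf1; [lia|trivial]) n' ltac:(lra)).
    specialize (X ltac:(apply Rle_trans with (1 := Rmin_r _ _), Hf1'; [lia|trivial])). lra. }
  destruct (Rlt_le_dec al2 al1) as [|Hge]; [left; trivial|right].
  destruct (Rlt_le_dec al1 al2) as [Hlt|Hle].
  - exfalso. destruct (@linear_log_large (al2 - al1) (be2 - be1) (D1 + D2)) as [J HJ]; [lra|].
    destruct (Hfreq J) as (n & Hn & X). specialize (HJ n Hn). lra.
  - assert (E : al2 = al1) by lra. split; trivial.
    destruct (Rle_lt_dec be2 be1) as [|Hbe]; trivial. exfalso.
    destruct (INR_ge_ev (exp ((D1 + D2 + 1) / (be2 - be1)))) as [J HJ].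
    destruct (Hfreq J) as (n & Hn & X). specialize (HJ n Hn).
    rewrite E in X. assert (L : (D1 + D2 + 1) / (be2 - be1) <= ln (INR n)).
    { rewrite <- (ln_exp ((D1 + D2 + 1) / (be2 - be1))). apply ln_le; trivial. apply exp_pos. }
    apply Rmult_le_compat_l with (r := be2 - be1) in L; [|lra].
    replace ((be2 - be1) * ((D1 + D2 + 1) / (be2 - be1))) with (D1 + D2 + 1) in L by (field; lra). lra.
Qed.

(** A conjugacy mixes the coordinates, but as [z2] tends to 0, a late point outside a fixed polydisc
    is outside because of its second coordinate. *)
Lemma visibility_transfer (z1 w1 z2 w2 : nat -> C) :
  (forall e, 0 < e -> exists d, 0 < d /\ forall j, small d (z2 j, w2 j) -> small e (z1 j, w1 j)) ->
  (forall eps, 0 < eps -> exists N, forall n, (N <= n)%nat -> Cmod (z2 n) < eps) ->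
  forall eps, 0 < eps -> exists eps' (N : nat), 0 < eps' /\
    forall n, (N <= n)%nat -> eps <= Cmod (w1 n) -> eps' <= Cmod (w2 n).
Proof.
  intros H Hz eps Heps. destruct (H eps Heps) as (d & Hd & H1). destruct (Hz d Hd) as [N HN].
  exists d, N. split; trivial. intros n Hn Hv.
  destruct (Rle_lt_dec d (Cmod (w2 n))) as [|Hlt]; trivial. exfalso.
  destruct (H1 n) as [_ B]; [split; simpl; auto|]. simpl in B. lra.
Qed.

Lemma alpha_of_inj b b' : 1 / 4 < b -> 1 / 4 < b' -> alpha_of b = alpha_of b' -> b = b'.
Proof.
  unfold alpha_of, c_of. intros Hb Hb' E. apply exp_inv in E.
  assert (s1 : 0 < sqrt (4 * b - 1)) by (apply sqrt_lt_R0; lra).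
  assert (s2 : 0 < sqrt (4 * b' - 1)) by (apply sqrt_lt_R0; lra).
  assert (PI0 := PI_RGT_0).
  assert (E2 : sqrt (4 * b - 1) = sqrt (4 * b' - 1)).
  { apply Rmult_eq_reg_l with PI; [|lra].
    replace (PI * sqrt (4 * b - 1)) with (PI / (sqrt (4 * b' - 1) / 2) * (sqrt (4 * b - 1) * sqrt (4 * b' - 1)) / 2)
      by (field; lra).
    rewrite <- E. field. lra. }
  apply sqrt_inj in E2; lra.
Qed.

Theorem proposition1p15
  (p1 p2 : C -> C) (q1 q2 : C -> C -> C)
  (a1 a2 b03_1 b03_2 b30_1 b30_2 : C) (b1 b2 : R)
  (hol1 : holomorphic (skew_product p1 q1))
  (hol2 : holomorphic (skew_product p2 q2))
  (exp_p1 : base_expansion p1 a1)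
  (exp_p2 : base_expansion p2 a2)
  (exp_q1 : fiber_expansion q1 b1 b03_1 b30_1)
  (exp_q2 : fiber_expansion q2 b2 b03_2 b30_2)
  (hb1 : (1 / 4 < b1)%R)
  (hb2 : (1 / 4 < b2)%R)
  (beta1_real : Im (beta_of a1 b03_1 b1) = 0%R)
  (beta2_real : Im (beta_of a2 b03_2 b2) = 0%R)
  (hconj : topologically_conjugated_near_0 (skew_product p1 q1) (skew_product p2 q2)) :
  alpha_of b1 = alpha_of b2 /\
  beta_of a1 b03_1 b1 = beta_of a2 b03_2 b2 /\
  b1 = b2.
Proof.
  destruct (norm_form p1 q1 a1 b03_1 b30_1 b1 hol1 exp_p1 exp_q1 hb1 beta1_real)
    as (Al1 & th1 & M1 & r1 & Hr1 & Hc1 & Hb1 & Ha1 & Hp1 & Hq1 & Hcont1 & Hbe1).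
  destruct (norm_form p2 q2 a2 b03_2 b30_2 b2 hol2 exp_p2 exp_q2 hb2 beta2_real)
    as (Al2 & th2 & M2 & r2 & Hr2 & Hc2 & Hb2 & Ha2 & Hp2 & Hq2 & _ & Hbe2).
  destruct (recurrent_orbit_facts p1 q1 a1 b03_1 b30_1 th1 b1 (c_of b1) M1 r1 Hr1 Hc1 Hb1 Ha1 Hp1 Hq1)
    as (s1 & Hs1 & F1).
  destruct (recurrent_orbit_facts p2 q2 a2 b03_2 b30_2 th2 b2 (c_of b2) M2 r2 Hr2 Hc2 Hb2 Ha2 Hp2 Hq2)
    as (s2 & Hs2 & F2).
  fold (alpha_of b1) in F1. fold (alpha_of b2) in F2.
  destruct (conjugacy_local _ _ hconj) as (h & R0 & HR0 & Hh & Hh0 & Hg0).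
  destruct (Hh0 s2 Hs2) as (s3 & Hs3 & Hh2).
  set (rs := Rmin R0 (Rmin s1 s3)).
  assert (rs1 : rs <= R0) by apply Rmin_l.
  assert (rs2 : rs <= s1) by (apply Rle_trans with (1 := Rmin_r _ _), Rmin_l).
  assert (rs3 : rs <= s3) by (apply Rle_trans with (1 := Rmin_r _ _), Rmin_r).
  destruct (recurrent_orbit p1 q1 a1 b03_1 b30_1 th1 b1 (c_of b1) M1 r1 Hr1 Hc1 Hb1 Ha1 Hp1 Hq1 Hcont1 rs)
    as (z1 & w1 & eps1 & Horb1 & Hsm1 & _ & Heps1 & Hrec1); [repeat apply Rmin_glb_lt; trivial|].
  (* The image orbit. It does not come from the construction for the second map; its recurrence is
     inherited through [T12], which is what [recurrent_orbit_facts] asks for. *)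
  set (z2 := fun j => fst (h (z1 j, w1 j))). set (w2 := fun j => snd (h (z1 j, w1 j))).
  assert (HR : forall j, small R0 (z1 j, w1 j)) by (intros j; apply small_le with (1 := rs1), Hsm1).
  assert (Horb2 : orbit_from p2 q2 z2 w2 0).
  { intros j Hj. destruct (Horb1 j Hj) as [E1 E2].
    assert (E : h (z1 (S j), w1 (S j)) = skew_product p2 q2 (h (z1 j, w1 j))).
    { rewrite <- Hh; [unfold skew_product; simpl; rewrite E1, E2; trivial|apply HR|].
      unfold skew_product. simpl. rewrite <- E1, <- E2. apply HR. }
    unfold z2, w2. rewrite E. split; trivial. }
  assert (Hpair : forall j, small s2 (z2 j, w2 j)).
  { intros j. apply (Hh2 (z1 j, w1 j) (HR j)). apply small_le with (1 := rs3), Hsm1. }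
  assert (T12 : forall e, 0 < e -> exists d, 0 < d /\ forall j, small d (z2 j, w2 j) -> small e (z1 j, w1 j)).
  { intros e He. destruct (Hg0 e He) as (d & Hd & H). exists d. split; trivial.
    intros j Hj. apply (H (z1 j, w1 j) (HR j) Hj). }
  assert (T21 : forall e, 0 < e -> exists d, 0 < d /\ forall j, small d (z1 j, w1 j) -> small e (z2 j, w2 j)).
  { intros e He. destruct (Hh0 e He) as (d & Hd & H). exists d. split; trivial.
    intros j Hj. apply (H (z1 j, w1 j) (HR j) Hj). }
  assert (V1 : exists eps, 0 < eps /\ forall J, exists n, (J <= n)%nat /\ ~ small eps (z1 n, w1 n)).
  { exists eps1. split; trivial. intros J. destruct (Hrec1 J) as (n & Hn & Hv). exists n. split; trivial.
    intros [_ B]. simpl in B. lra. }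
  assert (V2 : exists eps, 0 < eps /\ forall J, exists n, (J <= n)%nat /\ ~ small eps (z2 n, w2 n)).
  { destruct V1 as (e & He & V). destruct (T12 e He) as (d & Hd & H). exists d. split; trivial.
    intros J. destruct (V J) as (n & Hn & Hv). exists n. auto. }
  destruct (F1 z1 w1 Horb1) as [Z1 P1]; trivial.
  { intros j. apply small_le with (1 := rs2), Hsm1. }
  destruct (F2 z2 w2 Horb2 Hpair V2) as [Z2 P2].
  assert (W12 := visibility_transfer z1 w1 z2 w2 T12 Z2).
  assert (W21 := visibility_transfer z2 w2 z1 w1 T21 Z1).
  assert (R1 : exists eps, 0 < eps /\ forall J, exists n, (J <= n)%nat /\ eps <= Cmod (w1 n)) by eauto.
  assert (R2 : exists eps, 0 < eps /\ forall J, exists n, (J <= n)%nat /\ eps <= Cmod (w2 n)).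
  { destruct (W12 eps1 Heps1) as (e & N & He & H). exists e. split; trivial.
    intros J. destruct (Hrec1 (J + N)%nat) as (n & Hn & Hv). exists n. split; [lia|]. apply H; [lia|trivial]. }
  assert (L12 : alpha_of b2 < alpha_of b1 \/
    (alpha_of b2 = alpha_of b1 /\ th2 * (1 - alpha_of b2) <= th1 * (1 - alpha_of b1))).
  { apply (passage_comparison w1 w2); trivial.
    - intros e He. destruct (P1 e He) as (e' & D & N & He' & H). exists e', D, N. split; trivial.
      intros n Hn Hv. apply (H n Hn Hv).
    - intros e He. destruct (P2 e He) as (e' & D & N & He' & H). exists D, N.
      intros n Hn Hv. apply (H n Hn Hv). }
  assert (L21 : alpha_of b1 < alpha_of b2 \/
    (alpha_of b1 = alpha_of b2 /\ th1 * (1 - alpha_of b1) <= th2 * (1 - alpha_of b2))).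
  { apply (passage_comparison w2 w1); trivial.
    - intros e He. destruct (P2 e He) as (e' & D & N & He' & H). exists e', D, N. split; trivial.
      intros n Hn Hv. apply (H n Hn Hv).
    - intros e He. destruct (P1 e He) as (e' & D & N & He' & H). exists D, N.
      intros n Hn Hv. apply (H n Hn Hv). }
  (* The two comparisons are compatible only when both coefficients agree. *)
  destruct L12 as [L12|[Eal Ebe]], L21 as [L21|[Eal' Ebe']]; try lra.
  split; [trivial|split].
  - rewrite Hbe1, Hbe2. apply f_equal. lra.
  - apply alpha_of_inj; trivial.
Qed.
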